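(* Let $d\in\{2,3\}$ and let $D\subset\mathbb{R}^d$ be a bounded open connected set with $C^1$ boundary. Let $f\in H^{-1}(D)$, $g\in L^2(D)$ (vector valued), and assume that $\phi$ may be extended to a function $\phi\in H^1(D)$. For $u\in L^\infty(D)$ let $p$ be the solution of $$-\nabla\cdot(e^u\nabla p)=f+\nabla\cdot g\ \text{ in }D,\qquad p=\phi\ \text{ on }\partial D.$$ Let $l_1,\dots,l_K$ be bounded linear functionals on $H^1(D)$ and $\mathcal{G}(u)=(l_1(p),\dots,l_K(p))\in\mathbb{R}^K$. Then there is a constant $C$, depending only on $D$, $K$, $\|f\|_{H^{-1}}$, $\|g\|_{L^2}$, $\|\phi\|_{H^1(D)}$ and the maximum over $j$ of the dual norms of the $l_j$, such that for any $u,u_1,u_2\in L^\infty(D)$ $$|\mathcal{G}(u)|\le C\exp\bigl(2\|u\|_{L^\infty(D)}\bigr)$$ and $$|\mathcal{G}(u_1)-\mathcal{G}(u_2)|\le C\exp\bigl(4\max\{\|u_1\|_{L^\infty},\|u_2\|_{L^\infty}\}\bigr)\|u_1-u_2\|_{L^\infty(D)}.$$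
   Context: Solutions are weak solutions $p\in H^1(D)$, with $p=\phi$ on $\partial D$ in the trace sense. $|\cdot|$ is the Euclidean norm on $\mathbb{R}^K$; the dual norm of $l_j$ is its norm as a bounded linear functional on $H^1(D)$. *)

(* Defs.v *)
From HB Require Import structures.
From mathcomp Require Import all_boot all_order all_algebra.
From mathcomp Require Import all_classical all_reals all_analysis.

Set Implicit Arguments.
Unset Strict Implicit.
Unset Printing Implicit Defensive.

Import Order.TTheory GRing.Theory Num.Theory.
Import numFieldNormedType.Exports.

Local Open Scope classical_set_scope.
Local Open Scope ring_scope.

(** * Lebesgue measure on R^n

    The sigma-algebra on ['rV[R]_n] is the one generated by the coordinate
    maps, that is, the Borel sigma-algebra.  Lebesgue measure is the iterated
    product of the one-dimensional [lebesgue_measure], transported along the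
    bijection between R * R^n and R^(1+n). *)

Fact rV_display : measure_display. Proof. exact: default_measure_display. Qed.

Section measurable_rV.
Context {R : realType} (n : nat).

Let coors : 'I_n -> 'rV[R]_n -> measurableTypeR R := fun i x => x ord0 i.

Let rV_set0 : g_sigma_preimage coors set0.
Proof. exact: sigma_algebra0. Qed.

Let rV_setC A : g_sigma_preimage coors A -> g_sigma_preimage coors (~` A).
Proof. exact: sigma_algebraC. Qed.

Let rV_bigcup (F : (set 'rV[R]_n)^nat) :
  (forall i, g_sigma_preimage coors (F i)) ->
  g_sigma_preimage coors (\bigcup_i (F i)).
Proof. exact: sigma_algebra_bigcup. Qed.

HB.instance Definition _ := @isMeasurable.Build rV_display
  'rV[R]_n (g_sigma_preimage coors) rV_set0 rV_setC rV_bigcup.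

Lemma measurable_coord (i : 'I_n) :
  measurable_fun [set: 'rV[R]_n] (fun v : 'rV[R]_n => v ord0 i : measurableTypeR R).
Proof.
move=> _ Y mY; rewrite setTI; apply: sub_sigma_algebra => /=.
rewrite -bigcup_seq/=; exists i => /=; first by rewrite mem_index_enum.
by exists Y => //; rewrite setTI.
Qed.

Lemma measurable_fun_rV d (T : measurableType d) (f : T -> 'rV[R]_n) :
  (forall i, measurable_fun [set: T] (fun t => f t ord0 i : measurableTypeR R)) ->
  measurable_fun [set: T] f.
Proof.
move=> mf.
pose S : set (set 'rV[R]_n) := [set A | measurable (f @^-1` A)].
suff sub : (measurable : set (set 'rV[R]_n)) `<=` S.
  by move=> _ A mA; rewrite setTI; exact: sub.
apply: smallest_sub.
  split; rewrite /S /=.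
  - by rewrite preimage_set0.
  - by move=> A mA; rewrite setTD preimage_setC; exact: measurableC.
  - by move=> F mF; rewrite preimage_bigcup; exact: bigcupT_measurable.
move=> A; rewrite -bigcup_seq/= => -[i _ [B mB <-]].
by rewrite /S /= setTI; have := mf i measurableT B mB; rewrite setTI.
Qed.

End measurable_rV.

Section lebesgue_rV.
Context {R : realType}.
Local Open Scope ereal_scope.

Definition rV_cons n (p : measurableTypeR R * 'rV[R]_n) : 'rV[R]_n.+1 :=
  \row_i (if unlift ord0 i is Some j then p.2 ord0 j else p.1).

Definition rV_uncons n (v : 'rV[R]_n.+1) : measurableTypeR R * 'rV[R]_n :=
  (v ord0 ord0, \row_j v ord0 (lift ord0 j)).

Lemma rV_consK n : cancel (@rV_cons n) (@rV_uncons n).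
Proof.
move=> [x v]; rewrite /rV_uncons /rV_cons mxE unlift_none; congr pair.
by apply/rowP => j; rewrite !mxE liftK.
Qed.

Lemma rV_unconsK n : cancel (@rV_uncons n) (@rV_cons n).
Proof.
move=> v; apply/rowP => i; rewrite !mxE /=.
by case: unliftP => [j ->|->]; rewrite ?mxE.
Qed.

Lemma measurable_rV_cons n : measurable_fun setT (@rV_cons n).
Proof.
apply: measurable_fun_rV => i; under eq_fun do rewrite mxE.
case: (unlift ord0 i) => [j|]; last exact: measurable_fst.
exact: (measurableT_comp (measurable_coord j) measurable_snd).
Qed.

Lemma measurable_rV_uncons n : measurable_fun setT (@rV_uncons n).
Proof.
apply/measurable_fun_pair; first exact: measurable_coord.
apply: measurable_fun_rV => i; under eq_fun do rewrite mxE.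
exact: measurable_coord.
Qed.

Section succ.
Variables (n : nat) (mu : {sigma_finite_measure set 'rV[R]_n -> \bar R}).

Definition lebesgue_rV_succ : set 'rV[R]_n.+1 -> \bar R :=
  pushforward (@lebesgue_measure R \x mu) (@rV_cons n).

Let mcons A : measurable A -> measurable (@rV_cons n @^-1` A).
Proof. by move=> mA; rewrite -[X in measurable X]setTI; exact: measurable_rV_cons. Qed.

Let succ0 : lebesgue_rV_succ set0 = 0.
Proof. by rewrite /lebesgue_rV_succ /pushforward preimage_set0 measure0. Qed.

Let succ_ge0 A : 0 <= lebesgue_rV_succ A.
Proof. by rewrite /lebesgue_rV_succ /pushforward measure_ge0. Qed.

Let succ_sigma_additive : semi_sigma_additive lebesgue_rV_succ.
Proof.
move=> F mF tF mUF; rewrite /lebesgue_rV_succ /pushforward preimage_bigcup.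
apply: measure_semi_sigma_additive.
- by move=> n'; exact: mcons.
- apply/trivIsetP => /= i j _ _ ij; rewrite -preimage_setI.
  by move/trivIsetP : tF => /(_ _ _ _ _ ij) ->//; rewrite preimage_set0.
- by rewrite -preimage_bigcup; exact: mcons.
Qed.

HB.instance Definition _ := isMeasure.Build _ _ _ lebesgue_rV_succ
  succ0 succ_ge0 succ_sigma_additive.

Let succ_sigma_finite : sigma_finite setT lebesgue_rV_succ.
Proof.
have /sigma_finiteP[F [TF ndF Foo]] := sigma_finiteT (@lebesgue_measure R).
have /sigma_finiteP[G [TG ndG Goo]] := sigma_finiteT mu.
exists (fun k => @rV_uncons n @^-1` (F k `*` G k)).
  rewrite -preimage_bigcup (_ : \bigcup_k _ = setT) ?preimage_setT//.
  apply/seteqP; split => // -[x v] _.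
  have [k _ Fx] : (\bigcup_k F k) x by rewrite -TF.
  have [l _ Gv] : (\bigcup_k G k) v by rewrite -TG.
  exists (maxn k l) => //; split.
    by move: x Fx; exact/subsetPset/ndF/leq_maxl.
  by move: v Gv; exact/subsetPset/ndG/leq_maxr.
move=> k; have [mF Fk] := Foo k; have [mG Gk] := Goo k; split.
  rewrite -[X in measurable X]setTI; apply: measurable_rV_uncons => //.
  exact: measurableX.
rewrite /lebesgue_rV_succ /pushforward (_ : _ @^-1` _ = F k `*` G k).
  by rewrite product_measure1E// lte_mul_pinfty// ge0_fin_numE.
by apply/funext => x; rewrite /preimage /mkset rV_consK.
Qed.

HB.instance Definition _ := Measure_isSigmaFinite.Build _ _ _ lebesgue_rV_succ
  succ_sigma_finite.

End succ.

Fixpoint lebesgue_rV n : {sigma_finite_measure set 'rV[R]_n -> \bar R} :=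
  match n with
  | 0%N => dirac (0%R : 'rV[R]_0)
  | n'.+1 => lebesgue_rV_succ (lebesgue_rV n')
  end.

Lemma lebesgue_rV_box n (A : 'I_n -> set (measurableTypeR R)) :
  (forall i, measurable (A i)) ->
  lebesgue_rV n [set x | forall i, A i (x ord0 i)]
    = \prod_(i < n) lebesgue_measure (A i).
Proof.
elim: n A => [|n IH] A mA.
  rewrite big_ord0 /= diracE mem_set//; exact: (fun i => False_ind _ (notF (ltn_ord i))).
have mB : measurable [set x : 'rV[R]_n | forall i, A (lift ord0 i) (x ord0 i)].
  rewrite (_ : mkset _ =
      \bigcap_(i in setT) ((fun x : 'rV[R]_n => x ord0 i) @^-1` A (lift ord0 i))).
    apply: fin_bigcap_measurable => // i _.
    by rewrite -[X in measurable X]setTI; exact: measurable_coord.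
  by apply/seteqP; split => [x xA i _|x xA i]; [exact: xA|exact: (xA i I)].
rewrite big_ord_recl -(IH (fun j => A (lift ord0 j)))// -product_measure1E//.
rewrite /= /lebesgue_rV_succ /pushforward; congr (_ _).
apply/seteqP; split => -[x v] /=.
  move=> H; split; first by have := H ord0; rewrite mxE unlift_none.
  by move=> i; have := H (lift ord0 i); rewrite mxE liftK.
move=> [xA vA] i; rewrite mxE.
by case: unliftP => [j ->|->].
Qed.

End lebesgue_rV.

(** * Euclidean structure, differentiability, C^1 domains *)

Section euclidean.
Context {R : realType} {n : nat}.
Implicit Types x y : 'rV[R]_n.

Definition dotv x y : R := \sum_(i < n) x ord0 i * y ord0 i.

(** The library norm [`|x|] on row vectors is the sup norm. *)
Definition enorm x : R := Num.sqrt (dotv x x).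

Definition partial (i : 'I_n) (f : 'rV[R]_n -> R) : 'rV[R]_n -> R :=
  fun x => 'D_(delta_mx ord0 i) f x.

Fixpoint Ck (k : nat) (f : 'rV[R]_n -> R) : Prop :=
  match k with
  | 0%N => continuous f
  | k'.+1 => continuous f /\
      forall i, (forall x, derivable f x (delta_mx ord0 i)) /\ Ck k' (partial i f)
  end.

Definition smooth f := forall k, Ck k f.

(** Elements of C_c^oo(D), extended by zero to the whole space. *)
Definition test_function (D : set 'rV[R]_n) : set ('rV[R]_n -> R) :=
  [set psi | smooth psi /\
    exists A, [/\ compact A, A `<=` D & forall x, ~ A x -> psi x = 0]].

Definition bd (D : set 'rV[R]_n) : set 'rV[R]_n := closure D `\` interior D.

End euclidean.

(** Near each boundary point, up to relabelling and reorienting the axes,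
    [D] is the set of points strictly above the graph of a C^1 function of
    the other n - 1 coordinates ([col' i x] is [x] with its [i]-th
    coordinate removed). *)
Definition C1_boundary {R : realType} {n : nat} (D : set 'rV[R]_n) : Prop :=
  forall x0, bd D x0 -> exists (i : 'I_n) (b : bool) (gam : 'rV[R]_n.-1 -> R),
    Ck 1 gam /\
    \forall x \near x0, D x <-> gam (col' i x) < (-1) ^+ b * x ord0 i.

(** * Surface measure

    [hausdorff s] is the [s]-dimensional Hausdorff outer measure built from
    the Euclidean diameter; it is a measure on Borel sets.  The normalising
    constant is omitted: it does not affect convergence in L^2 of the
    boundary. *)

Section hausdorff.
Context {R : realType} {n : nat}.
Local Open Scope ereal_scope.

Definition ediam (A : set 'rV[R]_n) : \bar R :=
  ereal_sup (0 |` [set (enorm (x - y))%:E | x in A & y in A]).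

Definition hausdorff_pre (s : nat) (delta : R) (A : set 'rV[R]_n) : \bar R :=
  ereal_inf [set \sum_(0 <= k <oo) ediam (U k) ^+ s | U in
    [set U : (set 'rV[R]_n)^nat |
      A `<=` \bigcup_k U k /\ forall k, ediam (U k) <= delta%:E]].

Definition hausdorff (s : nat) (A : set 'rV[R]_n) : \bar R :=
  ereal_sup [set hausdorff_pre s delta A | delta in [set delta : R | (0 < delta)%R]].

End hausdorff.

(** * Lebesgue and Sobolev spaces on D

    Elements are represented by functions on the whole space; only their
    values on [D], up to null sets, matter. *)

Section sobolev.
Context {R : realType} {d : nat}.
Variable D : set 'rV[R]_d.
Local Notation fn := ('rV[R]_d -> R).
Local Notation vfn := ('rV[R]_d -> 'rV[R]_d).
Local Notation leb := (@lebesgue_rV R d).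

Definition Lp (p : \bar R) : set fn :=
  [set f | measurable_fun D f /\ finite_norm leb p (f \_ D)].

Definition Lp_norm (p : \bar R) (f : fn) : R :=
  fine ('N[leb]_p[EFin \o (f \_ D)])%E.

Definition L2v : set vfn := [set g | forall i, Lp 2%:E (fun x => g x ord0 i)].

Definition L2v_norm (g : vfn) : R := Lp_norm 2%:E (fun x => enorm (g x)).

Definition weak_gradient (v : fn) (G : vfn) : Prop :=
  L2v G /\ forall psi, test_function D psi -> forall i,
    \int[leb]_(x in D) (v x * partial i psi x) =
    - \int[leb]_(x in D) (G x ord0 i * psi x).

Definition H1 : set fn :=
  [set v | Lp 2%:E v /\ exists G, weak_gradient v G].

(** A choice of the weak gradient, which is unique almost everywhere. *)
Definition grad (v : fn) : vfn := xget (fun=> 0) [set G | weak_gradient v G].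

Definition H1_norm (v : fn) : R :=
  Num.sqrt (Lp_norm 2%:E v ^+ 2 + L2v_norm (grad v) ^+ 2).

(** The trace operator is the continuous extension to H^1(D) of the
    restriction to the boundary of functions that are C^1 up to the boundary:
    [h] is the trace of [v] when [v] is a limit in H^1(D) of such functions
    whose boundary values converge to [h] in L^2 of the boundary. *)
Definition is_trace (v h : fn) : Prop :=
  [/\ measurable_fun (bd D) h,
      (\int[hausdorff d.-1]_(x in bd D) ((h x) ^+ 2)%:E < +oo)%E &
      exists w : fn^nat, [/\ forall k, Ck 1 (w k),
        H1_norm (w k \- v) @[k --> \oo] --> (0 : R) &
        (\int[hausdorff d.-1]_(x in bd D) ((w k x - h x) ^+ 2)%:E)%E
          @[k --> \oo] --> 0%E]].

Definition eq_trace (v w : fn) : Prop := exists h, is_trace v h /\ is_trace w h.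

(** H^1_0(D), the functions of H^1(D) with zero trace. *)
Definition H10 : set fn := [set v | H1 v /\ is_trace v (fun=> 0)].

(** Bounded linear functionals on a subspace [V] of H^1(D), for the full H^1
    norm; H^{-1}(D) is [dual H10].  Boundedness makes [l v] depend only on the
    almost-everywhere class of [v] in [D]. *)
Definition dual (V : set fn) : set (fn -> R) :=
  [set l | (forall (a : R) v w, V v -> V w ->
              l (fun x => a * v x + w x) = a * l v + l w) /\
           exists M : R, forall v, V v -> `|l v| <= M * H1_norm v].

Definition dual_norm (V : set fn) (l : fn -> R) : R :=
  sup [set `|l v| | v in [set v | V v /\ H1_norm v <= 1]].

(** Weak solutions of - div (e^u grad p) = f + div g in D, p = phi on the
    boundary of D. *)
Definition weak_solution (u : fn) (f : fn -> R) (g : vfn) (phi p : fn) : Prop :=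
  [/\ H1 p, eq_trace p phi &
      forall v, H10 v ->
        \int[leb]_(x in D) (expR (u x) * dotv (grad p x) (grad v x)) =
        f v - \int[leb]_(x in D) dotv (g x) (grad v x)].

End sobolev.

Definition observe {R : realType} {d K : nat}
  (l : 'I_K -> ('rV[R]_d -> R) -> R) (p : 'rV[R]_d -> R) : 'rV[R]_K :=
  \row_j l j p.

(* Main.v *)
Require Import Defs.
From HB Require Import structures.
From mathcomp Require Import all_boot all_order all_algebra.
From mathcomp Require Import all_classical all_reals all_analysis.
From mathcomp Require Import measurable_realfun ess_sup_inf.
From mathcomp Require Import ring lra.
Set Implicit Arguments.
Unset Strict Implicit.
Unset Printing Implicit Defensive.
Import Order.TTheory GRing.Theory Num.Theory.
Import numFieldNormedType.Exports.
Local Open Scope classical_set_scope.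
Local Open Scope ring_scope.

(** Both estimates come from testing the weak formulation, with [p - phi] and
    with [p1 - p2] respectively, which lie in H^1_0(D) because the traces agree;
    coercivity costs a factor [exp |u|], and
    [|exp a - exp b| <= exp (max a b) |a - b|] handles the difference of the
    coefficients.

    What has to be proved about D is the Poincare inequality on H^1_0(D), where
    the trace is defined through the Hausdorff measure of the boundary.  For
    [w] of class C^1, follow the first coordinate from a point of D to the exit
    point on the boundary: [w^2] at the point is at most [w^2] at the exit point
    plus the integral of [2 |w| |d_0 w|] over the slice.  The boundary term is
    integrated by covering the boundary with sets of small diameter, whose
    projections along the first coordinate are contained in cubes, so that it is
    bounded by the Hausdorff integral of [w^2], which tends to 0 along the
    sequence approximating an element of H^1_0(D).

    Linearity of the trace needs [int f <= 2 C (int a + int b)] for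
    [f <= C (a + b)] with respect to the Hausdorff outer measure, which is only
    known to be subadditive.  Almost everywhere uniqueness of weak gradients,
    needed since [grad] is a choice, follows by testing with products of
    functions [exp (-1 / t)]. *)

(** * Lebesgue measure on row vectors *)

(** Powers of the exponential, with [M] bounding the sup norms: inverting the coercivity constant
    [exp (-M)] costs [exp M], and moving the lifting [phi] to the right-hand side costs another,
    whence [exp (2 M)]. The difference [p1 - p2] solves an equation with source
    [(exp u2 - exp u1) grad p2]: [exp M] from coercivity, [exp M] from the coefficients and
    [exp (2 M)] from the bound on [p2] give [exp (4 M)]. Poincare enters twice, to absorb [f v] into
    the gradient and to return from the gradient to the full H^1 norm.

    The obstacle in Poincare is that an element of H^1_0(D) is only a limit of C^1 functions whose
    boundary values tend to 0; the approximants themselves need not vanish on the boundary. Hence an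
    inequality with a boundary remainder is proved for C^1 functions and passed to the limit. A
    slice of D may have infinitely many components, and its exit point depends on the slice in an
    uncontrolled way. Bounding the boundary values by a function of the last n coordinates alone
    makes any measurability of the exit point or parametrisation of the boundary unnecessary. *)

Section rV_measurability.
Context {R : realType}.

Lemma rV_ballP n (x y : 'rV[R]_n) (e : R) : 0 < e ->
  ball x e y <-> forall i, `|x ord0 i - y ord0 i| < e.
Proof.
move=> e0; split=> [[_ /(_ ord0)]//|h]; split=> // i j.
by rewrite (ord1 i); exact: h.
Qed.

Lemma measurable_forall n (P : 'I_n -> set (measurableTypeR R)) :
  (forall i, measurable (P i)) ->
  measurable [set x : 'rV[R]_n | forall i, P i (x ord0 i)].
Proof.
move=> mP.
rewrite (_ : mkset _ =
    \bigcap_(i in setT) ((fun x : 'rV[R]_n => x ord0 i) @^-1` P i)).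
  apply: fin_bigcap_measurable => // i _.
  by rewrite -[X in measurable X]setTI; exact: measurable_coord.
by apply/seteqP; split => [x xA i _|x xA i]; [exact: xA|exact: (xA i I)].
Qed.

Lemma rV_ball_measurable n (x : 'rV[R]_n) (e : R) : 0 < e ->
  measurable (ball x e).
Proof.
move=> e0; rewrite (_ : ball x e = [set y : 'rV[R]_n | forall i,
    `]x ord0 i - e, x ord0 i + e[%classic (y ord0 i)]).
  apply: (measurable_forall (P := fun i => `]x ord0 i - e, x ord0 i + e[%classic)).
  by move=> i; exact: measurable_itv.
apply/seteqP; split => y.
  move=> /(rV_ballP _ _ e0) h i; have := h i.
  by rewrite /= in_itv/= distrC ltr_distl.
move=> h; apply/rV_ballP => // i; have := h i.
by rewrite /= in_itv/= distrC ltr_distl.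
Qed.

(** The doubled radius leaves room in [A] for a closed cube around the smaller ball, so that
    compactly supported test functions fit. The 3 in the choice of [k] is one radius from [x] to the
    rational centre plus two for the larger ball. *)
Lemma rV_rational_ball n (A : set 'rV[R]_n) (x : 'rV[R]_n) : open A -> A x ->
  exists (q : 'rV[rat]_n) (k : nat),
    ball (map_mx ratr q : 'rV[R]_n) (k.+1%:R^-1) x /\
    ball (map_mx ratr q : 'rV[R]_n) (2 * k.+1%:R^-1) `<=` A.
Proof.
move=> oA Ax; have := open_nbhs_nbhs (conj oA Ax); rewrite -nbhs_ballE.
move=> -[e /= e0 eA].
have [k _ ke] : exists2 k : nat, True & (3 * k.+1%:R^-1 < e :> R)%R.
  exists (Num.truncn (3 / e)) => //; rewrite ltr_pdivrMr// mulrC -ltr_pdivrMr//.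
  exact: truncnS_gt.
have k0 : (0 : R) < k.+1%:R^-1 by rewrite invr_gt0.
have hq i : exists q : rat, `|x ord0 i - ratr q| < k.+1%:R^-1.
  have [|q] := @rat_in_itvoo R (x ord0 i - k.+1%:R^-1) (x ord0 i + k.+1%:R^-1).
    by move: k0; set c := k.+1%:R^-1 => k0; lra.
  by rewrite in_itv/= => h; exists q; rewrite distrC ltr_distl.
have [q qP] := choice hq.
exists (\row_i q i), k; split.
  by apply/rV_ballP => // i; rewrite !mxE distrC.
move=> y; have k20 : 0 < 2 * k.+1%:R^-1 :> R by rewrite mulr_gt0.
move=> /(rV_ballP _ _ k20) h; apply: eA; apply/rV_ballP => // i.
have := h i; have := qP i; rewrite !mxE => h1 h2.
rewrite (le_lt_trans (ler_distD (ratr (q i)) _ _))//.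
move: ke h1 h2; set c := k.+1%:R^-1 => ke h1 h2; lra.
Qed.

(** The sigma-algebra is generated by coordinates, not by open sets; an open set is a countable
    union of rational cubes, which are boxes. *)
Lemma open_measurable_rV n (A : set 'rV[R]_n) : open A -> measurable A.
Proof.
move=> oA.
pose B (p : 'rV[rat]_n * nat) : set 'rV[R]_n :=
  ball (map_mx ratr p.1 : 'rV[R]_n) (p.2.+1%:R^-1).
rewrite (_ : A = \bigcup_(p in [set p | B p `<=` A]) B p).
  rewrite bigcup_mkcond; apply: countable_bigcupT_measurable.
    exact: countableP.
  move=> p; case: ifP => // _.
  by apply: rV_ball_measurable; rewrite invr_gt0.
apply/seteqP; split => [x Ax|x [p] /= BA Bx]; last exact: BA.
have [q [k [qx qA]]] := rV_rational_ball oA Ax.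
exists (q, k) => //= y; rewrite /B/= => yq; apply: qA.
by apply: le_ball yq; rewrite ler_peMl// ?ler1n.
Qed.

Lemma closed_measurable_rV n (A : set 'rV[R]_n) : closed A -> measurable A.
Proof.
move=> cA; rewrite -[A]setCK; apply: measurableC; apply: open_measurable_rV.
by rewrite openC.
Qed.

Lemma continuous_measurable_rV n (f : 'rV[R]_n -> R) (D : set 'rV[R]_n) :
  measurable D -> continuous f -> measurable_fun D f.
Proof.
move=> mD /continuousP cf; apply: (@measurable_funTS _ _ _ _ D).
apply: (measurability _ (RGenOpens.measurableE R)).
move=> _ [_ [a [b ->]] <-]; rewrite setTI.
by apply: open_measurable_rV; apply: cf; exact: interval_open.
Qed.

End rV_measurability.

(** * Bounded sets and iterated integrals *)

Section lebesgue_rV_facts.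
Context {R : realType}.
Local Notation leb := (@lebesgue_rV R).

Lemma lebesgue_rV_bounded n (D : set 'rV[R]_n) : measurable D -> bounded_set D ->
  (leb n D < +oo)%E.
Proof.
move=> mD [M [Mr MD]].
have M1 : M < M + 1 by lra.
have := MD _ M1 => {}MD.
set B := [set x : 'rV[R]_n | forall i, `[- (M+1), M+1]%classic (x ord0 i)].
have mB : measurable B.
  apply: (measurable_forall (P := fun=> `[- (M+1), M+1]%classic)) => i.
  exact: measurable_itv.
apply: (@le_lt_trans _ _ (leb n B)).
  apply: le_measure; rewrite ?inE// => x Dx i /=.
  rewrite in_itv/= -ler_norml; apply: le_trans (MD _ Dx).
  rewrite [leRHS]mx_normrE.
  exact: (le_bigmax _ (fun i : 'I_1 * 'I_n => `|x i.1 i.2|) (ord0, i)).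
rewrite /B (lebesgue_rV_box (A := fun=> `[- (M+1), M+1]%classic)).
  rewrite -ge0_fin_numE ?prode_ge0//.
  apply: prode_fin_num => i _; rewrite lebesgue_measure_itv/=.
  by case: ifP.
by move=> i; exact: measurable_itv.
Qed.

Lemma ge0_integral_rVS n (h : 'rV[R]_n.+1 -> \bar R) :
  measurable_fun [set: 'rV[R]_n.+1] h -> (forall x, 0 <= h x)%E ->
  (\int[leb n.+1]_x h x =
   \int[leb n]_v \int[lebesgue_measure]_t h (rV_cons (t, v)))%E.
Proof.
move=> mh h0.
transitivity (\int[lebesgue_measure \x leb n]_p h (rV_cons p))%E.
  by rewrite -(preimage_setT (@rV_cons R n)) -ge0_integral_pushforward//;
    exact: measurable_rV_cons.
rewrite (fubini_tonelli2 (h \o @rV_cons R n))//=.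
by apply: measurableT_comp => //; exact: measurable_rV_cons.
Qed.


(** Both orders are needed by [integral_partial_0], where the inner integral must run over the
    variables containing the differentiated one. *)
Lemma integral_rVS n (h : 'rV[R]_n.+1 -> \bar R) :
  (leb n.+1).-integrable [set: 'rV[R]_n.+1] h ->
  (\int[leb n.+1]_x h x =
   \int[leb n]_v \int[lebesgue_measure]_t h (rV_cons (t, v)))%E /\
  (\int[leb n.+1]_x h x =
   \int[lebesgue_measure]_t \int[leb n]_v h (rV_cons (t, v)))%E.
Proof.
move=> ih; have mh := measurable_int _ ih.
have mc := @measurable_rV_cons R n.
have mhc : measurable_fun setT (h \o @rV_cons R n) by apply: measurableT_comp.
have ihc : (lebesgue_measure \x leb n)%E.-integrable setT (h \o @rV_cons R n).
  apply/integrableP; split => //=.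
  move/integrableP : ih => [_].
  rewrite /= /lebesgue_rV_succ ge0_integral_pushforward//=.
  by apply: measurableT_comp.
have -> : (\int[leb n.+1]_x h x =
    \int[lebesgue_measure \x leb n]_p h (rV_cons p))%E.
  by rewrite /= /lebesgue_rV_succ integral_pushforward//= preimage_setT.
split; first by rewrite -(integral21_prod_meas1 ihc).
by rewrite -(integral12_prod_meas1 ihc).
Qed.

End lebesgue_rV_facts.

(** * Partial derivatives along slices, and the vanishing integral of a derivative *)

Section calculus_rV.
Context {R : realType}.
Local Notation leb := (@lebesgue_rV R).

Lemma continuous_to_rV (T : topologicalType) n (f : T -> 'rV[R]_n) :
  (forall i, continuous (fun t => f t ord0 i)) -> continuous f.
Proof.
move=> cf t A [P Pft PA].
have : \forall s \near t, forall ij : 'I_1 * 'I_n, P ij.1 ij.2 (f s ij.1 ij.2).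
  apply: filter_forall => -[i j] /=; rewrite (ord1 i).
  by apply: (cf j t); have := Pft ord0 j.
by apply: filterS => s Ps; apply: PA => i j; exact: (Ps (i, j)).
Qed.

Lemma continuous_rV_consl n (v : 'rV[R]_n) :
  continuous (fun t : R => rV_cons (t, v)).
Proof.
apply: continuous_to_rV => i; under eq_fun do rewrite mxE.
by case: (unlift ord0 i) => [j|] /=; [exact: cst_continuous|exact: id].
Qed.

Lemma continuous_rV_consr n (t : R) :
  continuous (fun v : 'rV[R]_n => rV_cons (t, v)).
Proof.
apply: continuous_to_rV => i; under eq_fun do rewrite mxE.
case: (unlift ord0 i) => [j|] /=; last exact: cst_continuous.
exact: coord_continuous.
Qed.

Lemma rV_cons_addl n (s t : R) (v : 'rV[R]_n) :
  s *: delta_mx ord0 ord0 + rV_cons (t, v) = rV_cons (s + t, v).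
Proof.
apply/rowP => i; rewrite !mxE eqxx/=.
by case: unliftP => [j ->|->]/=; rewrite ?mulr0 ?add0r ?mulr1.
Qed.

Lemma rV_cons_addr n (s t : R) (v : 'rV[R]_n) j :
  s *: delta_mx ord0 (lift ord0 j) + rV_cons (t, v) =
  rV_cons (t, s *: delta_mx ord0 j + v).
Proof.
apply/rowP => i; rewrite !mxE eqxx/=.
case: unliftP => [k ->|->]/=; last by rewrite mulr0 add0r.
by rewrite (inj_eq lift_inj) !mxE eqxx.
Qed.

(** The two difference quotients are the same function, so derivatives transfer between spaces of
    different dimension without a chain rule. *)
Lemma eq_difference_quotient (V W : normedModType R) (f : V -> R) (g : W -> R)
    a v b w : (forall s : R, f (s *: v + a) = g (s *: w + b)) ->
  'D_v f a = 'D_w g b /\ (derivable f a v <-> derivable g b w).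
Proof.
move=> fg; have fg0 : f a = g b by have := fg 0; rewrite !scale0r !add0r.
rewrite /derive /derivable.
rewrite (_ : (fun h => h^-1 *: ((f \o shift a) (h *: v) - f a)) =
  (fun h => h^-1 *: ((g \o shift b) (h *: w) - g b)))//.
by apply/funext => s /=; rewrite fg fg0.
Qed.

Lemma derive_rV_consl n (h : 'rV[R]_n.+1 -> R) (t : R) (v : 'rV[R]_n) :
  'D_1 (fun t => h (rV_cons (t, v))) t = partial ord0 h (rV_cons (t, v)) /\
  (derivable (fun t => h (rV_cons (t, v))) t 1 <->
   derivable h (rV_cons (t, v)) (delta_mx ord0 ord0)).
Proof.
apply: (@eq_difference_quotient R _ (fun t => h (rV_cons (t, v)))) => s.
by rewrite rV_cons_addl -[s%:A]/(s * 1) mulr1.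
Qed.

Lemma derive_rV_consr n (h : 'rV[R]_n.+1 -> R) (t : R) (v : 'rV[R]_n) j :
  partial j (fun v => h (rV_cons (t, v))) v =
    partial (lift ord0 j) h (rV_cons (t, v)) /\
  (derivable (fun v => h (rV_cons (t, v))) v (delta_mx ord0 j) <->
   derivable h (rV_cons (t, v)) (delta_mx ord0 (lift ord0 j))).
Proof. by apply: eq_difference_quotient => s; rewrite rV_cons_addr. Qed.

Lemma rV_coord_le_norm n (x : 'rV[R]_n) i : `|x ord0 i| <= `|x|.
Proof.
rewrite [leRHS]mx_normrE.
exact: (le_bigmax _ (fun i : 'I_1 * 'I_n => `|x i.1 i.2|) (ord0, i)).
Qed.

Lemma rV_norm_le n (x : 'rV[R]_n) (M : R) : 0 <= M ->
  (forall i, `|x ord0 i| <= M) -> `|x| <= M.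
Proof.
move=> M0 h; rewrite [leLHS]mx_normrE; apply: bigmax_le => // -[i j] _ /=.
by rewrite (ord1 i).
Qed.

Lemma continuous_compact_support_integrable n (h : 'rV[R]_n -> R) (M : R) :
  continuous h -> (forall x, M < `|x| -> h x = 0) ->
  (leb n).-integrable [set: 'rV[R]_n] (EFin \o h).
Proof.
move=> ch h0; set B := [set x : 'rV[R]_n | `|x| <= M].
have cB : closed B.
  by apply: (@closed_comp _ _ (fun x : 'rV[R]_n => `|x|) [set y | y <= M]);
    [move=> x _; exact: norm_continuous|exact: closed_le].
have bB : bounded_set B.
  exists M; split; first exact: num_real.
  by move=> e Me x /= /le_trans; apply; exact: ltW.
have mB : measurable B by exact: closed_measurable_rV.
have -> : EFin \o h = (EFin \o h) \_ B.
  apply/funext => x; rewrite patchE; case: ifPn => //.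
  by rewrite notin_setE /B/= => /negP; rewrite -ltNge => /h0 ->.
apply/(integrable_mkcond _ mB).
apply: measurable_bounded_integrable => //.
- exact: lebesgue_rV_bounded.
- exact: continuous_measurable_rV.
- have := @continuous_compact _ _ h B (continuous_subspaceT ch)
    (bounded_closed_compact bB cB).
  move=> /compact_bounded [N [Nr hN]]; exists N; split => // e Ne x Bx.
  by apply: (hN _ Ne) => /=; exists x.
Qed.

Lemma partial_out n (i : 'I_n) (h : 'rV[R]_n -> R) (A : set 'rV[R]_n) x :
  closed A -> (forall y, ~ A y -> h y = 0) -> ~ A x -> partial i h x = 0.
Proof.
move=> cA h0 nAx; rewrite /partial -(derive_cst (0 : R) x (delta_mx ord0 i)).
apply: near_eq_derive.
have : nbhs x (~` A) by apply: open_nbhs_nbhs; split=> //; rewrite openC.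
by apply: filterS => y /h0.
Qed.

Lemma integral_derive1_0 (h : R -> R) (M : R) :
  (forall t, derivable h t 1) -> continuous (fun t => 'D_1 h t) ->
  (forall t, M < `|t| -> h t = 0) ->
  (\int[lebesgue_measure]_t ('D_1 h t)%:E = 0)%E.
Proof.
(* [h] has to vanish at the endpoints as well, and [M] may be negative. *)
move=> dh cdh h0; pose N : R := `|M| + 1.
have MN : M < N by rewrite /N (le_lt_trans (ler_norm M))// ltrDl.
have N0 : 0 < N by rewrite /N ltr_pwDr.
have h0' t : N <= `|t| -> h t = 0 by move=> /(lt_le_trans MN) /h0.
have D0 t : N < `|t| -> 'D_1 h t = 0.
  move=> Nt; rewrite -(derive_cst (0 : R) t (1 : R)).
  apply: near_eq_derive.
  have : \forall s \near t, N < `|s|.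
    exact: (cvgr_gt `|t| (@norm_continuous _ R t)).
  by apply: filterS => s Ns; rewrite h0'// ltW.
transitivity (\int[lebesgue_measure]_(t in `[(- N)%R, N]) ('D_1 h t)%:E)%E.
  rewrite [RHS]integral_mkcond; apply: eq_integral => t _.
  rewrite patchE; case: ifPn => //.
  rewrite notin_setE/= in_itv/= -ler_norml => /negP; rewrite -ltNge => Nt.
  by rewrite D0.
rewrite (@continuous_FTC2 _ _ h).
- by rewrite !h0' ?subee// ?normrN gtr0_norm.
- lra.
- exact: continuous_subspaceT.
- have ch : continuous h.
    by move=> t; apply/differentiable_continuous; exact/derivable1_diffP.
  by split => [x _||]; [exact: dh|apply: cvg_at_right_filter; exact: ch
    |apply: cvg_at_left_filter; exact: ch].
- by move=> x _; rewrite derive1E.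
Qed.

(** Induction on the dimension: for the first coordinate the inner one-dimensional integral vanishes
    by the fundamental theorem of calculus; for any other one, freeze the first coordinate and use
    the induction hypothesis. *)
Lemma integral_partial_0 n (i : 'I_n) (h : 'rV[R]_n -> R) (M : R) :
  (forall x, derivable h x (delta_mx ord0 i)) -> continuous (partial i h) ->
  (forall x, M < `|x| -> h x = 0) ->
  (\int[leb n]_x (partial i h x)%:E = 0)%E.
Proof.
elim: n i h => [[]//|n IH] i h dh ch h0.
have ih : (leb n.+1).-integrable [set: 'rV[R]_n.+1] (EFin \o partial i h).
  apply: (@continuous_compact_support_integrable _ _ M) => // x Mx.
  apply: (@partial_out _ _ _ [set x | `|x| <= M]).
  - by apply: (@closed_comp _ _ (fun x : 'rV[R]_n.+1 => `|x|) [set y | y <= M]);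
      [move=> y _; exact: norm_continuous|exact: closed_le].
  - by move=> y /= /negP; rewrite -ltNge; exact: h0.
  - by apply/negP; rewrite -ltNge.
have [F1 F2] := integral_rVS ih.
case: (unliftP ord0 i) => [j ij|i0].
  rewrite [LHS]F2; apply: integral0_eq => t _.
  rewrite -[RHS](IH j (fun v => h (rV_cons (t, v)))).
  - by apply: eq_integral => v _; rewrite /= (derive_rV_consr _ _ _ _).1 ij.
  - by move=> v; apply/(derive_rV_consr _ _ _ _).2; rewrite -ij; exact: dh.
  - rewrite (_ : partial _ _ = (partial i h) \o (fun v => rV_cons (t, v))).
      by move=> v; apply: continuous_comp; [exact: continuous_rV_consr|exact: ch].
    by apply/funext => v /=; rewrite (derive_rV_consr _ _ _ _).1 ij.
  - move=> v Mv; apply: h0; apply: (lt_le_trans Mv).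
    apply: rV_norm_le => // k.
    have := rV_coord_le_norm (rV_cons (t, v)) (lift ord0 k).
    by rewrite mxE liftK.
rewrite [LHS]F1; apply: integral0_eq => v _.
rewrite -[RHS](@integral_derive1_0 (fun t => h (rV_cons (t, v))) M).
- by apply: eq_integral => t _; rewrite /= (derive_rV_consl _ _ _).1 i0.
- by move=> t; apply/(derive_rV_consl _ _ _).2; rewrite -i0; exact: dh.
- rewrite (_ : (fun t => _) = (partial i h) \o (fun t => rV_cons (t, v))).
    by move=> t; apply: continuous_comp; [exact: continuous_rV_consl|exact: ch].
  by apply/funext => t /=; rewrite (derive_rV_consl _ _ _).1 i0.
- move=> t Mt; apply: h0; apply: (lt_le_trans Mt).
  have := rV_coord_le_norm (rV_cons (t, v)) ord0.
  by rewrite mxE unlift_none.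
Qed.

End calculus_rV.

(** * Test functions *)

Section flat_exponential.
Context {R : realType}.

(* Indexed by [m] so that the functions [flat_exp m] span a space stable under
   differentiation. *)
Definition flat_exp (m : nat) (t : R) : R :=
  if 0 < t then t^-1 ^+ m * expR (- t^-1) else 0.

(** Raise [1 + z <= exp z] at [z = y / (k + 1)] to the power [k + 1]. *)
Lemma expR_ge_pow (y : R) k : 0 <= y -> (y / k.+1%:R) ^+ k.+1 <= expR y.
Proof.
move=> y0; have {2}-> : y = k.+1%:R * (y / k.+1%:R) by rewrite mulrC divfK.
rewrite expRM_natl.
rewrite lerXn2r ?nnegrE ?divr_ge0 ?expR_ge0//.
by apply: le_trans (expR_ge1Dx _); rewrite lerDr.
Qed.

Lemma flat_exp_quadratic m : exists C : R, forall t,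
  `|flat_exp m t| <= C * t ^+ 2.
Proof.
exists (m.+2%:R ^+ m.+2) => t; rewrite /flat_exp; case: ifPn => t0; last first.
  by rewrite normr0 mulr_ge0 ?sqr_ge0// exprn_ge0.
have ti : 0 <= t^-1 by rewrite invr_ge0 ltW.
rewrite ger0_norm ?mulr_ge0 ?expR_ge0 ?exprn_ge0// expRN.
rewrite ler_pdivrMr ?expR_gt0//.
have := @expR_ge_pow t^-1 m.+1 ti.
rewrite expr_div_n ler_pdivrMr ?exprn_gt0// => h.
rewrite -mulrA [_ ^+ 2 * _]mulrC mulrCA mulrA.
rewrite -(ler_pM2r (_ : 0 < t^-1 ^+ 2)) ?exprn_gt0 ?invr_gt0//.
rewrite -[leRHS]mulrA -exprMn mulfV ?gt_eqF// expr1n mulr1.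
by rewrite -exprD addn2.
Qed.

Lemma is_derive_quadratic_zero (f : R -> R) (C : R) :
  (forall t, `|f t| <= C * t ^+ 2) -> is_derive (0 : R) (1 : R) f 0.
Proof.
move=> fC.
have f0 : f 0 = 0.
  by apply/normr0_eq0/le_anti; rewrite normr_ge0 (le_trans (fC 0))// expr0n/= mulr0.
have cv : (fun h : R => h^-1 *: ((f \o shift (0:R)) (h *: (1:R)) - f 0)) @ 0^' --> (0 : R).
  apply/cvgrPdist_le => /= e e0.
  have C1 : 0 < `|C| + 1 by rewrite ltr_pwDr.
  near=> h.
  rewrite f0 subr0 /= addr0 sub0r normrN -[h%:A]/(h * 1) mulr1 normrM normfV.
  have h0 : h != 0 by near: h; exact: nbhs_dnbhs_neq.
  rewrite mulrC ler_pdivrMr ?normr_gt0// (le_trans (fC h))//.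
  rewrite -(@real_normK _ h) ?num_real// expr2 mulrA.
  rewrite ler_pM2r ?normr_gt0//.
  have : `|h| <= e / (`|C| + 1) by near: h; apply: dnbhs0_le; rewrite divr_gt0.
  rewrite ler_pdivlMr// mulrC; apply: le_trans.
  by rewrite ler_wpM2r// (le_trans (ler_norm C))// lerDl.
apply: DeriveDef; first by apply/cvg_ex; exists 0.
exact: cvg_lim.
Unshelve. all: by end_near. Qed.

Lemma is_derive_flat_exp m (t : R) :
  is_derive t 1 (flat_exp m) (flat_exp m.+2 t - m%:R * flat_exp m.+1 t).
Proof.
have [t0|t0|->] := ltgtP t 0.
- rewrite /flat_exp ltNge (ltW t0)/= mulr0 subr0.
  have dc : is_derive t (1 : R) (cst (0 : R)) (0 : R) by exact: is_derive_cst.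
  apply: near_eq_is_derive dc.
  have : \forall y \near t, y < 0 by apply: open_nbhs_nbhs; split => //; exact: open_lt.
  by apply: filterS => y y0; rewrite ltNge (ltW y0).
- have dV : is_derive t 1 (fun y : R => y^-1) (- t ^- 2 *: 1).
    by apply: (@is_deriveV _ id); rewrite ?gt_eqF//.
  have dN : is_derive t 1 (fun y : R => - y^-1) (- (- t ^- 2 *: 1)).
    exact: (@is_deriveN _ _ _ (fun y : R => y^-1)).
  have dE := @is_derive1_comp _ _ _ t _ _ (is_derive_expR (- t^-1)) dN.
  have dX := @is_deriveX _ _ (fun y : R => y^-1) m t 1 _ dV.
  have := is_deriveM dX dE; rewrite exprfctE => dM.
  apply: (@near_eq_is_derive _ _ _ (fun y : R => y^-1 ^+ m * expR (- y^-1))).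
    have : \forall y \near t, 0 < y.
      by apply: open_nbhs_nbhs; split => //; exact: open_gt.
    by apply: filterS => y y0; rewrite /flat_exp y0.
  apply: (is_derive_eq dM); rewrite /flat_exp t0 /=.
  rewrite -![_ *: _]/(_ * _) exprVn.
  case: m {dX dM} => [|m] /=.
    by rewrite !mul0r mulr0 addr0 subr0 expr0; ring.
  rewrite -!exprVn; set u := t^-1; set w := expR _.
  by rewrite !exprS; ring.
- have [C Cm] := flat_exp_quadratic m.
  have := is_derive_quadratic_zero Cm.
  by rewrite /flat_exp ltxx mulr0 subr0.
Qed.

Lemma flat_exp_cvg1 (t : R) : 0 < t ->
  flat_exp 0 (k.+1%:R * t) @[k --> \oo] --> (1 : R).
Proof.
move=> t0.
rewrite (_ : (fun k : nat => _) = (fun k : nat => expR (- (t^-1 * k.+1%:R^-1)))).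
  rewrite -[X in _ --> X](expR0 R).
  apply: continuous_cvg; first exact: continuous_expR.
  rewrite -oppr0; apply: cvgN; rewrite -(mulr0 t^-1).
  by apply: cvgM; [exact: cvg_cst|exact: cvg_harmonic].
apply/funext => k; rewrite /flat_exp mulr_gt0// expr0 mul1r.
by rewrite invfM mulrC.
Qed.

Lemma flat_exp_le0 m (t : R) : t <= 0 -> flat_exp m t = 0.
Proof. by rewrite /flat_exp leNgt => /negbTE ->. Qed.

Lemma flat_exp_01 (t : R) : 0 <= flat_exp 0 t <= 1.
Proof.
rewrite /flat_exp; case: ifPn => t0; last by rewrite lexx ler01.
by rewrite expr0 mul1r expR_ge0 expR_le1 oppr_le0 invr_ge0 ltW.
Qed.

End flat_exponential.

(** * Smooth bumps on boxes *)

Section bump_functions.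
Context {R : realType} {n : nat}.

(** A class closed under partial derivatives, so smoothness to all orders is a single induction with
    no formula for higher derivatives. *)
Inductive flat_algebra : ('rV[R]_n -> R) -> Prop :=
| flat_cst c : flat_algebra (fun=> c)
| flat_coord m i a b : flat_algebra (fun x => flat_exp m (a * x ord0 i + b))
| flat_add f g : flat_algebra f -> flat_algebra g ->
    flat_algebra (fun x => f x + g x)
| flat_mul f g : flat_algebra f -> flat_algebra g ->
    flat_algebra (fun x => f x * g x).

Lemma derive_scale (f : R -> R) (t w : R) : derivable f t 1 ->
  derivable f t w /\ 'D_w f t = w * 'D_1 f t.
Proof.
move=> /derivable1_diffP df; split; first exact: diff_derivable.
rewrite !deriveE//.
have -> : 'd f t w = 'd f t (w *: (1 : R)) by rewrite -[_%:A]/(w * 1) mulr1.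
by rewrite linearZ.
Qed.

Lemma flat_coord_partial m i a b j (x : 'rV[R]_n) :
  derivable (fun x : 'rV[R]_n => flat_exp m (a * x ord0 i + b)) x (delta_mx ord0 j) /\
  partial j (fun x => flat_exp m (a * x ord0 i + b)) x =
   a * (i == j)%:R * (flat_exp m.+2 (a * x ord0 i + b)
     + - m%:R * flat_exp m.+1 (a * x ord0 i + b)).
Proof.
have dm := is_derive_flat_exp m (a * x ord0 i + b).
have [d1 d2] := @derive_scale (flat_exp m) _ (a * (i == j)%:R) (@ex_derive _ _ _ _ _ _ _ dm).
have [e1 e2] : partial j (fun x : 'rV[R]_n => flat_exp m (a * x ord0 i + b)) x =
   'D_(a * (i == j)%:R) (flat_exp m) (a * x ord0 i + b) /\
   (derivable (fun x : 'rV[R]_n => flat_exp m (a * x ord0 i + b)) x (delta_mx ord0 j)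
     <-> derivable (flat_exp m) (a * x ord0 i + b) (a * (i == j)%:R)).
  apply: eq_difference_quotient => s; rewrite !mxE eqxx/=.
  by congr (flat_exp _ _); rewrite -[_ *: _]/(_ * _) (eq_sym i); ring.
split; first exact/e2.
by rewrite e1 d2 (@derive_val _ _ _ _ _ _ _ dm) mulNr.
Qed.

Lemma flat_algebra_partial f : flat_algebra f -> forall j,
  (forall x, derivable f x (delta_mx ord0 j)) /\ flat_algebra (partial j f).
Proof.
elim=> [c|m i a b|{}f g _ Hf _ Hg|{}f g ff Hf fg Hg] j.
- split => [x|]; first exact: derivable_cst.
  rewrite (_ : partial j _ = fun=> 0); first exact: flat_cst.
  by apply/funext => x; exact: (derive_cst c x).
- split => [x|]; first exact: (flat_coord_partial m i a b j x).1.
  rewrite (_ : partial j _ = fun x => (a * (i == j)%:R) *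
     (flat_exp m.+2 (a * x ord0 i + b)
     + - m%:R * flat_exp m.+1 (a * x ord0 i + b))).
    apply: flat_mul; first exact: flat_cst.
    apply: flat_add; first exact: flat_coord.
    by apply: flat_mul; [exact: flat_cst|exact: flat_coord].
  by apply/funext => x; exact: (flat_coord_partial m i a b j x).2.
- have [df pf] := Hf j; have [dg pg] := Hg j; split => [x|].
    exact: (@derivableD _ _ _ f g).
  rewrite (_ : partial j _ = fun x => partial j f x + partial j g x).
    exact: flat_add.
  by apply/funext => x; exact: (@deriveD _ _ _ f g).
- have [df pf] := Hf j; have [dg pg] := Hg j; split => [x|].
    exact: (@derivableM _ _ f g).
  rewrite (_ : partial j _ = fun x => f x * partial j g x + g x * partial j f x).
    by apply: flat_add; exact: flat_mul.
  by apply/funext => x; exact: (@deriveM _ _ f g).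
Qed.

Lemma flat_exp_continuous m : continuous (@flat_exp R m).
Proof.
move=> t; apply: differentiable_continuous; apply/derivable1_diffP.
exact: (@ex_derive _ _ _ _ _ _ _ (is_derive_flat_exp m t)).
Qed.

Lemma flat_algebra_continuous f : flat_algebra f -> continuous f.
Proof.
elim=> [c|m i a b|{}f g _ Hf _ Hg|{}f g ff Hf fg Hg] x.
- exact: cst_continuous.
- apply: (@continuous_comp _ _ _ (fun x : 'rV[R]_n => a * x ord0 i + b)).
    apply: continuousD; last exact: cst_continuous.
    by apply: continuousM; [exact: cst_continuous|exact: coord_continuous].
  exact: flat_exp_continuous.
- by apply: (@continuousD _ _ _ f g x); [exact: Hf|exact: Hg].
- by apply: (@continuousM _ _ f g x); [exact: Hf|exact: Hg].
Qed.

Lemma flat_algebra_smooth f : flat_algebra f -> smooth f.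
Proof.
move=> ff k; elim: k f ff => [|k IH] f ff; first exact: flat_algebra_continuous.
split; first exact: flat_algebra_continuous.
move=> i; have [df pf] := flat_algebra_partial ff i; split => //.
exact: IH.
Qed.

(** Coordinatewise [exp (-1 / ((k+1)(x - a)))] times [exp (-1 / ((k+1)(b - x)))]: positive exactly
    on the open box, and tending to its indicator as [k] grows. *)
Definition box_bump (a b : 'rV[R]_n) (k : nat) (x : 'rV[R]_n) : R :=
  \prod_(i < n) (flat_exp 0 (k.+1%:R * (x ord0 i - a ord0 i)) *
                 flat_exp 0 (k.+1%:R * (b ord0 i - x ord0 i))).

Definition open_box (a b : 'rV[R]_n) : set 'rV[R]_n :=
  [set x | forall i, a ord0 i < x ord0 i < b ord0 i].

Definition closed_box (a b : 'rV[R]_n) : set 'rV[R]_n :=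
  [set x | forall i, a ord0 i <= x ord0 i <= b ord0 i].

Lemma box_bump_flat a b k : flat_algebra (box_bump a b k).
Proof.
rewrite /box_bump; elim: (index_enum _) => [|i s IH].
  rewrite (_ : (fun x => _) = fun=> 1); first exact: flat_cst.
  by apply/funext => x; rewrite big_nil.
rewrite (_ : (fun x => _) = fun x : 'rV[R]_n =>
  (flat_exp 0 (k.+1%:R * x ord0 i + - (k.+1%:R * a ord0 i)) *
  flat_exp 0 (- k.+1%:R * x ord0 i + k.+1%:R * b ord0 i)) *
  \prod_(i <- s) (flat_exp 0 (k.+1%:R * (x ord0 i - a ord0 i)) *
                 flat_exp 0 (k.+1%:R * (b ord0 i - x ord0 i)))).
  by apply: flat_mul => //; apply: flat_mul; exact: flat_coord.
apply/funext => x; rewrite big_cons; congr (_ * _ * _); congr flat_exp; ring.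
Qed.

Lemma box_bump_out a b k x : ~ open_box a b x -> box_bump a b k x = 0.
Proof.
move=> /existsNP[i /negP]; rewrite negb_and -!leNgt => h.
rewrite /box_bump (bigD1 i)//=.
case/orP: h => h; [rewrite [X in X * _ * _]flat_exp_le0|
    rewrite [X in _ * X * _]flat_exp_le0]; rewrite ?mulr0 ?mul0r//;
  by rewrite pmulr_rle0 ?subr_le0.
Qed.

Lemma box_bump_01 a b k x : 0 <= box_bump a b k x <= 1.
Proof.
rewrite /box_bump; apply/andP; split.
  apply: prodr_ge0 => i _.
  by rewrite mulr_ge0//; [have /andP[] := flat_exp_01 (k.+1%:R * (x ord0 i - a ord0 i))
    |have /andP[] := flat_exp_01 (k.+1%:R * (b ord0 i - x ord0 i))].
apply: prodr_ile1 => i _.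
have /andP[h1 h2] := flat_exp_01 (k.+1%:R * (x ord0 i - a ord0 i)).
have /andP[h3 h4] := flat_exp_01 (k.+1%:R * (b ord0 i - x ord0 i)).
by rewrite mulr_ge0//= mulr_ile1.
Qed.

Lemma cvg_prod (I : Type) (s : seq I) (F : I -> nat -> R) (l : I -> R) :
  (forall i, F i k @[k --> \oo] --> l i) ->
  \prod_(i <- s) F i k @[k --> \oo] --> \prod_(i <- s) l i.
Proof.
move=> Fl; elim: s => [|i s IH].
  by rewrite big_nil; under eq_fun do rewrite big_nil; exact: cvg_cst.
by rewrite big_cons; under eq_fun do rewrite big_cons; apply: cvgM.
Qed.

Lemma box_bump_cvg a b x :
  box_bump a b k x @[k --> \oo] --> (\1_(open_box a b) x : R).
Proof.
have [xab|xab] := pselect (open_box a b x); last first.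
  rewrite (_ : (fun k : nat => _) = fun=> 0); last first.
    by apply/funext => k; exact: box_bump_out.
  by rewrite indicE memNset//; exact: cvg_cst.
rewrite indicE mem_set//=.
have -> : 1%:R = \prod_(i < n) 1 :> R by rewrite big1.
rewrite /box_bump; apply: cvg_prod => i; rewrite -[X in _ --> X](mulr1 (1 : R)).
have /andP[h1 h2] := xab i.
by apply: cvgM; apply: flat_exp_cvg1; rewrite subr_gt0.
Qed.

Lemma box_bump_test (D : set 'rV[R]_n) a b k : closed_box a b `<=` D ->
  test_function D (box_bump a b k).
Proof.
move=> abD; split; first exact/flat_algebra_smooth/box_bump_flat.
exists (closed_box a b); split => //.
  have := @rV_compact _ n (fun i => `[a ord0 i, b ord0 i]%classic)
    (fun i => @segment_compact _ _ _).
  congr compact; apply/seteqP; split => x h i; have := h i;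
    by rewrite /= in_itv.
move=> x nx; apply: box_bump_out => h; apply: nx => i.
by have /andP[/ltW -> /ltW ->] := h i.
Qed.

End bump_functions.

(** * Fundamental lemma of the calculus of variations *)

Section fundamental_lemma.
Context {R : realType}.
Local Notation leb := (@lebesgue_rV R).

Lemma measurable_open_box n (a b : 'rV[R]_n) : measurable (open_box a b).
Proof.
rewrite (_ : open_box a b =
    [set x | forall i, `]a ord0 i, b ord0 i[%classic (x ord0 i)]).
  apply: (measurable_forall (P := fun i => `]a ord0 i, b ord0 i[%classic)) => i.
  exact: measurable_itv.
by apply/seteqP; split => x /= h i; have := h i; rewrite /= in_itv.
Qed.

(** Dominated convergence along the bumps of the box, with dominating function [|G|]. *)
Lemma integral_open_box_0 n (D : set 'rV[R]_n) (G : 'rV[R]_n -> R)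
    (a b : 'rV[R]_n) : measurable D ->
  (leb n).-integrable D (EFin \o G) ->
  (forall psi, test_function D psi -> \int[leb n]_(x in D) (G x * psi x) = 0) ->
  closed_box a b `<=` D ->
  (\int[leb n]_(x in open_box a b) (G x)%:E = 0)%E.
Proof.
move=> mD iG G0 abD; have mB := measurable_open_box a b.
have mG : measurable_fun D G by apply/measurable_EFinP; exact: measurable_int iG.
have mpsi k : measurable_fun D (box_bump a b k).
  by apply: continuous_measurable_rV => //; apply: flat_algebra_continuous;
    exact: box_bump_flat.
have bd k x : `|G x * box_bump a b k x| <= `|G x|.
  have /andP[h1 h2] := box_bump_01 a b k x.
  by rewrite normrM ler_piMr// ger0_norm.
have ik k : (leb n).-integrable D (EFin \o (fun x => G x * box_bump a b k x)).
  apply: le_integrable iG => //.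
    by apply/measurable_EFinP; apply: measurable_funM.
  by move=> x _ /=; rewrite lee_fin bd.
(* A zero [Rintegral] could be the default value of an infinite integral; integrability excludes
   this. *)
have zk k : (\int[leb n]_(x in D) (G x * box_bump a b k x)%:E = 0)%E.
  have := G0 _ (box_bump_test k abD); rewrite /Rintegral => h.
  by rewrite -[LHS]fineK ?h//; exact: integrable_fin_num (ik k).
have [] := @dominated_convergence _ _ _ (leb n) D mD
   (fun k x => (G x * box_bump a b k x)%:E)
   (fun x => (G x * \1_(open_box a b) x)%:E)
   (fun x => `|G x|%:E).
- by move=> k; apply: measurable_int (ik k).
- apply/measurable_EFinP; apply: measurable_funM => //.
- apply: aeW => x Dx; apply: cvg_EFin; first by near=> k.
  by apply: cvgM; [exact: cvg_cst|exact: box_bump_cvg].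
- exact: integrable_abse iG.
- by apply: aeW => x k Dx; rewrite /= lee_fin bd.
move=> _ _; under eq_fun do rewrite zk.
move=> /(cvg_unique _ (cvg_cst _)) /= E.
rewrite [RHS](E (@ereal_hausdorff R)).
rewrite [LHS]integral_mkcond [RHS]integral_mkcond; apply: eq_integral => x _.
rewrite !patchE indicE; case: ifPn => xB; last by rewrite mulr0; case: ifP.
rewrite mulr1 mem_set//; apply: abD => i.
by move: xB; rewrite inE => /(_ i) /andP[/ltW -> /ltW ->].
Unshelve. all: by end_near. Qed.

(** A family stable under intersection that generates the sigma-algebra; intersected with a cube,
    each member is again an open box. *)
Definition upper_corners n : set (set 'rV[R]_n) :=
  range (fun a : 'rV[R]_n => [set x : 'rV[R]_n | forall i, a ord0 i < x ord0 i]).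

Lemma measurable_upper_corners n :
  @measurable _ 'rV[R]_n = <<s @upper_corners n >>.
Proof.
apply/seteqP; split.
  apply: smallest_sub; first exact: smallest_sigma_algebra.
  move=> A; rewrite -bigcup_seq/= => -[i _ [B mB <-]]; rewrite setTI.
  pose S : set (set (measurableTypeR R)) :=
    [set B | <<s @upper_corners n >> ((fun x : 'rV[R]_n => x ord0 i) @^-1` B)].
  suff h : <<s @RGenOInfty.G R >> `<=` S.
    by apply: h; exact: (eq_ind _ (fun M : set (set R) => M B) mB _
      (RGenOInfty.measurableE R)).
  apply: smallest_sub.
    split; rewrite /S /=.
    - by rewrite preimage_set0; exact: sigma_algebra0.
    - by move=> C mC; rewrite setTD preimage_setC; exact: sigma_algebraC.
    - by move=> F mF; rewrite preimage_bigcup; exact: sigma_algebra_bigcup.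
  move=> _ [y ->]; rewrite /S /=.
  (* A half-space in the direction [i] is the increasing union of corners whose other coordinates
     are bounded below by [-k]. *)
  pose c (k : nat) : 'rV[R]_n := \row_j (if j == i then y else - k%:R).
  rewrite (_ : _ @^-1` _ =
      \bigcup_k [set x : 'rV[R]_n | forall j, c k ord0 j < x ord0 j]).
    apply: sigma_algebra_bigcup => k; apply: sub_sigma_algebra.
    by exists (c k).
  apply/seteqP; split => x /=.
    rewrite in_itv/= andbT => yx; exists (Num.truncn `|x|).+1 => // j.
    rewrite mxE; case: eqP => [->//|_].
    rewrite ltrNl; apply: le_lt_trans (truncnS_gt _).
    by rewrite (le_trans _ (rV_coord_le_norm x j))// -normrN ler_norm.
  by move=> [k _ /(_ i)]; rewrite /= mxE eqxx in_itv/= andbT.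
apply: smallest_sub; first exact: sigma_algebra_measurable.
move=> _ [a _ <-].
rewrite (_ : mkset _ =
    [set x : 'rV[R]_n | forall i, `]a ord0 i, +oo[%classic (x ord0 i)]).
  apply: (measurable_forall (P := fun i => `]a ord0 i, +oo[%classic)) => i.
  exact: measurable_itv.
by apply/seteqP; split => x h i; have := h i; rewrite /= in_itv/= andbT.
Qed.

Lemma upper_corners_setI n : setI_closed (@upper_corners n).
Proof.
move=> _ _ [a _ <-] [b _ <-].
exists (\row_i Num.max (a ord0 i) (b ord0 i)) => //.
apply/seteqP; split => x /=.
  by move=> h; split => i; have := h i; rewrite mxE gt_max => /andP[].
by move=> [h1 h2] i; rewrite mxE gt_max h1 h2.
Qed.

(** On a cube well inside [D], the integral of [G] vanishes over open boxes, hence over all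
    measurable subsets by a Dynkin argument, so [G] is null there. Countably many rational cubes
    exhaust [D]. *)
Lemma ae_eq0_of_test n (D : set 'rV[R]_n) (G : 'rV[R]_n -> R) : open D ->
  (leb n).-integrable D (EFin \o G) ->
  (forall psi, test_function D psi -> \int[leb n]_(x in D) (G x * psi x) = 0) ->
  {ae leb n, forall x, D x -> G x = 0}.
Proof.
move=> oD iG G0; have mD := open_measurable_rV oD.
pose B (p : 'rV[rat]_n * nat) : set 'rV[R]_n :=
  ball (map_mx ratr p.1 : 'rV[R]_n) (p.2.+1%:R^-1).
pose B2 (p : 'rV[rat]_n * nat) : set 'rV[R]_n :=
  ball (map_mx ratr p.1 : 'rV[R]_n) (2 * p.2.+1%:R^-1).
have key p : B2 p `<=` D -> {ae leb n, forall x, B p x -> G x = 0}.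
  case: p => q k; rewrite /B /B2 /=.
  have : (0 : R) < k.+1%:R^-1 by rewrite invr_gt0.
  set r : R := k.+1%:R^-1; set c : 'rV[R]_n := map_mx ratr q => r0 BD.
  have mQ : measurable (ball c r) by exact: rV_ball_measurable.
  have QD : ball c r `<=` D.
    by move=> x cx; apply: BD; apply: le_ball cx; rewrite ler_peMl ?ler1n// ltW.
  have r20 : 0 < 2 * r by rewrite mulr_gt0.
  have cbD (a b : 'rV[R]_n) : (forall i, c ord0 i - r <= a ord0 i) ->
      (forall i, b ord0 i <= c ord0 i + r) -> closed_box a b `<=` D.
    move=> ha hb x abx; apply: BD; apply/rV_ballP => // i.
    have := ha i; have := hb i; have /andP[] := abx i.
    rewrite distrC ltr_distl; lra.
  have iQ : (leb n).-integrable (ball c r) (EFin \o G) by exact: integrableS iG.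
  have iS S : measurable S -> (leb n).-integrable (S `&` ball c r) (EFin \o G).
    by move=> mS; apply: integrableS iQ => //; exact: measurableI.
  (* Intersecting with the fixed cube keeps all integrals finite and makes this class of sets stable
     under complements. *)
  pose P (S : set 'rV[R]_n) := (\int[leb n]_(x in S `&` ball c r) (G x)%:E = 0)%E.
  have PT : P setT.
    rewrite /P setTI.
    rewrite (_ : ball c r = open_box (c - const_mx r) (c + const_mx r)).
      by apply: (integral_open_box_0 mD iG G0); apply: cbD => i; rewrite !mxE.
    apply/seteqP; split => x.
      move=> /(rV_ballP _ _ r0) h i; have := h i.
      by rewrite distrC ltr_distl !mxE.
    move=> h; apply/rV_ballP => // i; have := h i.
    by rewrite distrC ltr_distl !mxE.
  have PS : forall S, measurable S -> P S.
    move=> S mS; move: (mS); rewrite measurable_upper_corners.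
    move: S {mS}; apply: (dynkin_induction (measurable_upper_corners n)) => //.
    - exact: upper_corners_setI.
    - move=> _ [a _ <-]; rewrite /P.
      rewrite (_ : _ `&` _ = open_box (\row_i Num.max (a ord0 i) (c ord0 i - r))
          (c + const_mx r)).
        apply: (integral_open_box_0 mD iG G0); apply: cbD => i; rewrite !mxE//.
        by rewrite le_max lexx orbT.
      apply/seteqP; split => x.
        move=> [h1 /(rV_ballP _ _ r0) h2] i; have := h2 i.
        by rewrite !mxE gt_max h1 distrC ltr_distl.
      move=> h; split; [move=> i|apply/rV_ballP => // i]; have := h i;
        rewrite !mxE gt_max; first by move=> /andP[/andP[]].
      by rewrite distrC ltr_distl => /andP[/andP[_ ->] ->].
    - move=> S mS PS; have mSC := measurableC mS.
      have E : ball c r = (S `&` ball c r) `|` (~` S `&` ball c r).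
        by rewrite -setIUl setUv setTI.
      move: PT; rewrite /P setTI [X in (\int[_]_(_ in X) _)%E = _ -> _]E.
      rewrite integral_setU//; first by rewrite PS add0e.
      + exact: measurableI.
      + exact: measurableI.
      + by rewrite -E; exact: measurable_int iQ.
      + by apply/disj_setPS => x [[Sx _] [nSx _]]; exact: nSx.
    - move=> F mF tF PF; rewrite /P setI_bigcupl integral_bigcup//.
      + by apply: eseries0 => k' _ _; exact: PF.
      + apply/trivIsetP => i j _ _ ij; rewrite setIACA.
        by move/trivIsetP : tF => /(_ _ _ I I ij) ->; rewrite set0I.
      + by move=> k'; exact: measurableI.
      + rewrite -setI_bigcupl; apply: iS; exact: bigcupT_measurable.
  have := @integral_ae_eq _ _ _ (leb n) (ball c r) mQ (cst 0%E) _ iQ.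
  move=> /(_ (measurable_cst _)) H.
  have {H} : ae_eq (leb n) (ball c r) (EFin \o G) (cst 0%E).
    apply: H => E EQ mE; rewrite integral0.
    by have := PS _ mE; rewrite /P setIidl.
  by apply: filterS => x /= h /h [].
(* Cubes whose double leaves [D] contribute the empty set, so the union can be indexed by all
   rational cubes and stay countable. *)
pose N p := if pselect (B2 p `<=` D) is left _ then
  [set x | ~ (B p x -> G x = 0)] else set0.
have nN : (leb n).-negligible (\bigcup_p N p).
  rewrite (_ : \bigcup_p N p =
      \bigcup_k (if unpickle k is Some p then N p else set0)).
    apply: negligible_bigcup => k.
    case: (unpickle k) => [p|]; last exact: negligible_set0.
    rewrite /N; case: pselect => [/key|_]; last exact: negligible_set0.
    by [].
  apply/seteqP; split => x.
    by move=> [p _ Np]; exists (pickle p) => //; rewrite pickleK.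
  by move=> [k _]; case: (unpickle k) => // p Np; exists p.
apply: negligibleS nN => x /= /not_implyP[Dx Gx].
have [q [k [qx qA]]] := rV_rational_ball oD Dx.
exists (q, k) => //; rewrite /N; case: pselect => // _ /=.
by move=> /(_ qx).
Qed.

End fundamental_lemma.

(** * Square-integrable and bounded functions *)

Lemma quadratic_cauchy_schwarz (R : realType) (a b c : R) : 0 <= a -> 0 <= c ->
  (forall t, 0 <= a - 2 * t * b + t ^+ 2 * c) -> b <= Num.sqrt a * Num.sqrt c.
Proof.
move=> a0 c0 h; have [b0|b0] := leP b 0; first by rewrite (le_trans b0)// mulr_ge0.
have := c0; rewrite le_eqVlt => /orP[/eqP c00|c1].
  (* If [c = 0] the quadratic is affine in [t]; this [t] gives it the value -1. *)
  have := h ((a + 1) / (2 * b)); rewrite -c00 mulr0 addr0.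
  have -> : 2 * ((a + 1) / (2 * b)) * b = a + 1 by field; rewrite gt_eqF.
  lra.
rewrite -sqrtrM// -[leLHS]gtr0_norm// -sqrtr_sqr; apply: ler_wsqrtr.
(* The minimiser of the quadratic. *)
have := h (b / c).
have -> : a - 2 * (b / c) * b + (b / c) ^+ 2 * c = (a * c - b ^+ 2) / c.
  by field; rewrite gt_eqF.
by rewrite pmulr_lge0 ?invr_gt0// subr_ge0.
Qed.

Section L2_facts.
Context {R : realType} {n : nat}.
Variable D : set 'rV[R]_n.
Hypothesis mD : measurable D.
Local Notation leb := (@lebesgue_rV R n).
Local Notation fn := ('rV[R]_n -> R).
Local Notation vfn := ('rV[R]_n -> 'rV[R]_n).
Local Notation integ f := (leb.-integrable D (EFin \o f)).
Local Notation L2 := (Lp D 2%:E).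
Local Notation "'I' f" := (\int[leb]_(x in D) f x) (at level 10).
Implicit Types (f g h : fn) (G H : vfn).

Lemma Lnorm2_poweR f :
  ('N[leb]_2%:E[EFin \o (f \_ D)] `^ 2 = \int[leb]_(x in D) (f x ^+ 2)%:E)%E.
Proof.
rewrite poweR_Lnorm// [RHS]integral_mkcond; apply: eq_integral => x _.
rewrite /= !patchE; case: ifPn => _.
  by rewrite (powR_mulrn 2)// real_normK// num_real.
by rewrite normr0 powR0.
Qed.

Lemma Lp2P f : L2 f <-> measurable_fun D f /\ integ (fun x => f x ^+ 2).
Proof.
split=> -[mf ff]; split => //.
  apply/integrableP; split.
    by apply/measurable_EFinP; exact: measurable_funX.
  under eq_integral do rewrite /= ger0_norm ?sqr_ge0//.
  by rewrite -Lnorm2_poweR; apply: poweR_lty.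
move/integrableP : ff => [_].
under eq_integral do rewrite /= ger0_norm ?sqr_ge0//.
rewrite -Lnorm2_poweR /finite_norm.
case: ('N[leb]_2%:E[_])%E (Lnorm_ge0 leb 2%:E (EFin \o f \_ D)) => [r||]//.
  by move=> _ _; exact: ltry.
by rewrite poweRyr.

Qed.

Lemma Lp2_measurable f : L2 f -> measurable_fun D f.
Proof. by case. Qed.

Lemma Lp2_sqr_integrable f : L2 f -> integ (fun x => f x ^+ 2).
Proof. by move=> /Lp2P[]. Qed.

Lemma Lp_norm_ge0 p f : 0 <= Lp_norm D p f.
Proof. by rewrite /Lp_norm fine_ge0// Lnorm_ge0. Qed.

Lemma Lp2_norm_sqr f : L2 f -> Lp_norm D 2%:E f ^+ 2 = I (fun x => f x ^+ 2).
Proof.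
move=> [mf ff]; have := Lnorm2_poweR f; rewrite /Rintegral => <-.
rewrite /Lp_norm; move: ff; rewrite /finite_norm.
case: ('N[leb]_2%:E[_])%E (Lnorm_ge0 leb 2%:E (EFin \o f \_ D)) => [r||]//=.
by rewrite lee_fin => r0 _; rewrite (powR_mulrn 2).
Qed.

Lemma Lp2_norm_sqrt f : L2 f -> Lp_norm D 2%:E f = Num.sqrt (I (fun x => f x ^+ 2)).
Proof.
by move=> f2; rewrite -Lp2_norm_sqr// sqrtr_sqr ger0_norm// Lp_norm_ge0.
Qed.

Lemma integ_le f g : measurable_fun D f -> integ g ->
  (forall x, D x -> `|f x| <= `|g x|) -> integ f.
Proof.
move=> mf ig fg; by apply: le_integrable ig => //; exact/measurable_EFinP.
Qed.

Lemma integ_le_ae f g : measurable_fun D f -> integ g ->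
  {ae leb, forall x, D x -> `|f x| <= `|g x|} -> integ f.
Proof.
move=> mf /integrableP[mg ig] fg; apply/integrableP; split.
  exact/measurable_EFinP.
apply: le_lt_trans ig; apply: ae_ge0_le_integral => //.
- by apply: measurableT_comp => //; exact/measurable_EFinP.
- by apply: measurableT_comp => //; exact/measurable_EFinP.
Qed.

Lemma integ_lin a b f g : integ f -> integ g ->
  integ (fun x => a * f x + b * g x).
Proof.
move=> jf jg.
rewrite (_ : _ \o _ = (fun x => a%:E * (f x)%:E) \+ (fun x => b%:E * (g x)%:E))%E//.
by apply: integrableD => //; exact: integrableZl.
Qed.

Lemma I_lin a b f g : integ f -> integ g ->
  I (fun x => a * f x + b * g x) = a * I f + b * I g.
Proof.
move=> jf jg; rewrite RintegralD//; first by rewrite !RintegralZl.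
  exact: (integrableZl mD _ jf).
exact: (integrableZl mD _ jg).
Qed.

Lemma Lp2_mul_integrable f g : L2 f -> L2 g -> integ (fun x => f x * g x).
Proof.
move=> /Lp2P[mf jf] /Lp2P[mg jg].
apply: (integ_le _ (integ_lin 1 1 jf jg)); first exact: measurable_funM.
move=> x _; rewrite !mul1r [leRHS]ger0_norm ?addr_ge0 ?sqr_ge0//.
rewrite normrM -(@real_normK _ (f x)) ?num_real// -(@real_normK _ (g x)) ?num_real//.
have := sqr_ge0 (`|f x| - `|g x|); have := normr_ge0 (f x); have := normr_ge0 (g x).
by nra.
Qed.

Lemma Lp2_lin a b f g : L2 f -> L2 g -> L2 (fun x => a * f x + b * g x).
Proof.
move=> /[dup] f2 /Lp2P[mf jf] /[dup] g2 /Lp2P[mg jg]; apply/Lp2P.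
have mab : measurable_fun D (fun x => a * f x + b * g x).
  by apply: measurable_funD; apply: measurable_funM.
split => //.
have := integ_lin 1 (2 * a * b)
  (integ_lin (a ^+ 2) (b ^+ 2) jf jg) (Lp2_mul_integrable f2 g2).
by apply: eq_integrable => // x _ /=; congr EFin; ring.
Qed.

Lemma Lp2_cauchy_schwarz f g : L2 f -> L2 g ->
  I (fun x => f x * g x) <= Lp_norm D 2%:E f * Lp_norm D 2%:E g.
Proof.
move=> f2 g2; rewrite !Lp2_norm_sqrt//; apply: quadratic_cauchy_schwarz.
- by apply: Rintegral_ge0 => x _; exact: sqr_ge0.
- by apply: Rintegral_ge0 => x _; exact: sqr_ge0.
move=> t.
have -> : I (fun x => f x ^+ 2) - 2 * t * I (fun x => f x * g x) +
   t ^+ 2 * I (fun x => g x ^+ 2) = I (fun x => (f x - t * g x) ^+ 2).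
  have jf := Lp2_sqr_integrable f2; have jg := Lp2_sqr_integrable g2.
  have jfg := Lp2_mul_integrable f2 g2.
  transitivity (1 * (1 * I (fun x => f x ^+ 2) + (- (2 * t)) * I (fun x => f x * g x))
     + t ^+ 2 * I (fun x => g x ^+ 2)); first by ring.
  rewrite -I_lin// -I_lin//; last exact: integ_lin.
  by apply: eq_Rintegral => x _; ring.
by apply: Rintegral_ge0 => x _; exact: sqr_ge0.
Qed.

(** [g - f] agrees almost everywhere with its absolute value, whose integral is nonnegative. *)
Lemma I_le f g : integ f -> integ g -> {ae leb, forall x, D x -> f x <= g x} ->
  I f <= I g.
Proof.
move=> jf jg fg; rewrite -subr_ge0.
have -> : I g - I f = I (fun x => 1 * g x + (-1) * f x).
  by rewrite I_lin// mul1r mulN1r.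
rewrite /Rintegral.
have -> : (\int[leb]_(x in D) (1 * g x + -1 * f x)%:E =
   \int[leb]_(x in D) `|(1 * g x + -1 * f x)%:E|)%E.
  have j := integ_lin 1 (-1) jg jf.
  apply: ae_eq_integral => //.
  - exact: measurable_int j.
  - by apply: measurableT_comp => //; exact: measurable_int j.
  - apply: filterS fg => x h Dx /=; rewrite ger0_norm// mul1r mulN1r subr_ge0.
    exact: h.
by apply: fine_ge0; exact: integral_ge0.
Qed.

Lemma I_eq_ae f g : measurable_fun D f -> measurable_fun D g ->
  {ae leb, forall x, D x -> f x = g x} -> I f = I g.
Proof.
move=> mf mg fg; rewrite /Rintegral; congr fine.
apply: ae_eq_integral => //; [exact/measurable_EFinP|exact/measurable_EFinP|].
by apply: filterS fg => x h Dx; rewrite h.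
Qed.

Lemma I_abs_le f : integ f -> `|I f| <= I (fun x => `|f x|).
Proof. by move=> jf; exact: le_normr_Rintegral. Qed.

Lemma Lp2_norm_eq_ae f g : L2 f -> L2 g ->
  {ae leb, forall x, D x -> f x = g x} -> Lp_norm D 2%:E f = Lp_norm D 2%:E g.
Proof.
move=> f2 g2 fg; rewrite !Lp2_norm_sqrt//; congr Num.sqrt.
apply: I_eq_ae.
- by apply: measurable_funX; exact: Lp2_measurable.
- by apply: measurable_funX; exact: Lp2_measurable.
by apply: filterS fg => x h Dx; rewrite h.
Qed.

Lemma Lp2_norm_le f g : L2 f -> L2 g ->
  {ae leb, forall x, D x -> `|f x| <= `|g x|} ->
  Lp_norm D 2%:E f <= Lp_norm D 2%:E g.
Proof.
move=> f2 g2 fg; rewrite !Lp2_norm_sqrt//; apply: ler_wsqrtr.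
apply: I_le; [exact: Lp2_sqr_integrable|exact: Lp2_sqr_integrable|].
apply: filterS fg => x h Dx.
rewrite -(@real_normK _ (f x)) ?num_real// -(@real_normK _ (g x)) ?num_real//.
by rewrite lerXn2r ?nnegrE//; exact: h.
Qed.

Lemma dotv_ge0 (x : 'rV[R]_n) : 0 <= dotv x x.
Proof. by apply: sumr_ge0 => i _; rewrite -expr2 sqr_ge0. Qed.

Lemma enorm_sqr (x : 'rV[R]_n) : enorm x ^+ 2 = dotv x x.
Proof. by rewrite sqr_sqrtr// dotv_ge0. Qed.

Lemma enorm_ge0 (x : 'rV[R]_n) : 0 <= enorm x.
Proof. exact: sqrtr_ge0. Qed.

Lemma dotvC (x y : 'rV[R]_n) : dotv x y = dotv y x.
Proof. by apply: eq_bigr => i _; rewrite mulrC. Qed.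

Lemma dotv_linl a b (x y z : 'rV[R]_n) :
  dotv (a *: x + b *: y) z = a * dotv x z + b * dotv y z.
Proof.
rewrite /dotv !mulr_sumr -big_split/=; apply: eq_bigr => i _.
by rewrite !mxE mulrDl !mulrA.
Qed.

Lemma dotv_cauchy_schwarz (x y : 'rV[R]_n) : `|dotv x y| <= enorm x * enorm y.
Proof.
suff h (z : 'rV[R]_n) : dotv x z <= enorm x * enorm z.
  rewrite ler_norml h andbT lerNl.
  have := h (-1 *: y + 0 *: 0).
  rewrite dotvC dotv_linl mulN1r mul0r addr0 dotvC => /le_trans; apply.
  rewrite le_eqVlt; apply/orP; left; apply/eqP; congr (_ * _).
  rewrite /enorm dotv_linl dotvC dotv_linl mul0r addr0 mul0r addr0.
  by rewrite mulN1r mulN1r opprK.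
apply: quadratic_cauchy_schwarz; [exact: dotv_ge0|exact: dotv_ge0|move=> t].
have -> : dotv x x - 2 * t * dotv x z + t ^+ 2 * dotv z z =
    dotv (1 *: x + (- t) *: z) (1 *: x + (- t) *: z).
  by rewrite dotv_linl ![dotv _ (_ + _)]dotvC !dotv_linl (dotvC z x); ring.
exact: dotv_ge0.
Qed.

Lemma coord_le_enorm (x : 'rV[R]_n) i : `|x ord0 i| <= enorm x.
Proof.
rewrite -sqrtr_sqr ler_wsqrtr// /dotv (bigD1 i)//= -expr2 lerDl.
by apply: sumr_ge0 => j _; rewrite -expr2 sqr_ge0.
Qed.

Lemma integ_sum (s : seq 'I_n) (F : 'I_n -> fn) : (forall i, integ (F i)) ->
  integ (fun x => \sum_(i <- s) F i x).
Proof.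
move=> jF; elim: s => [|i s IH].
  under eq_fun do rewrite /= big_nil.
  exact: integrable0.
have := integ_lin 1 1 (jF i) IH.
apply: eq_integrable => // x _; rewrite /= big_cons !mul1r.
by [].
Qed.

Lemma dotv_integrable G H : L2v D G -> L2v D H ->
  integ (fun x => dotv (G x) (H x)).
Proof.
move=> G2 H2; apply: integ_sum => i.
exact: (Lp2_mul_integrable (G2 i) (H2 i)).
Qed.

Lemma enorm_measurable G : L2v D G -> measurable_fun D (fun x => enorm (G x)).
Proof.
move=> G2; apply: (measurableT_comp (f := @Num.sqrt R)).
  exact: (continuous_measurable_fun (@sqrt_continuous R)).
by apply/measurable_EFinP; exact: measurable_int (dotv_integrable G2 G2).
Qed.

Lemma enorm_Lp2 G : L2v D G -> L2 (fun x => enorm (G x)).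
Proof.
move=> G2; apply/Lp2P; split; first exact: enorm_measurable.
under eq_fun do rewrite /= enorm_sqr; exact: dotv_integrable.
Qed.

Lemma L2v_norm_sqr G : L2v D G -> L2v_norm D G ^+ 2 = I (fun x => dotv (G x) (G x)).
Proof.
move=> G2; rewrite /L2v_norm Lp2_norm_sqr; last exact: enorm_Lp2.
by apply: eq_Rintegral => x _; rewrite enorm_sqr.
Qed.

Lemma L2v_lin a b G H : L2v D G -> L2v D H -> L2v D (fun x => a *: G x + b *: H x).
Proof.
move=> G2 H2 i; under eq_fun do rewrite !mxE.
exact: (Lp2_lin _ _ (G2 i) (H2 i)).
Qed.

Lemma weighted_dotv_integrable (c : fn) M G H : measurable_fun D c ->
  {ae leb, forall x, D x -> `|c x| <= M} -> L2v D G -> L2v D H ->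
  integ (fun x => c x * dotv (G x) (H x)).
Proof.
move=> mc cM G2 H2; have j := dotv_integrable G2 H2.
apply: (integ_le_ae _ (integ_lin M 0 j j)).
  by apply: measurable_funM => //; apply/measurable_EFinP; exact: measurable_int j.
apply: filterS cM => x h Dx; rewrite mul0r addr0 !normrM.
by rewrite ler_wpM2r// (le_trans (h Dx))// ler_norm.
Qed.

Lemma weighted_cauchy_schwarz (c : fn) M G H : measurable_fun D c ->
  {ae leb, forall x, D x -> `|c x| <= M} -> L2v D G -> L2v D H -> 0 <= M ->
  `|I (fun x => c x * dotv (G x) (H x))| <= M * (L2v_norm D G * L2v_norm D H).
Proof.
move=> mc cM G2 H2 M0.
have j := weighted_dotv_integrable mc cM G2 H2.
have k := Lp2_mul_integrable (enorm_Lp2 G2) (enorm_Lp2 H2).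
apply: (le_trans (I_abs_le j)).
apply: (@le_trans _ _ (I (fun x => M * (enorm (G x) * enorm (H x)) + 0 *
    (enorm (G x) * enorm (H x))))).
  apply: I_le; [exact: integrable_norm|exact: integ_lin|].
  apply: filterS cM => x h Dx; rewrite mul0r addr0 normrM.
  apply: ler_pM => //; [exact: h|exact: dotv_cauchy_schwarz].
rewrite I_lin// mul0r addr0 ler_wpM2l//.
exact: Lp2_cauchy_schwarz (enorm_Lp2 G2) (enorm_Lp2 H2).
Qed.

Lemma L2v_cauchy_schwarz G H : L2v D G -> L2v D H ->
  `|I (fun x => dotv (G x) (H x))| <= L2v_norm D G * L2v_norm D H.
Proof.
move=> G2 H2.
have := @weighted_cauchy_schwarz (cst 1) 1 G H (measurable_cst _) _ G2 H2 ler01.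
rewrite mul1r /=; under eq_Rintegral do rewrite mul1r.
by apply; apply: aeW => x _; rewrite normr1.
Qed.

Lemma Loo_bound (u : fn) : Lp D +oo%E u ->
  {ae leb, forall x, D x -> `|u x| <= Lp_norm D +oo%E u}.
Proof.
move=> [mu]; rewrite /finite_norm /Lp_norm unlock /=.
(* The norm is 0 by convention when the whole space is null, and then any statement holds almost
   everywhere. In the other case [m0] makes the essential supremum nonnegative, hence finite. *)
case: ifPn => [m0|]; last first.
  rewrite -leNgt => m0 _; have {}m0 : leb setT = 0%E.
    by apply/eqP; rewrite eq_le m0 measure_ge0.
  by exists setT; split.
set f := abse \o _ => foo.
have := ess_sup_ge leb f; apply: filterS => x h Dx.
have fin : ess_sup leb f \is a fin_num.
  rewrite ge0_fin_numE//; apply: ess_sup_gee => //.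
  by apply: aeW => y; rewrite /f/=.
move: h; rewrite -(fineK fin) /f /= patchE mem_set// lee_fin.
Qed.

Lemma Loo_sub (u w : fn) : Lp D +oo%E u -> Lp D +oo%E w -> Lp D +oo%E (u \- w).
Proof.
move=> Lu Lw; split; first by apply: measurable_funB; [case: Lu|case: Lw].
rewrite /finite_norm unlock /=; case: ifPn => // _.
apply: (@le_lt_trans _ _ ((Lp_norm D +oo%E u + Lp_norm D +oo%E w)%:E));
  last exact: ltry.
apply/ess_supP; apply: filterS2 (Loo_bound Lu) (Loo_bound Lw) => x hu hw /=.
rewrite patchE lee_fin; case: ifPn => xD.
  move: xD; rewrite inE => xD.
  by rewrite (le_trans (ler_normB _ _))// lerD//; [exact: hu|exact: hw].
by rewrite normr0 addr_ge0// Lp_norm_ge0.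
Qed.

End L2_facts.

(** * Weak gradients *)

Section weak_gradients.
Context {R : realType} {n : nat}.
Variable D : set 'rV[R]_n.
Hypotheses (oD : open D) (bD : bounded_set D).
Local Notation leb := (@lebesgue_rV R n).
Local Notation fn := ('rV[R]_n -> R).
Local Notation vfn := ('rV[R]_n -> 'rV[R]_n).
Local Notation integ f := (leb.-integrable D (EFin \o f)).
Local Notation L2 := (Lp D 2%:E).
Local Notation "'I' f" := (\int[leb]_(x in D) f x) (at level 10).
Implicit Types (f g h v w : fn) (G H : vfn).

Let mD : measurable D := open_measurable_rV oD.

Lemma bounded_in_ball : exists2 M : R, 0 < M & forall x, D x -> `|x| <= M.
Proof.
have [M [Mr DM]] := bD; exists (`|M| + 1); first by rewrite ltr_pwDr.
by apply: DM; rewrite (le_lt_trans (ler_norm M))// ltrDl.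
Qed.

Lemma closed_norm_ball (M : R) : closed [set x : 'rV[R]_n | `|x| <= M].
Proof.
by apply: (@closed_comp _ _ (fun x : 'rV[R]_n => `|x|) [set y | y <= M]);
  [move=> y _; exact: norm_continuous|exact: closed_le].
Qed.

Lemma compact_norm_ball (M : R) : compact [set x : 'rV[R]_n | `|x| <= M].
Proof.
apply: bounded_closed_compact; last exact: closed_norm_ball.
exists M; split; first exact: num_real.
by move=> e Me x /= /le_trans; apply; exact: ltW.
Qed.

Lemma continuous_integrable f : continuous f -> integ f.
Proof.
move=> cf; apply: measurable_bounded_integrable => //.
- exact: lebesgue_rV_bounded.
- exact: continuous_measurable_rV.
have [M M0 DM] := bounded_in_ball.
have := @continuous_compact _ _ f _ (continuous_subspaceT cf)
  (compact_norm_ball (M := M)).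
move=> /compact_bounded [N [Nr hN]]; exists N; split => // e Ne x Dx.
by apply: (hN _ Ne) => /=; exists x => //; exact: DM.
Qed.

Lemma continuous_Lp2 f : continuous f -> L2 f.
Proof.
move=> cf; apply/Lp2P => //; split; first exact: continuous_measurable_rV.
by apply: continuous_integrable => x; apply: (@continuousM _ _ f f x); exact: cf.
Qed.

Lemma Lp2_integrable f : L2 f -> integ f.
Proof.
move=> f2; have c1 : L2 (fun=> 1) by apply: continuous_Lp2; exact: cst_continuous.
have := Lp2_mul_integrable mD f2 c1; apply: eq_integrable => // x _ /=.
by rewrite mulr1.
Qed.

Lemma test_function_Lp2 psi i : test_function D psi -> L2 psi /\ L2 (partial i psi).
Proof.
move=> [sm _]; have [c0 /(_ i)[_ c1]] := sm 1%N.
by split; exact: continuous_Lp2.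
Qed.

Lemma weak_gradient_lin a b v w G H : L2 v -> L2 w ->
  weak_gradient D v G -> weak_gradient D w H ->
  weak_gradient D (fun x => a * v x + b * w x) (fun x => a *: G x + b *: H x).
Proof.
move=> v2 w2 [G2 hG] [H2 hH]; split; first exact: L2v_lin.
move=> psi tpsi i; have [p0 p1] := test_function_Lp2 i tpsi.
transitivity (a * I (fun x => v x * partial i psi x) +
              b * I (fun x => w x * partial i psi x)).
  rewrite -I_lin//; [|exact: Lp2_mul_integrable|exact: Lp2_mul_integrable].
  by apply: eq_Rintegral => x _; ring.
rewrite hG// hH//.
transitivity (- (a * I (fun x => G x ord0 i * psi x) +
              b * I (fun x => H x ord0 i * psi x))); first by ring.
rewrite -I_lin//; [|exact: (Lp2_mul_integrable mD (G2 i) p0)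
  |exact: (Lp2_mul_integrable mD (H2 i) p0)].
by congr (- _); apply: eq_Rintegral => x _; rewrite !mxE; ring.
Qed.

(** Each component of [G - H] integrates to 0 against every test function, so [ae_eq0_of_test]
    applies; there are finitely many components. *)
Lemma weak_gradient_unique v G H : weak_gradient D v G -> weak_gradient D v H ->
  {ae leb, forall x, D x -> G x = H x}.
Proof.
move=> [G2 hG] [H2 hH].
have key i : {ae leb, forall x, D x -> G x ord0 i - H x ord0 i = 0}.
  have d2 := Lp2_lin mD 1 (-1) (G2 i) (H2 i).
  apply: (ae_eq0_of_test oD).
    have := Lp2_integrable d2; apply: eq_integrable => // x _ /=.
    by rewrite mul1r mulN1r.
  move=> psi tpsi; have [p0 p1] := test_function_Lp2 i tpsi.
  transitivity (1 * I (fun x => G x ord0 i * psi x) +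
              (-1) * I (fun x => H x ord0 i * psi x)).
    rewrite -I_lin//; [|exact: (Lp2_mul_integrable mD (G2 i) p0)
      |exact: (Lp2_mul_integrable mD (H2 i) p0)].
    by apply: eq_Rintegral => x _; ring.
  have := hG _ tpsi i; rewrite (hH _ tpsi i) => /oppr_inj ->.
  by rewrite mul1r mulN1r subrr.
have : {ae leb, forall x i, D x -> G x ord0 i - H x ord0 i = 0}.
  exact: filter_forall.
apply: filterS => x h Dx; apply/rowP => i.
by apply/eqP; rewrite -subr_eq0 h.
Qed.

Lemma grad_weak v : H1 D v -> weak_gradient D v (grad D v).
Proof. by move=> [_ [G hG]]; rewrite /grad; exact: (xgetPex _ (ex_intro _ G hG)). Qed.

Lemma H1_Lp2 v : H1 D v -> L2 v.
Proof. by case. Qed.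

Lemma grad_L2v v : H1 D v -> L2v D (grad D v).
Proof. by move=> /grad_weak[]. Qed.

Lemma H1_lin a b v w : H1 D v -> H1 D w -> H1 D (fun x => a * v x + b * w x).
Proof.
move=> hv hw; split; first by apply: Lp2_lin => //; exact: H1_Lp2.
exists (fun x => a *: grad D v x + b *: grad D w x).
by apply: weak_gradient_lin; [exact: H1_Lp2|exact: H1_Lp2|exact: grad_weak
  |exact: grad_weak].
Qed.

Lemma grad_lin a b v w : H1 D v -> H1 D w ->
  {ae leb, forall x, D x -> grad D (fun x => a * v x + b * w x) x =
     a *: grad D v x + b *: grad D w x}.
Proof.
move=> hv hw; apply: (@weak_gradient_unique (fun x => a * v x + b * w x)).
  by apply: grad_weak; exact: H1_lin.
by apply: weak_gradient_lin; [exact: H1_Lp2|exact: H1_Lp2|exact: grad_weak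
  |exact: grad_weak].
Qed.

Lemma L2v_norm_eq_ae G H : L2v D G -> L2v D H ->
  {ae leb, forall x, D x -> G x = H x} -> L2v_norm D G = L2v_norm D H.
Proof.
move=> G2 H2 GH; apply: Lp2_norm_eq_ae => //; [exact: enorm_Lp2|exact: enorm_Lp2|].
by apply: filterS GH => x h Dx; rewrite h.
Qed.

(** Stands in for the triangle inequality in L^2 and H^1: the squared form integrates directly, and
    the lost factor 2 only affects constants. *)
Lemma sqr_lin_le (a b x y : R) :
  (a * x + b * y) ^+ 2 <= 2 * a ^+ 2 * x ^+ 2 + 2 * b ^+ 2 * y ^+ 2.
Proof.
by have := sqr_ge0 (a * x - b * y); nra.
Qed.

Lemma Lp2_norm_lin_sqr_le a b f g : L2 f -> L2 g ->
  Lp_norm D 2%:E (fun x => a * f x + b * g x) ^+ 2 <=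
  2 * a ^+ 2 * Lp_norm D 2%:E f ^+ 2 + 2 * b ^+ 2 * Lp_norm D 2%:E g ^+ 2.
Proof.
move=> f2 g2; rewrite !Lp2_norm_sqr//; last exact: Lp2_lin.
have jf := Lp2_sqr_integrable f2; have jg := Lp2_sqr_integrable g2.
rewrite -I_lin//; apply: I_le => //.
- by apply: Lp2_sqr_integrable => //; exact: Lp2_lin.
- exact: integ_lin.
by apply: aeW => x _; exact: sqr_lin_le.
Qed.

Lemma Lp2_norm_scale a f : L2 f ->
  Lp_norm D 2%:E (fun x => a * f x) ^+ 2 = a ^+ 2 * Lp_norm D 2%:E f ^+ 2.
Proof.
move=> f2; have jf := Lp2_sqr_integrable f2.
rewrite !Lp2_norm_sqr//; last first.
  by have := Lp2_lin mD a 0 f2 f2; under eq_fun do rewrite mul0r addr0.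
have := I_lin mD (a ^+ 2) 0 jf jf; rewrite mul0r addr0 => <-.
by apply: eq_Rintegral => x _; ring.
Qed.

Lemma dotv_scale a b (x y : 'rV[R]_n) : dotv (a *: x) (b *: y) = a * b * dotv x y.
Proof. by rewrite /dotv mulr_sumr; apply: eq_bigr => i _; rewrite !mxE; ring. Qed.

Lemma L2v_norm_lin_sqr_le a b G H : L2v D G -> L2v D H ->
  L2v_norm D (fun x => a *: G x + b *: H x) ^+ 2 <=
  2 * a ^+ 2 * L2v_norm D G ^+ 2 + 2 * b ^+ 2 * L2v_norm D H ^+ 2.
Proof.
move=> G2 H2; rewrite !L2v_norm_sqr//; last exact: L2v_lin.
have jG := dotv_integrable mD G2 G2; have jH := dotv_integrable mD H2 H2.
rewrite -I_lin//; apply: I_le => //.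
- by apply: dotv_integrable => //; exact: L2v_lin.
- exact: integ_lin.
apply: aeW => x _; rewrite /dotv !mulr_sumr -big_split/=.
by apply: ler_sum => i _; rewrite !mxE -!expr2; exact: sqr_lin_le.
Qed.

Lemma L2v_norm_scale a G : L2v D G ->
  L2v_norm D (fun x => a *: G x) ^+ 2 = a ^+ 2 * L2v_norm D G ^+ 2.
Proof.
move=> G2; have jG := dotv_integrable mD G2 G2.
rewrite !L2v_norm_sqr//; last first.
  have := L2v_lin mD a 0 G2 G2; under eq_fun do rewrite scale0r addr0.
  by [].
have := I_lin mD (a ^+ 2) 0 jG jG; rewrite mul0r addr0 => <-.
by apply: eq_Rintegral => x _; rewrite dotv_scale; ring.
Qed.

Lemma H1_norm_ge0 v : 0 <= H1_norm D v.
Proof. exact: sqrtr_ge0. Qed.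

Lemma H1_norm_sqr v :
  H1_norm D v ^+ 2 = Lp_norm D 2%:E v ^+ 2 + L2v_norm D (grad D v) ^+ 2.
Proof. by rewrite sqr_sqrtr// addr_ge0 ?sqr_ge0. Qed.

Lemma Lp2_norm_le_H1 v : Lp_norm D 2%:E v <= H1_norm D v.
Proof.
rewrite -(@ler_pXn2r _ 2) ?nnegrE ?Lp_norm_ge0 ?H1_norm_ge0//.
by rewrite H1_norm_sqr lerDl sqr_ge0.
Qed.

Lemma grad_norm_le_H1 v : L2v_norm D (grad D v) <= H1_norm D v.
Proof.
rewrite -(@ler_pXn2r _ 2) ?nnegrE ?Lp_norm_ge0 ?H1_norm_ge0//.
by rewrite H1_norm_sqr lerDr sqr_ge0.
Qed.

Lemma H1_norm_lin_sqr_le a b v w : H1 D v -> H1 D w ->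
  H1_norm D (fun x => a * v x + b * w x) ^+ 2 <=
  2 * a ^+ 2 * H1_norm D v ^+ 2 + 2 * b ^+ 2 * H1_norm D w ^+ 2.
Proof.
move=> hv hw; rewrite [leLHS]H1_norm_sqr [X in _ <= _ * X + _]H1_norm_sqr
  [X in _ <= _ + _ * X]H1_norm_sqr.
rewrite (L2v_norm_eq_ae _ _ (grad_lin a b hv hw)).
- rewrite !mulrDr addrACA; apply: lerD.
    exact: Lp2_norm_lin_sqr_le (H1_Lp2 hv) (H1_Lp2 hw).
  exact: L2v_norm_lin_sqr_le (grad_L2v hv) (grad_L2v hw).
- by apply: grad_L2v; exact: H1_lin.
- by apply: L2v_lin => //; exact: grad_L2v.
Qed.

Lemma H1_scale a v : H1 D v -> H1 D (fun x => a * v x).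
Proof.
by move=> hv; have := H1_lin a 0 hv hv; under eq_fun do rewrite mul0r addr0.
Qed.

(** Here equality is needed, not an estimate up to a factor: [dual_le] normalises a function to have
    norm 1. *)
Lemma H1_norm_scale a v : H1 D v -> H1_norm D (fun x => a * v x) = `|a| * H1_norm D v.
Proof.
move=> hv; apply/eqP.
rewrite -(@eqrXn2 _ 2) ?mulr_ge0 ?H1_norm_ge0//; apply/eqP.
rewrite exprMn real_normK ?num_real// [LHS]H1_norm_sqr
  [X in _ = _ * X]H1_norm_sqr mulrDr.
rewrite Lp2_norm_scale; last exact: H1_Lp2.
congr (_ + _); rewrite -L2v_norm_scale; last exact: grad_L2v.
congr (_ ^+ 2); apply: L2v_norm_eq_ae.
- by apply: grad_L2v; exact: H1_scale.
- have := L2v_lin mD a 0 (grad_L2v hv) (grad_L2v hv).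
  by under eq_fun do rewrite scale0r addr0.
have := grad_lin a 0 hv hv.
rewrite (_ : (fun x => a * v x + 0 * v x) = (fun x => a * v x)); last first.
  by apply/funext => x; rewrite mul0r addr0.
by apply: filterS => x h Dx; rewrite h// scale0r addr0.
Qed.

Lemma test_function_support psi : test_function D psi ->
  exists A M, [/\ closed A, A `<=` D, forall x, ~ A x -> psi x = 0 &
    forall x, A x -> `|x| <= M].
Proof.
move=> [_ [A [cA AD A0]]]; have [M M0 DM] := bounded_in_ball.
exists A, M; split => //; last by move=> x /AD /DM.
by apply: compact_closed => //; exact: norm_hausdorff.
Qed.

Definition classical_gradient (w : fn) : vfn := fun x => \row_i partial i w x.

(** The product [w psi] has compact support in [D], so the integral of its partial derivative over
    the whole space is 0; expand by the product rule. *)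
Lemma C1_weak_gradient w : Ck 1 w -> weak_gradient D w (classical_gradient w).
Proof.
move=> [cw dw]; split.
  move=> i; under eq_fun do rewrite mxE.
  by apply: continuous_Lp2; have [] := dw i.
move=> psi tpsi i; have [A [M [cA AD A0 AM]]] := test_function_support tpsi.
have [sm _] := tpsi; have [cpsi /(_ i) [dpsi cdpsi]] := sm 1%N.
have [dwi cdwi] := dw i.
pose h x := w x * psi x.
have dh x : derivable h x (delta_mx ord0 i) by exact: (@derivableM _ _ w psi).
have Eh x : partial i h x = w x * partial i psi x + partial i w x * psi x.
  rewrite /partial (@deriveM _ _ w psi)//.
  by congr (_ + _); rewrite mulrC.
have ch : continuous (partial i h).
  rewrite (_ : partial i h = fun x => w x * partial i psi x + partial i w x * psi x).
    move=> x; apply: (@continuousD _ _ _ (fun x => w x * partial i psi x)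
        (fun x => partial i w x * psi x) x).
      by apply: (@continuousM _ _ w (partial i psi)); [exact: cw|exact: cdpsi].
    by apply: (@continuousM _ _ (partial i w) psi); [exact: cdwi|exact: cpsi].
  by apply/funext => x; exact: Eh.
have h0 x : ~ A x -> h x = 0 by move=> nA; rewrite /h A0 ?mulr0.
have := @integral_partial_0 R n i h M dh ch.
have hM x : M < `|x| -> h x = 0.
  by move=> Mx; apply: h0 => /AM; rewrite leNgt Mx.
move=> /(_ hM) Z.
have : I (partial i h) = 0.
  rewrite /Rintegral integral_mkcond -[RHS]/(fine 0%E) -Z; congr fine.
  apply: eq_integral => x _; rewrite patchE; case: ifPn => //.
  rewrite notin_setE => nD; rewrite (@partial_out _ _ _ _ A)//.
  by move=> /AD.
have -> : I (partial i h) = 1 * I (fun x => w x * partial i psi x) +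
    1 * I (fun x => partial i w x * psi x).
  rewrite -I_lin//; first by apply: eq_Rintegral => x _; rewrite Eh !mul1r.
  - by apply: Lp2_mul_integrable => //; exact: continuous_Lp2.
  - by apply: Lp2_mul_integrable => //; exact: continuous_Lp2.
rewrite !mul1r => /eqP; rewrite addr_eq0 => /eqP ->; congr (- _).
by apply: eq_Rintegral => x _; rewrite mxE.
Qed.

Lemma C1_H1 w : Ck 1 w -> H1 D w.
Proof.
move=> cw; split; first by apply: continuous_Lp2; case: cw.
by exists (classical_gradient w); exact: C1_weak_gradient.
Qed.

Lemma C1_grad w : Ck 1 w ->
  {ae leb, forall x, D x -> grad D w x = classical_gradient w x}.
Proof.
move=> cw; apply: (weak_gradient_unique (v := w)); last exact: C1_weak_gradient.
by apply: grad_weak; exact: C1_H1.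
Qed.

End weak_gradients.

(** * Integration against an outer measure *)

Section subadditive_integral.
Context d {T : measurableType d} {R : realType}.
Variable mu : set T -> \bar R.
Hypotheses (mu0 : mu set0 = 0%E) (mu_ge0 : forall A, (0 <= mu A)%E)
  (mu_le : forall A B, A `<=` B -> (mu A <= mu B)%E)
  (muU : forall A B, (mu (A `|` B) <= mu A + mu B)%E).
Import HBNNSimple.
Local Open Scope ereal_scope.

Lemma sintegral_range (h : {nnsfun T >-> R}) :
  sintegral mu h = \sum_(r <- finmap.enum_fset (fset_set (range h)))
    r%:E * mu (h @^-1` [set r]).
Proof.
rewrite -fsbig_finite; last exact: fimfunP.
rewrite /sintegral; symmetry; apply: fsbig_widen => //= x [_ Nfx] /=.
by rewrite preimage10// mu0 mule0.
Qed.

Lemma sintegral_term_ge0 (h : {nnsfun T >-> R}) r :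
  0 <= r%:E * mu (h @^-1` [set r]).
Proof.
have [r0|r0] := leP 0%R r; first by rewrite mule_ge0// lee_fin.
rewrite preimage10 ?mu0 ?mule0// => -[t _ htr].
by move: r0; rewrite -htr ltNge fun_ge0.
Qed.

Lemma sintegral_subadd_ge0 (h : {nnsfun T >-> R}) : 0 <= sintegral mu h.
Proof.
by rewrite sintegral_range; apply: sume_ge0 => r _; exact: sintegral_term_ge0.
Qed.

(** Values in [s] that [h] does not take contribute 0, because their level set is empty. This allows
    one list of values to be used for several simple functions. *)
Lemma sum_le_sintegral (h : {nnsfun T >-> R}) (s : seq R) : uniq s ->
  \sum_(r <- s) r%:E * mu (h @^-1` [set r]) <= sintegral mu h.
Proof.
move=> us; rewrite fsbig_seq//.
apply: (@le_trans _ _ (\sum_(r \in [set` s] `|` range h) r%:E * mu (h @^-1` [set r]))).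
  apply: lee_fsum_nneg_subset => //.
  - by rewrite finite_setU; split; [exact: finite_seq|exact: fimfunP].
  - by move=> x; rewrite !inE => xs; left.
  - by move=> x _; exact: sintegral_term_ge0.
rewrite le_eqVlt; apply/orP; left; apply/eqP.
rewrite /sintegral; apply: fsbig_widen => //= x [_ Nfx] /=.
by rewrite preimage10 ?mu0 ?mule0// => hx; apply: Nfx; right.
Qed.

(** The integral is defined as a difference of two suprema, for an arbitrary set function; for a
    nonnegative integrand the second supremum is 0. *)
Lemma ge0_integral_subaddE (S : set T) (f : T -> R) :
  (forall x, S x -> (0 <= f x)%R) ->
  \int[mu]_(x in S) (f x)%:E = ereal_sup [set sintegral mu h | h in
    [set h : {nnsfun T >-> R} | forall x, (h x)%:E <= ((EFin \o f) \_ S) x]].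
Proof.
move=> f0; rewrite /integral.
set g := _ \_ S.
have gp : g ^\+ = g.
  apply/funext => x; rewrite funeposE max_l// /g patchE; case: ifPn => //.
  by rewrite inE => /f0; rewrite lee_fin.
have gn : g ^\- = cst 0.
  apply/funext => x; rewrite funenegE /=; apply/max_idPr.
  rewrite leeNl oppe0 /g patchE; case: ifPn => //.
  by rewrite inE => /f0; rewrite lee_fin.
rewrite gp gn.
rewrite [X in _ - X](_ : _ = 0) ?sube0//.
apply/eqP; rewrite eq_le; apply/andP; split.
  apply: ge_ereal_sup => _ [h /= h0 <-].
  rewrite sintegral_range big1// => r _.
  have [->|r0] := eqVneq r 0%R; first by rewrite mul0e.
  rewrite preimage10 ?mu0 ?mule0// => -[t _ htr]; move/eqP : r0; apply.
  rewrite -htr; apply/eqP; rewrite eq_le fun_ge0 andbT.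
  by have := h0 t; rewrite lee_fin.
apply: ereal_sup_ubound; exists nnsfun0 => //=.
rewrite -[LHS]/(sintegral mu (@nnsfun0 _ T R)) sintegral_range big1// => r _.
have [->|r0] := eqVneq r 0%R; first by rewrite mul0e.
by rewrite preimage10 ?mu0 ?mule0// => -[t _ htr]; move/eqP : r0; apply.
Qed.

Lemma integral_subadd_ge0 (S : set T) (f : T -> R) :
  (forall x, S x -> (0 <= f x)%R) -> 0 <= \int[mu]_(x in S) (f x)%:E.
Proof.
move=> f0; rewrite ge0_integral_subaddE//.
apply: le_trans (sintegral_subadd_ge0 nnsfun0) _.
apply: ereal_sup_ubound; exists nnsfun0 => //= x.
by rewrite patchE; case: ifPn => //; rewrite inE => /f0; rewrite lee_fin.
Qed.

Lemma integral_subadd_cst0 (S : set T) : \int[mu]_(x in S) (0%R)%:E = 0.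
Proof.
apply/eqP; rewrite eq_le integral_subadd_ge0// andbT.
rewrite (@ge0_integral_subaddE S (fun=> 0%R))//.
apply: ge_ereal_sup => _ [h /= h0 <-].
rewrite sintegral_range big1// => r _.
have [->|r0] := eqVneq r 0%R; first by rewrite mul0e.
rewrite preimage10 ?mu0 ?mule0// => -[t _ htr]; move/eqP : r0; apply.
rewrite -htr; apply/eqP; rewrite eq_le fun_ge0 andbT.
by have := h0 t; rewrite patchE/= if_same lee_fin.
Qed.

(* [mu] is not additive, so the integral of a sum is not estimated by linearity:
   a simple function [h <= C (a + b)] is split along the set where
   [h <= 2 C a]. *)
Lemma integral_subadd_le (S : set T) (f a b : T -> R) (C : R) :
  measurable S -> measurable_fun S a -> (0 < C)%R ->
  (forall x, S x -> (0 <= f x)%R) ->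
  (forall x, S x -> (0 <= a x)%R) -> (forall x, S x -> (0 <= b x)%R) ->
  (forall x, S x -> (f x <= C * (a x + b x))%R) ->
  \int[mu]_(x in S) (f x)%:E <=
  (2 * C)%:E * (\int[mu]_(x in S) (a x)%:E + \int[mu]_(x in S) (b x)%:E).
Proof.
move=> mS ma C0 f0 a0 b0 fab.
rewrite !ge0_integral_subaddE//; apply: ge_ereal_sup => _ [h /= hf <-].
have K0 : (0 < 2 * C)%R by rewrite mulr_gt0.
have Ki : (0 <= (2 * C)^-1)%R by rewrite invr_ge0 ltW.
(* Outside [E], the bound [h <= C (a + b)] forces [(2 C)^-1 h <= b]. So the rescaled [h], cut to [E]
   and to its complement in [S], gives simple functions below [a] and below [b]. *)
pose E := S `&` [set x | ((2 * C)^-1 * h x <= a x)%R].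
have mE : measurable E.
  apply: measurable_fun_le => //.
  by apply: measurable_funM => //; exact: measurable_funTS.
have mF : measurable (S `\` E) by exact: measurableD.
have hS x : ~ S x -> h x = 0%R.
  move=> nS; apply/eqP; rewrite eq_le fun_ge0 andbT.
  by have := hf x; rewrite patchE memNset// lee_fin.
pose s1 := mul_nnsfun (mul_nnsfun (cst_nnsfun T (NngNum Ki)) h) (indic_nnsfun R mE).
pose s2 := mul_nnsfun (mul_nnsfun (cst_nnsfun T (NngNum Ki)) h) (indic_nnsfun R mF).
have s1E x : s1 x = ((2 * C)^-1 * h x * \1_E x)%R by [].
have s2E x : s2 x = ((2 * C)^-1 * h x * \1_(S `\` E) x)%R by [].
have s1a x : (s1 x)%:E <= ((EFin \o a) \_ S) x.
  rewrite s1E patchE indicE; case: ifPn => [|nS].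
    rewrite inE => Sx; case: (boolP (x \in E)); rewrite ?mulr0 ?lee_fin ?a0//.
    by rewrite inE mulr1 => -[].
  by rewrite hS ?mulr0 ?mul0r//; move: nS; rewrite notin_setE.
have s2b x : (s2 x)%:E <= ((EFin \o b) \_ S) x.
  rewrite s2E patchE indicE; case: ifPn => [|nS].
    rewrite inE => Sx; case: (boolP (x \in S `\` E)); rewrite ?mulr0 ?lee_fin ?b0//.
    rewrite inE mulr1 => -[_ nE].
    have /negP : ~ ((2 * C)^-1 * h x <= a x)%R by move=> xa; apply: nE.
    rewrite -ltNge => ha.
    have : (h x <= C * (a x + b x))%R.
      apply: le_trans (fab _ Sx).
      by have := hf x; rewrite patchE mem_set// lee_fin.
    rewrite ler_pdivrMl//; move: ha; rewrite ltr_pdivlMl//.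
    by lra.
  by rewrite hS ?mulr0 ?mul0r//; move: nS; rewrite notin_setE.
apply: (@le_trans _ _ ((2 * C)%:E * (sintegral mu s1 + sintegral mu s2))); last first.
  apply: lee_wpmul2l; first by rewrite lee_fin ltW.
  by apply: leeD; apply: ereal_sup_ubound; [exists s1|exists s2].
rewrite (sintegral_range h).
set s := finmap.enum_fset _.
have us : uniq s by exact: finmap.fset_uniq.
pose s' := [seq ((2 * C)^-1 * r)%R | r <- s].
have us' : uniq s'.
  rewrite map_inj_uniq// => x y; apply: mulfI.
  by rewrite invr_neq0// gt_eqF.
apply: (@le_trans _ _ ((2 * C)%:E *
   (\sum_(r <- s') r%:E * mu (s1 @^-1` [set r]) +
    \sum_(r <- s') r%:E * mu (s2 @^-1` [set r])))); last first.
  apply: lee_wpmul2l; first by rewrite lee_fin ltW.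
  by apply: leeD; exact: sum_le_sintegral.
rewrite -big_split/= big_map ge0_sume_distrr; last first.
  move=> r _; apply: adde_ge0; first exact: (sintegral_term_ge0 s1).
  exact: (sintegral_term_ge0 s2).
rewrite big_seq [leRHS]big_seq; apply: lee_sum => r.
rewrite in_fset_set; last exact: fimfunP.
rewrite inE => -[t _ htr].
have r0 : (0 <= r)%R by rewrite -htr fun_ge0.
have [->|rn0] := eqVneq r 0%R; first by rewrite !mul0e mulr0 !mul0e adde0 mule0.
rewrite -muleDr//; last by rewrite ge0_adde_def// inE.
rewrite muleA -EFinM mulrA mulfV ?gt_eqF// mul1r.
apply: lee_wpmul2l; first by rewrite lee_fin.
(* The level set of [h] at a nonzero [r] is covered by the level sets of [s1] and [s2] at
   [(2 C)^-1 r]: one use of subadditivity per value. *)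
apply: le_trans (muU _ _); apply: mu_le => x /= hxr.
have Sx : S x.
  by apply: contrapT => /hS; rewrite hxr => r00; rewrite r00 eqxx in rn0.
have [xE|xE] := pselect (E x); [left|right].
  have : s1 x = ((2 * C)^-1 * r)%R by rewrite s1E indicE mem_set// mulr1 hxr.
  exact.
have : s2 x = ((2 * C)^-1 * r)%R by rewrite s2E indicE mem_set ?mulr1 ?hxr.
exact.
Qed.

End subadditive_integral.

(** * The Hausdorff outer measure *)

Section hausdorff_measure.
Context {R : realType} {n : nat}.
Variable s : nat.
Hypothesis s0 : (0 < s)%N.
Local Open Scope ereal_scope.
Implicit Types A B : set 'rV[R]_n.

Lemma ediam_ge0 A : 0 <= ediam A.
Proof. by apply: ereal_sup_ubound; left. Qed.

Lemma ediam0 : ediam (set0 : set 'rV[R]_n) = 0.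
Proof.
apply/eqP; rewrite eq_le ediam_ge0 andbT.
by apply: ge_ereal_sup => _ [->//|[x []]].
Qed.

Lemma hausdorff_pre_ge0 delta A : 0 <= hausdorff_pre s delta A.
Proof.
apply: le_ereal_inf_tmp => _ [U _ <-].
by apply: nneseries_ge0 => k _ _; rewrite expe_ge0// ediam_ge0.
Qed.

Lemma hausdorff_pre_le delta A B : A `<=` B ->
  hausdorff_pre s delta A <= hausdorff_pre s delta B.
Proof.
move=> AB; apply: le_ereal_inf => _ [U [BU dU] <-].
by exists U => //; split => //; exact: subset_trans BU.
Qed.

Lemma hausdorff_pre0 delta : (0 < delta)%R ->
  hausdorff_pre s delta (set0 : set 'rV[R]_n) = 0.
Proof.
move=> d0; apply/eqP; rewrite eq_le hausdorff_pre_ge0 andbT.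
apply: ereal_inf_lbound; exists (fun=> set0).
  by split => // k; rewrite ediam0 lee_fin ltW.
(* With [s = 0] each empty set would contribute [0 ^+ 0 = 1]; hence the hypothesis [0 < s]. *)
by rewrite eseries0// => k _ _; rewrite ediam0; case: s s0 => // s' _; rewrite expeS mul0e.
Qed.

Lemma hausdorff_preU delta A B :
  hausdorff_pre s delta (A `|` B) <= hausdorff_pre s delta A + hausdorff_pre s delta B.
Proof.
have [->|Aoo] := eqVneq (hausdorff_pre s delta A) +oo.
  by rewrite addye ?leey// gt_eqF// (lt_le_trans _ (hausdorff_pre_ge0 _ _)).
have [->|Boo] := eqVneq (hausdorff_pre s delta B) +oo.
  by rewrite addey ?leey// gt_eqF// (lt_le_trans _ (hausdorff_pre_ge0 _ _)).
have Af : hausdorff_pre s delta A \is a fin_num.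
  by rewrite ge0_fin_numE ?hausdorff_pre_ge0// ltey.
have Bf : hausdorff_pre s delta B \is a fin_num.
  by rewrite ge0_fin_numE ?hausdorff_pre_ge0// ltey.
apply/lee_addgt0Pr => e e0.
have e20 : (0 < e / 2)%R by rewrite divr_gt0.
have [_ [U [AU dU] <-] Ue] := lb_ereal_inf_adherent e20 Af.
have [_ [V [BV dV] <-] Ve] := lb_ereal_inf_adherent e20 Bf.
(* Interleave the two nearly optimal covers. *)
pose W k := if odd k then V k./2 else U k./2.
have t0 (Z : set 'rV[R]_n) : 0 <= ediam Z ^+ s by rewrite expe_ge0// ediam_ge0.
apply: (@le_trans _ _ (\sum_(0 <= k <oo) ediam (W k) ^+ s)).
  apply: ereal_inf_lbound; exists W => //; split.
    move=> x [/AU[k _ Uk]|/BV[k _ Vk]].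
      by exists k.*2 => //; rewrite /W odd_double doubleK.
    by exists k.*2.+1 => //; rewrite /W /= odd_double /= uphalf_double.
  by move=> k; rewrite /W; case: ifP.
apply: (@le_trans _ _ (\sum_(0 <= k <oo) ediam (U k) ^+ s + \sum_(0 <= k <oo) ediam (V k) ^+ s)).
  apply: lime_le; first exact: is_cvg_nneseries.
  apply: nearW => N.
  apply: (@le_trans _ _ (\sum_(0 <= k < N.*2) ediam (W k) ^+ s)).
    by apply: lee_sum_nneg_natr => //; rewrite -addnn leq_addr.
  apply: (@le_trans _ _ (\sum_(0 <= k < N) ediam (U k) ^+ s + \sum_(0 <= k < N) ediam (V k) ^+ s)).
    elim: N => [|N IH]; first by rewrite !big_geq// adde0.
    rewrite doubleS !big_nat_recr//= [leRHS]addeACA -[leLHS]addeA leeD//.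
    by rewrite /W /= odd_double /= doubleK uphalf_double.
  by apply: leeD; exact: nneseries_lim_ge.
apply: (le_trans (leeD (ltW Ue) (ltW Ve))).
by rewrite addeACA -EFinD -splitr.
Qed.

Lemma hausdorff_pre_le_hausdorff delta A : (0 < delta)%R ->
  hausdorff_pre s delta A <= hausdorff s A.
Proof. by move=> d0; apply: ereal_sup_ubound; exists delta. Qed.

Lemma hausdorff_ge0 A : 0 <= hausdorff s A.
Proof.
exact: le_trans (hausdorff_pre_ge0 1%R A) (hausdorff_pre_le_hausdorff _ ltr01).
Qed.

Lemma hausdorff_le A B : A `<=` B -> hausdorff s A <= hausdorff s B.
Proof.
move=> AB; apply: ge_ereal_sup => _ [delta /= d0 <-].
apply: le_trans (hausdorff_pre_le_hausdorff _ d0).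
exact: hausdorff_pre_le.
Qed.

Lemma hausdorff0 : hausdorff s (set0 : set 'rV[R]_n) = 0.
Proof.
apply/eqP; rewrite eq_le hausdorff_ge0 andbT.
by apply: ge_ereal_sup => _ [delta /= d0 <-]; rewrite hausdorff_pre0.
Qed.

Lemma hausdorffU A B : hausdorff s (A `|` B) <= hausdorff s A + hausdorff s B.
Proof.
apply: ge_ereal_sup => _ [delta /= d0 <-].
apply: (le_trans (hausdorff_preU _ _ _)).
by apply: leeD; exact: hausdorff_pre_le_hausdorff.
Qed.

End hausdorff_measure.

(** * Traces *)

Section traces.
Context {R : realType} {n : nat}.
Hypothesis n1 : (0 < n.-1)%N.
Variable D : set 'rV[R]_n.
Hypotheses (oD : open D) (bD : bounded_set D).
Local Notation fn := ('rV[R]_n -> R).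
Implicit Types (f g h v w : fn).

Lemma bd_measurable : measurable (bd D).
Proof.
apply: measurableD; first by apply: closed_measurable_rV; exact: closed_closure.
by apply: open_measurable_rV; exact: open_interior.
Qed.

Lemma Ck1_continuous w : Ck 1 w -> continuous w.
Proof. by case. Qed.

Lemma Ck1_lin a b v w : Ck 1 v -> Ck 1 w -> Ck 1 (fun x => a * v x + b * w x).
Proof.
move=> [cv dv] [cw dw].
have clin (f g : fn) : continuous f -> continuous g ->
    continuous (fun x => a * f x + b * g x).
  move=> cf cg x.
  apply: (@continuousD _ _ _ (fun x => a * f x) (fun x => b * g x)).
    by apply: (@continuousM _ _ (fun=> a) f); [exact: cst_continuous|exact: cf].
  by apply: (@continuousM _ _ (fun=> b) g); [exact: cst_continuous|exact: cg].
split; first exact: clin.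
move=> i; have [dvi cvi] := dv i; have [dwi cwi] := dw i.
have dav x : derivable (a \*: v) x (delta_mx ord0 i) by exact: derivableZ.
have dbw x : derivable (b \*: w) x (delta_mx ord0 i) by exact: derivableZ.
split => [x|]; first exact: (@derivableD _ _ _ (a \*: v) (b \*: w)).
rewrite (_ : partial i _ = fun x => a * partial i v x + b * partial i w x).
  exact: clin.
apply/funext => x; rewrite /partial.
have := @deriveD _ _ _ (a \*: v) (b \*: w) x (delta_mx ord0 i) (dav x) (dbw x).
by rewrite deriveZ// deriveZ.
Qed.

Definition bd_sqr_integral (v h : fn) : \bar R :=
  (\int[hausdorff n.-1]_(x in bd D) ((v x - h x) ^+ 2)%:E)%E.

Lemma bd_sqr_integral_ge0 v h : (0 <= bd_sqr_integral v h)%E.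
Proof.
apply: (integral_subadd_ge0 (hausdorff0 n1) (hausdorff_ge0 _)) => x _.
exact: sqr_ge0.
Qed.

(** Since [a h + b h'] vanishes on the boundary, [a v + b v'] equals [a (v - h) + b (v' - h')]
    there, whose square is bounded by [sqr_lin_le]. *)
Lemma bd_sqr_integral_lin a b v v' h h' :
  measurable_fun (bd D) v -> measurable_fun (bd D) h ->
  (forall x, bd D x -> a * h x + b * h' x = 0) ->
  (bd_sqr_integral (fun x => a * v x + b * v' x)%R (fun=> 0%R) <=
  (2 * (2 * a ^+ 2 + 2 * b ^+ 2 + 1))%:E *
    (bd_sqr_integral v h + bd_sqr_integral v' h'))%E.
Proof.
move=> mv mh h0.
(* The summand 1 keeps the constant positive when [a = b = 0]. *)
have C0 : 0 < 2 * a ^+ 2 + 2 * b ^+ 2 + 1.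
  by rewrite ltr_pwDr// addr_ge0// mulr_ge0// sqr_ge0.
apply: (integral_subadd_le (hausdorff0 n1) (hausdorff_ge0 _)
  (@hausdorff_le _ _ _) (@hausdorffU _ _ _) bd_measurable _ C0).
- by apply: measurable_funX; exact: measurable_funB.
- by move=> x _; exact: sqr_ge0.
- by move=> x _; exact: sqr_ge0.
- by move=> x _; exact: sqr_ge0.
move=> x bx; rewrite subr0.
have -> : a * v x + b * v' x = a * (v x - h x) + b * (v' x - h' x).
  by have := h0 _ bx; lra.
apply: (le_trans (sqr_lin_le _ _ _ _)).
have := sqr_ge0 (v x - h x); have := sqr_ge0 (v' x - h' x).
have := sqr_ge0 a; have := sqr_ge0 b.
move: (a ^+ 2) (b ^+ 2) ((v x - h x) ^+ 2) ((v' x - h' x) ^+ 2) => A B X Y; nra.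
Qed.

Lemma cvg_lin_e0 (C : R) (u u' z : (\bar R)^nat) :
  (forall k, 0 <= z k <= C%:E * (u k + u' k))%E ->
  u k @[k --> \oo] --> 0%E -> u' k @[k --> \oo] --> 0%E -> z k @[k --> \oo] --> 0%E.
Proof.
move=> zu cu cu'.
apply: (@squeeze_cvge _ _ _ _ (fun=> 0%E) z (fun k => C%:E * (u k + u' k))%E).
- by apply: nearW.
- exact: cvg_cst.
rewrite -[X in _ --> X](mule0 C%:E); apply: cvgeZl => //.
by rewrite -[X in _ --> X](adde0 0%E); apply: cvgeD.
Qed.

Lemma cvg_lin_0 (A B : R) (u u' z : R^nat) :
  (forall k, 0 <= z k <= A * u k + B * u' k) ->
  u k @[k --> \oo] --> 0 -> u' k @[k --> \oo] --> 0 -> z k @[k --> \oo] --> 0.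
Proof.
move=> zu cu cu'.
apply: (squeeze_cvgr (f := fun=> 0) (h := fun k => A * u k + B * u' k)).
- by apply: nearW.
- exact: cvg_cst.
have -> : 0 = A * 0 + B * 0 :> R by rewrite !mulr0 addr0.
exact: cvgD (cvgM (cvg_cst _) cu) (cvgM (cvg_cst _) cu').
Qed.

Lemma H1_norm_lin_le a b v w : H1 D v -> H1 D w ->
  H1_norm D (fun x => a * v x + b * w x) <=
  2 * (`|a| * H1_norm D v + `|b| * H1_norm D w).
Proof.
move=> hv hw; have := H1_norm_lin_sqr_le oD bD a b hv hw.
have := H1_norm_ge0 D v; have := H1_norm_ge0 D w.
have := H1_norm_ge0 D (fun x => a * v x + b * w x).
set X := H1_norm D (fun x => _); set V := H1_norm D v; set W := H1_norm D w.
rewrite -(@real_normK _ a) ?num_real// -(@real_normK _ b) ?num_real//.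
have := normr_ge0 a; have := normr_ge0 b.
move: `|a| `|b| X V W => A B X V W B0 A0 X0 W0 V0 h.
have AV := mulr_ge0 A0 V0; have BW := mulr_ge0 B0 W0.
rewrite -(@ler_pXn2r _ 2) ?nnegrE ?mulr_ge0 ?addr_ge0//.
apply: (le_trans h); nra.
Qed.

(** The cancellation of the traces is a hypothesis, so that the same argument gives the linearity of
    H^1_0 (both traces 0) and the difference of two functions with equal trace ([a = 1],
    [b = -1]). *)
Lemma trace_lin0 a b v v' h h' : H1 D v -> H1 D v' ->
  is_trace D v h -> is_trace D v' h' ->
  (forall x, bd D x -> a * h x + b * h' x = 0) ->
  H10 D (fun x => a * v x + b * v' x).
Proof.
move=> hv hv' [mh _ [w [cw wv wh]]] [_ _ [w' [cw' wv' wh']]] h0.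
split; first exact: H1_lin.
split; first exact: measurable_cst.
  have := integral_subadd_cst0 (hausdorff0 n1) (hausdorff_ge0 _) (bd D).
  by rewrite expr0n/= => ->.
exists (fun k x => a * w k x + b * w' k x); split.
- by move=> k; exact: Ck1_lin.
- have hw k : H1 D (w k \- v).
    have := H1_lin oD bD 1 (-1) (C1_H1 oD bD (cw k)) hv.
    by congr H1; apply/funext => x; rewrite mul1r mulN1r.
  have hw' k : H1 D (w' k \- v').
    have := H1_lin oD bD 1 (-1) (C1_H1 oD bD (cw' k)) hv'.
    by congr H1; apply/funext => x; rewrite mul1r mulN1r.
  apply: (cvg_lin_0 (A := 2 * `|a|) (B := 2 * `|b|) _ wv wv') => k.
  rewrite H1_norm_ge0/= -!mulrA -mulrDr.
  apply: le_trans (H1_norm_lin_le a b (hw k) (hw' k)).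
  rewrite le_eqVlt; apply/orP; left; apply/eqP; congr (H1_norm D _).
  by apply/funext => x /=; ring.
apply: (cvg_lin_e0 _ wh wh') => k; apply/andP; split.
  exact: bd_sqr_integral_ge0.
apply: bd_sqr_integral_lin => //.
by apply: continuous_measurable_rV; [exact: bd_measurable|exact: Ck1_continuous].
Qed.

Lemma H10_lin a b v w : H10 D v -> H10 D w -> H10 D (fun x => a * v x + b * w x).
Proof.
move=> [hv tv] [hw tw]; apply: trace_lin0 hv hw tv tw _ => x _.
by rewrite !mulr0 addr0.
Qed.

Lemma eq_trace_H10 v w : H1 D v -> H1 D w -> eq_trace D v w -> H10 D (v \- w).
Proof.
move=> hv hw [h [tv tw]].
have -> : v \- w = (fun x => 1 * v x + (-1) * w x).
  by apply/funext => x; rewrite mul1r mulN1r.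
by apply: trace_lin0 hv hw tv tw _ => x _; rewrite mul1r mulN1r subrr.
Qed.

End traces.

(** * The Poincare inequality *)

Section exit_point.
Context {R : realType}.

(** [T] is the infimum of the points beyond [t] outside [O]; being open, [O] cannot contain it. *)
Lemma exit_time (O : set R) (t M : R) : open O -> O t ->
  (forall s, O s -> `|s| <= M) ->
  exists T, [/\ t < T, ~ O T & forall s, t <= s < T -> O s].
Proof.
move=> oO Ot OM; pose S := [set s : R | t <= s /\ ~ O s].
have S0 : S !=set0.
  have tM := le_trans (ler_norm t) (OM _ Ot).
  exists (M + 1); split; first by lra.
  move=> /OM; rewrite ger0_norm; last by have := normr_ge0 t; have := OM _ Ot; lra.
  by rewrite gerDl ler10.
have lS : lbound S t by move=> s [].
have hS : has_inf S by split => //; exists t.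
have tT : t <= inf S by apply: lb_le_inf.
have nOT : ~ O (inf S).
  move=> OT; have : nbhs (inf S) O by apply: open_nbhs_nbhs.
  move=> [e /= e0 eO]; have [s [ts nOs] se] := inf_adherent e0 hS.
  apply: (nOs); apply: eO; rewrite /ball_ /= distrC ger0_norm ?subr_ge0.
    by rewrite ltrBlDr addrC.
  exact: (ge_inf (ex_intro _ t lS) (conj ts nOs)).
exists (inf S); split => //.
  by rewrite lt_neqAle tT andbT; apply/eqP => tE; apply: nOT; rewrite -tE.
move=> s /andP[ts sT]; apply: contrapT => nOs.
have : inf S <= s by exact: (ge_inf (ex_intro _ t lS) (conj ts nOs)).
by rewrite leNgt sT.
Qed.

(** After the fundamental theorem on [[t, T]], the integral is enlarged to all of [O], which removes
    its dependence on [t] and on the exit time. *)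
Lemma line_bound (O : set R) (phi : R -> R) (t T : R) : measurable (O : set (measurableTypeR R)) ->
  (forall s, derivable phi s 1) -> continuous (fun s => 'D_1 phi s) ->
  t < T -> (forall s, t <= s < T -> O s) ->
  ((phi t)%:E <= (phi T)%:E +
    \int[lebesgue_measure]_(s in O) `|('D_1 phi s)%:E|)%E.
Proof.
move=> mO dphi cphi tT tTO.
have mphi : measurable_fun [set: measurableTypeR R] (fun s => ('D_1 phi s)%:E).
  by apply/measurable_EFinP; exact: continuous_measurable_fun.
have E : (\int[lebesgue_measure]_(s in `[t, T]) ('D_1 phi s)%:E =
    (phi T)%:E - (phi t)%:E)%E.
  apply: continuous_FTC2 => //.
  - exact: continuous_subspaceT.
  - have ch : continuous phi.
      by move=> s; apply/differentiable_continuous; exact/derivable1_diffP.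
    by split => [x _||]; [exact: dphi|apply: cvg_at_right_filter; exact: ch
      |apply: cvg_at_left_filter; exact: ch].
  - by move=> x _; rewrite derive1E.
have H1 : (`|(phi T)%:E - (phi t)%:E| <=
    \int[lebesgue_measure]_(s in `[t, T]) `|('D_1 phi s)%:E|)%E.
  by rewrite -E; apply: le_abse_integral => //; exact: measurable_funTS.
have H2 : (\int[lebesgue_measure]_(s in `[t, T]) `|('D_1 phi s)%:E| <=
    \int[lebesgue_measure]_(s in O) `|('D_1 phi s)%:E|)%E.
  (* Only the half-open interval is known to lie in [O]. *)
  rewrite -integral_itv_bndo_bndc; last first.
    by apply: measurableT_comp => //; exact: measurable_funTS.
  apply: ge0_subset_integral => //.
    by apply: measurableT_comp => //; exact: measurable_funTS.
apply: (@le_trans _ _ ((phi T)%:E + `|(phi T)%:E - (phi t)%:E|)%E).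
  rewrite /= -EFinD lee_fin -lerBlDl -normrN opprB.
  exact: ler_norm.
by rewrite leeD2l// (le_trans H1).
Qed.

End exit_point.

(** * Slices along the first coordinate *)

Section slices.
Context {R : realType} {n : nat}.
Variable D : set 'rV[R]_n.+1.
Hypotheses (oD : open D).
Variable M : R.
Hypotheses (M0 : 0 < M) (DM : forall x, D x -> `|x| <= M).
Local Notation leb := (@lebesgue_rV R).

Definition rV_tail (x : 'rV[R]_n.+1) : 'rV[R]_n := (rV_uncons x).2.

Definition slice (v : 'rV[R]_n) : set R := [set t | D (rV_cons (t, v))].

Let mD : measurable D := open_measurable_rV oD.

Lemma slice_open v : open (slice v).
Proof.
have /continuousP := @continuous_rV_consl R n v.
exact.
Qed.

Lemma slice_measurable v : measurable (slice v : set (measurableTypeR R)).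
Proof. by apply: open_measurable; exact: slice_open. Qed.

Lemma slice_bound v t : slice v t -> `|t| <= M.
Proof.
move=> /DM; apply: le_trans.
by have := rV_coord_le_norm (rV_cons (t, v)) ord0; rewrite mxE unlift_none.
Qed.

(** The exit point lies on the boundary and has the same tail [v] as the starting point, so its
    value is controlled by [c v] wherever the exit takes place. *)
Lemma slice_bound_point (F : 'rV[R]_n.+1 -> R) (B : R) (c : 'rV[R]_n -> \bar R) :
  (forall x, derivable F x (delta_mx ord0 ord0)) ->
  continuous (partial ord0 F) ->
  (forall y, bd D y -> (F y)%:E <= B%:E + c (rV_tail y))%E ->
  forall t v, slice v t -> ((F (rV_cons (t, v)))%:E <= B%:E + c v +
    \int[lebesgue_measure]_(s in slice v) `|(partial ord0 F (rV_cons (s, v)))%:E|)%E.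
Proof.
move=> dF cF Fc t v Dt.
have [T [tT nDT tTD]] := exit_time (@slice_open v) Dt (@slice_bound v).
have bT : bd D (rV_cons (T, v)).
  split; last by move=> /interior_subset.
  move=> B' nB; have := @continuous_rV_consl R n v T _ nB.
  move=> [e /= e0 eB].
  (* A point of the slice within [e] of the exit time, showing that the exit point is in the closure
     of [D]. *)
  pose s := Num.max t (T - e / 2).
  have sT : s < T by rewrite /s gt_max tT/= ltrBlDr ltrDl divr_gt0.
  exists (rV_cons (s, v)); split.
    by apply: tTD; rewrite sT andbT /s le_max lexx.
  apply: eB; rewrite /ball_/= gtr0_norm ?subr_gt0//.
  rewrite ltrBlDr -ltrBlDl (@lt_le_trans _ _ (T - e / 2))//.
    by rewrite ltrD2l ltrN2 ltr_pdivrMr// ltr_pMr// ltr1n.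
  by rewrite /s le_max lexx orbT.
have := @line_bound R (slice v) (fun s => F (rV_cons (s, v))) t T
  (slice_measurable v) _ _ tT tTD.
have dphi s : derivable (fun s => F (rV_cons (s, v))) s 1.
  by apply/(derive_rV_consl _ _ _).2; exact: dF.
have E : (fun s => 'D_1 (fun s => F (rV_cons (s, v))) s) =
    (partial ord0 F) \o (fun s => rV_cons (s, v)).
  by apply/funext => s /=; rewrite (derive_rV_consl _ _ _).1.
move=> /(_ dphi) H.
have cD : continuous (fun s => 'D_1 (fun s0 => F (rV_cons (s0, v))) s).
  rewrite E => s.
  by apply: continuous_comp; [exact: continuous_rV_consl|exact: cF].
apply: (le_trans (H cD)).
have -> : (\int[lebesgue_measure]_(s in slice v)
    `|('D_1 (fun s0 => F (rV_cons (s0, v))) s)%:E| =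
  \int[lebesgue_measure]_(s in slice v) `|(partial ord0 F (rV_cons (s, v)))%:E|)%E.
  by apply: eq_integral => s _; rewrite (derive_rV_consl _ _ _).1.
apply: leeD; last exact: lexx.
by have := Fc _ bT; rewrite /rV_tail rV_consK.
Qed.

(** Tonelli on [D], with the inner integral hidden behind [g] so that its measurability is available
    as a package. *)
Lemma slice_integral (h : 'rV[R]_n.+1 -> \bar R) : measurable_fun [set: 'rV[R]_n.+1] h ->
  (forall x, 0 <= h x)%E ->
  exists g : 'rV[R]_n -> \bar R,
  [/\ (forall v,
        \int[lebesgue_measure]_(s in slice v) h (rV_cons (s, v)) = g v)%E,
      measurable_fun [set: 'rV[R]_n] g, (forall v, 0 <= g v)%E &
      (\int[leb n]_v g v = \int[leb n.+1]_(x in D) h x)%E].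
Proof.
move=> mh h0;
exists (fun v => \int[lebesgue_measure]_(s in slice v) h (rV_cons (s, v)))%E.
have mhD : measurable_fun [set: 'rV[R]_n.+1] (h \_ D).
  by apply/(measurable_restrictT _ mD); exact: measurable_funTS.
have hD0 x : (0 <= (h \_ D) x)%E by rewrite patchE; case: ifP.
have E v : (\int[lebesgue_measure]_(s in slice v) h (rV_cons (s, v)) =
    \int[lebesgue_measure]_s (h \_ D) (rV_cons (s, v)))%E.
  rewrite integral_mkcond; apply: eq_integral => s _.
  rewrite !patchE /slice.
  have -> : (s \in [set t | D (rV_cons (t, v))]) = (rV_cons (s, v) \in D) by [].
  by [].
split => //; last first.
  rewrite [RHS]integral_mkcond (ge0_integral_rVS mhD hD0).
  by apply: eq_integral => v _; rewrite E.
- by move=> v; exact: integral_ge0.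
under eq_fun do rewrite E.
apply: (@measurable_fun_fubini_tonelli_G _ _ _ _ _ (@lebesgue_measure R)
  ((h \_ D) \o @rV_cons R n)) => //.
  by apply: measurableT_comp => //; exact: measurable_rV_cons.
by move=> x; exact: hD0.
Qed.

(** The bound on [c v] and on the derivative does not depend on the point of the slice, whose length
    is at most [2 M]; integrate over the slice, then over [v]. *)
Lemma integral_le_boundary (F : 'rV[R]_n.+1 -> R) (B : R) (c : 'rV[R]_n -> \bar R) :
  0 <= B -> (forall x, 0 <= F x) ->
  measurable_fun [set: 'rV[R]_n] c -> (forall v, 0 <= c v)%E ->
  continuous F ->
  (forall x, derivable F x (delta_mx ord0 ord0)) ->
  continuous (partial ord0 F) ->
  (forall y, bd D y -> (F y)%:E <= B%:E + c (rV_tail y))%E ->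
  (\int[leb n.+1]_(x in D) (F x)%:E <= B%:E * leb n.+1 D +
    (2 * M)%:E * (\int[leb n]_v c v +
      \int[leb n.+1]_(x in D) `|(partial ord0 F x)%:E|))%E.
Proof.
move=> B0 F0 mc c0 cF dF cdF Fc.
have mF : measurable_fun [set: 'rV[R]_n.+1] (EFin \o F).
  by apply/measurable_EFinP; exact: continuous_measurable_rV.
have mp : measurable_fun [set: 'rV[R]_n.+1] (fun x => `|(partial ord0 F x)%:E|)%E.
  apply: measurableT_comp => //; apply/measurable_EFinP.
  exact: continuous_measurable_rV.
have [g [gE mg g0 ig]] := slice_integral mp (fun x => abse_ge0 _).
have [f [fE mf f0 jf]] := slice_integral mF (fun x => F0 x : (0 <= (F x)%:E)%E).
(* The constant [B] is integrated over slices of [D] only: over all [v] its integral could be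
   infinite. *)
have [e [eE me e0 je]] := slice_integral (measurable_cst (B%:E))
  (fun x : 'rV[R]_n.+1 => B0 : (0 <= cst B%:E x)%E).
rewrite integral_cst// in je.
rewrite -jf -ig -je -ge0_integralD//.
have M20 : (0 <= (2 * M)%:E :> \bar R)%E by rewrite lee_fin mulr_ge0// ltW.
rewrite -ge0_integralZl//; last 2 first.
- exact: emeasurable_funD.
- by move=> v _; exact: adde_ge0.
rewrite -ge0_integralD//; last 2 first.
- by move=> v _; rewrite mule_ge0 ?adde_ge0.
- by apply: measurable_funeM; exact: emeasurable_funD.
apply: ge0_le_integral => //.
- by apply: emeasurable_funD => //; apply: measurable_funeM; exact: emeasurable_funD.
move=> v _; have mS := slice_measurable v; rewrite -fE -eE.
apply: (@le_trans _ _ (\int[lebesgue_measure]_(s in slice v) (B%:E + (c v + g v)))%E).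
  apply: ge0_le_integral => //.
  - by move=> s _; rewrite lee_fin.
  - apply: (measurable_funTS (D := slice v)).
    apply: (measurableT_comp mF).
    exact: (measurableT_comp (@measurable_rV_cons R n) (measurable_pair2 v)).
  - move=> s Ds; rewrite addeA.
    by rewrite -gE; exact: slice_bound_point.
rewrite ge0_integralD//; last by move=> s _; rewrite adde_ge0.
apply: leeD => //.
rewrite integral_cst//= muleC; apply: lee_wpmul2r; first exact: adde_ge0.
apply: (@le_trans _ _ (lebesgue_measure (`[- M, M]%classic : set (measurableTypeR R)))).
  apply: le_measure; rewrite ?inE//.
  by move=> s /slice_bound; rewrite /= in_itv/= ler_norml.
rewrite lebesgue_measure_itv/=; case: ifPn => // _.
  by rewrite -EFinB lee_fin; lra.
Qed.

End slices.

(** * Covering projections of boundary sets *)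

Section shadow_cover.
Context {R : realType} {n : nat}.
Hypothesis n0 : (0 < n)%N.
Local Notation leb := (@lebesgue_rV R).
Local Open Scope ereal_scope.

Lemma measurable_closed_box (a b : 'rV[R]_n) : measurable (closed_box a b).
Proof.
rewrite (_ : closed_box a b =
    [set x | forall i, `[a ord0 i, b ord0 i]%classic (x ord0 i)]).
  apply: (measurable_forall (P := fun i => `[a ord0 i, b ord0 i]%classic)) => i.
  exact: measurable_itv.
by apply/seteqP; split => x h i; have := h i; rewrite /= in_itv.
Qed.

Lemma lebesgue_rV_cube (c : 'rV[R]_n) (r : R) : (0 <= r)%R ->
  leb n (closed_box (c - const_mx r) (c + const_mx r)) = ((2 * r) ^+ n)%:E.
Proof.
move=> r0.
rewrite (_ : closed_box _ _ =
    [set x : 'rV[R]_n | forall i, `[(c ord0 i - r)%R, (c ord0 i + r)%R]%classic (x ord0 i)]); last first.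
  by apply/seteqP; split => x h i; have := h i; rewrite /= in_itv/= !mxE.
rewrite (lebesgue_rV_box (A := fun i => `[(c ord0 i - r)%R, (c ord0 i + r)%R]%classic)); last first.
  by move=> i; exact: measurable_itv.
rewrite (eq_bigr (fun=> (2 * r)%:E)); last first.
  move=> i _; rewrite lebesgue_measure_itv/= lte_fin; case: ifPn => h.
    by rewrite -EFinB; congr EFin; ring.
  congr EFin; move: h; rewrite -leNgt => h.
  by apply/eqP; rewrite eq_le; apply/andP; split; [rewrite mulr_ge0|lra].
by rewrite prodEFin prodr_const card_ord.
Qed.

Lemma ediam_coord (U : set 'rV[R]_n.+1) (x y : 'rV[R]_n.+1) (r : R) j :
  ediam U <= r%:E -> U x -> U y -> (`|x ord0 j - y ord0 j| <= r)%R.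
Proof.
move=> Ur Ux Uy; rewrite -lee_fin; apply: le_trans Ur.
apply: (@le_trans _ _ (enorm (x - y))%:E).
  by have := coord_le_enorm (x - y) j; rewrite !mxE lee_fin.
by apply: ereal_sup_ubound; right; exists x => //; exists y.
Qed.

(** Take the cube around the tail of any point of [U] with half-side the diameter; its side is twice
    the diameter, hence [2 ^+ n]. *)
Lemma shadow_set (U : set 'rV[R]_n.+1) : ediam U <= 1 ->
  exists Q : set 'rV[R]_n, [/\ measurable Q, forall y, U y -> Q (rV_tail y) &
    leb n Q <= (2 ^+ n)%:E * ediam U ^+ n].
Proof.
move=> U1; have [U0|/set0P[u Uu]] := eqVneq U set0.
  exists set0; split => //; first by rewrite U0.
  by rewrite measure0 mule_ge0// ?expe_ge0// ?ediam_ge0// lee_fin exprn_ge0.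
have fU : ediam U \is a fin_num.
  by rewrite ge0_fin_numE ?ediam_ge0//; apply: le_lt_trans U1 _; exact: ltry.
have d0 : (0 <= fine (ediam U))%R by rewrite fine_ge0// ediam_ge0.
exists (closed_box (rV_tail u - const_mx (fine (ediam U)))
  (rV_tail u + const_mx (fine (ediam U)))); split.
- exact: measurable_closed_box.
- move=> y Uy i; rewrite !mxE.
  have := @ediam_coord U y u (fine (ediam U)) (lift ord0 i).
  rewrite fineK// => /(_ (lexx _) Uy Uu); rewrite ler_norml => /andP[h1 h2].
  by apply/andP; split; lra.
- have -> : ediam U ^+ n = ((fine (ediam U)) ^+ n)%:E by rewrite EFin_expe fineK.
  by rewrite lebesgue_rV_cube// exprMn EFinM.
Qed.

(** [c] is the sum of the indicators of the cubes shadowing a nearly optimal cover of [A]. *)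
Lemma shadow_cover (A : set 'rV[R]_n.+1) (eps : R) : (0 < eps)%R ->
  hausdorff n A < +oo ->
  exists c : 'rV[R]_n -> \bar R,
  [/\ measurable_fun [set: 'rV[R]_n] c, forall v, 0 <= c v,
      forall y, A y -> 1 <= c (rV_tail y) &
      \int[leb n]_v c v <= (2 ^+ n)%:E * hausdorff n A + eps%:E].
Proof.
move=> e0 Aoo.
(* Any positive scale would do, as each pre-measure is below the Hausdorff measure; scale 1 matches
   the hypothesis of [shadow_set]. *)
have pA : hausdorff_pre n 1 A <= hausdorff n A by exact: hausdorff_pre_le_hausdorff.
have fA : hausdorff_pre n 1 A \is a fin_num.
  by rewrite ge0_fin_numE ?hausdorff_pre_ge0//; exact: le_lt_trans Aoo.
(* Anticipates the factor [2 ^+ n] of the cubes. *)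
have e1 : (0 < eps / 2 ^+ n)%R by rewrite divr_gt0// exprn_gt0.
have [_ [U [AU dU] <-] Ue] := lb_ereal_inf_adherent e1 fA.
have /choice[Q QP] : forall k, exists Q : set 'rV[R]_n,
  [/\ measurable Q, forall y, U k y -> Q (rV_tail y) &
    leb n Q <= (2 ^+ n)%:E * ediam (U k) ^+ n].
  by move=> k; exact: shadow_set.
have mQ k : measurable (Q k) by have [] := QP k.
exists (fun v => \sum_(0 <= k <oo) (\1_(Q k) v)%:E); split.
- apply: ge0_emeasurable_sum => [k v _ _|k _]; first by rewrite lee_fin.
  by apply/measurable_EFinP; exact: measurable_indic.
- by move=> v; apply: nneseries_ge0 => k _ _; rewrite lee_fin.
- move=> y /AU[k _ Uy]; have [_ /(_ _ Uy) Qy _] := QP k.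
  apply: (@le_trans _ _ (\sum_(0 <= k < k.+1) (\1_(Q k) (rV_tail y))%:E)).
    rewrite big_nat_recr//= -[leLHS]add0e; apply: leeD.
      by apply: sume_ge0 => i _; rewrite lee_fin.
    by rewrite indicE mem_set.
  by apply: nneseries_lim_ge => i _ _; rewrite lee_fin.
rewrite integral_nneseries//; last first.
  by move=> k; apply/measurable_EFinP; exact: measurable_indic.
apply: (@le_trans _ _ (\sum_(0 <= k <oo) ((2 ^+ n)%:E * ediam (U k) ^+ n))).
  apply: lee_nneseries => k _; first by rewrite integral_ge0// => v _; rewrite lee_fin.
  by rewrite integral_indic// setIT; have [] := QP k.
rewrite nneseriesZl//; last by move=> k _; rewrite expe_ge0// ediam_ge0.
apply: (@le_trans _ _ ((2 ^+ n)%:E * (hausdorff n A + (eps / 2 ^+ n)%:E))).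
  apply: lee_wpmul2l; first by rewrite lee_fin exprn_ge0.
  by apply: (le_trans (ltW Ue)); rewrite leeD2r.
rewrite ge0_muleDr ?hausdorff_ge0 ?lee_fin ?(ltW e1)//.
by rewrite -EFinM mulrC divfK ?gt_eqF ?exprn_gt0.
Qed.

Lemma sum_nat_ltn (N q : nat) : (q <= N)%N -> (\sum_(i < N) (i < q)%N = q)%N.
Proof.
move=> qN; rewrite -(big_mkord xpredT (fun i => (i < q)%N : nat)) /=.
rewrite (big_cat_nat (leq0n q) qN)/= -[RHS]addn0; congr addn.
  rewrite big_nat_cond (eq_bigr (fun=> 1%N)); last first.
    by move=> i; rewrite andbT => /andP[_ ->].
  by rewrite -big_nat_cond sum_nat_const_nat muln1 subn0.
rewrite big_nat_cond big1// => i; rewrite andbT => /andP[qi _].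
by rewrite ltnNge qi.
Qed.

Import HBNNSimple.

(** The function is [eps * floor (F / eps)] on [S], written as [eps] times the number of thresholds
    [(i + 1) eps] below [F]. *)
Lemma staircase_nnsfun (S : set 'rV[R]_n.+1) (F : 'rV[R]_n.+1 -> R) (B eps : R) :
  measurable S -> measurable_fun S F -> (0 < eps)%R ->
  (forall x, S x -> (0 <= F x <= B)%R) ->
  exists s : {nnsfun 'rV[R]_n.+1 >-> R},
    (forall x, ~ S x -> s x = 0%R) /\ (forall x, S x -> (s x <= F x <= s x + eps)%R).
Proof.
move=> mS mF e0 FB.
have mE i : measurable (S `&` [set x | (i.+1%:R * eps <= F x)%R]).
  by apply: measurable_fun_le.
pose N := (Num.truncn (B / eps)).+1.
exists (sum_nnsfun (fun i => mul_nnsfun (cst_nnsfun _ (NngNum (ltW e0))) (indic_nnsfun R (mE i))) N).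
have sE x : sum_nnsfun (fun i => mul_nnsfun (cst_nnsfun _ (NngNum (ltW e0))) (indic_nnsfun R (mE i))) N x
    = (eps * (\sum_(i < N) (x \in S `&` [set x | (i.+1%:R * eps <= F x)%R]))%:R)%R.
  rewrite sum_nnsfunE natr_sum mulr_sumr; apply: eq_bigr => i _.
  by [].
split=> x Sx; rewrite sE.
  rewrite big1 ?mulr0// => i _; rewrite memNset// => -[].
  by [].
have /andP[F0 FxB] := FB _ Sx.
have Fe : (0 <= F x / eps)%R by rewrite divr_ge0// ltW.
rewrite (eq_bigr (fun i : 'I_N => (i < Num.truncn (F x / eps))%N : nat)); last first.
  move=> i _; congr nat_of_bool; rewrite truncn_gt_nat ler_pdivlMr//.
  apply/idP/idP; first by rewrite inE => -[].
  by move=> h; rewrite inE.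
rewrite sum_nat_ltn; last first.
  apply: leqW; apply: le_truncn; rewrite ler_pM2r// ?invr_gt0//.
have /andP[t1 t2] := truncn_itv Fe.
move: t1 t2; rewrite ler_pdivlMr// ltr_pdivrMr// -natr1 => t1 t2.
by apply/andP; split; lra.
Qed.

(** Cover each level set of a staircase below [F] by [shadow_cover] and add the covers with the
    levels as weights; the rounding error of the staircase is the [eps] in the pointwise bound. *)
Lemma boundary_cover (D : set 'rV[R]_n.+1) (F : 'rV[R]_n.+1 -> R) (B eps : R) :
  measurable_fun (bd D) F -> (0 < eps)%R ->
  (forall x, bd D x -> (0 <= F x <= B)%R) ->
  \int[hausdorff n]_(x in bd D) (F x)%:E < +oo ->
  exists c : 'rV[R]_n -> \bar R,
  [/\ measurable_fun [set: 'rV[R]_n] c, forall v, 0 <= c v,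
      forall y, bd D y -> (F y)%:E <= eps%:E + c (rV_tail y) &
      \int[leb n]_v c v <=
        (2 ^+ n)%:E * \int[hausdorff n]_(x in bd D) (F x)%:E + eps%:E].
Proof.
move=> mF e0 FB Ioo.
have h0 := @hausdorff0 R n.+1 n n0.
have hge0 := @hausdorff_ge0 R n.+1 n.
have [s [sS sF]] := staircase_nnsfun (bd_measurable D) mF e0 FB.
have sI : sintegral (hausdorff n) s <= \int[hausdorff n]_(x in bd D) (F x)%:E.
  rewrite (ge0_integral_subaddE h0); last by move=> x /FB/andP[].
  apply: ereal_sup_ubound; exists s => //= x; rewrite patchE; case: ifPn.
    by rewrite inE => /sF/andP[h _]; rewrite lee_fin.
  by rewrite notin_setE => /sS ->.
set rs := finmap.enum_fset (fset_set (range s)).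
have rsP r : r \in rs -> exists x, s x = r.
  by rewrite in_fset_set; [rewrite inE => -[x _ <-]; exists x|exact: fimfunP].
have rs0 r : r \in rs -> (0 <= r)%R by move=> /rsP[x <-]; exact: fun_ge0.
have sIE : sintegral (hausdorff n) s =
    \sum_(r <- rs) r%:E * hausdorff n (s @^-1` [set r]).
  exact: sintegral_range.
(* Finiteness of the integral bounds the measure of every level set except that of 0, which may be
   infinite but has weight 0 and gets no cover. *)
have rfin r : r \in rs -> r != 0%R -> hausdorff n (s @^-1` [set r]) < +oo.
  move=> rrs rn0; rewrite ltey; apply/eqP => hoo.
  have : r%:E * hausdorff n (s @^-1` [set r]) <= sintegral (hausdorff n) s.
    have := @sum_le_sintegral _ _ _ _ h0 hge0 s [:: r] erefl.
    by rewrite big_seq1.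
  have rp : (0 < r)%R by rewrite lt_neqAle eq_sym rn0 rs0.
  rewrite hoo gt0_muley ?lte_fin// => /(fun h => le_trans h sI).
  by rewrite leye_eq => /eqP E; rewrite E in Ioo.
(* The weighted errors [r * (eps / T)] add up to at most [eps]; the 1 keeps [T] positive. *)
pose T := (1 + \sum_(r <- rs) r)%R.
have T0 : (0 < T)%R by rewrite ltr_pwDl// big_seq; apply: sumr_ge0.
have eT : (0 < eps / T)%R by rewrite divr_gt0.
have /choice[c cP] : forall r : R, exists c : 'rV[R]_n -> \bar R,
    [/\ measurable_fun [set: 'rV[R]_n] c, forall v, 0 <= r%:E * c v,
      r \in rs -> r != 0%R -> forall y, s y = r -> 1 <= c (rV_tail y) &
      r \in rs -> r != 0%R -> \int[leb n]_v c v <=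
         (2 ^+ n)%:E * hausdorff n (s @^-1` [set r]) + (eps / T)%:E].
  move=> r; have [/andP[rr rn0]|h] := boolP ((r \in rs) && (r != 0%R)).
    have [c [c1 c2 c3 c4]] := shadow_cover eT (rfin r rr rn0); exists c; split => //.
      by move=> v; rewrite mule_ge0// lee_fin rs0.
  by exists (cst 0); split => // [v|rr rn0|rr rn0]; rewrite /= ?mule0//;
    rewrite rr rn0 in h.
exists (fun v => \sum_(r <- rs) r%:E * c r v).
have mc r : measurable_fun [set: 'rV[R]_n] (c r) by have [] := cP r.
have rc0 r v : 0 <= r%:E * c r v by have [_ + _ _] := cP r.
split.
- by apply: emeasurable_sum => r; exact: measurable_funeM.
- by move=> v; apply: sume_ge0 => r _; exact: rc0.
- move=> y bDy; have /andP[_ Fy] := sF _ bDy.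
  apply: (@le_trans _ _ (eps%:E + (s y)%:E)); first by rewrite -EFinD lee_fin addrC.
  apply: leeD => //.
  have sy : s y \in rs by rewrite in_fset_set ?inE; [exists y|exact: fimfunP].
  have [->|syn0] := eqVneq (s y) 0%R.
    by apply: sume_ge0 => r _; exact: rc0.
  rewrite (bigD1_seq (s y))//=; last exact: finmap.fset_uniq.
  rewrite -[leLHS]adde0; apply: leeD; last first.
    by apply: sume_ge0 => r _; exact: rc0.
  rewrite -[leLHS]mule1; apply: lee_wpmul2l; first by rewrite lee_fin rs0.
  by have [_ _ /(_ sy syn0 y erefl)] := cP (s y).
rewrite ge0_integral_sum//; last by move=> r; exact: measurable_funeM.
apply: (@le_trans _ _ (\sum_(r <- rs) ((2 ^+ n)%:E *
   (r%:E * hausdorff n (s @^-1` [set r])) + (r * (eps / T))%:E))).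
  rewrite big_seq [leRHS]big_seq; apply: lee_sum => r rr.
  have [->|rn0] := eqVneq r 0%R.
    under eq_integral do rewrite mul0e.
    by rewrite integral0 mul0e mule0 mul0r adde0.
  have rp : (0 < r)%R by rewrite lt_neqAle eq_sym rn0 rs0.
  have cr0 v : 0 <= c r v by have := rc0 r v; rewrite pmule_rge0// lte_fin.
  rewrite ge0_integralZl//; last by rewrite lee_fin rs0.
  rewrite muleCA EFinM -ge0_muleDr ?mule_ge0 ?lee_fin ?exprn_ge0 ?(ltW eT)//.
  apply: lee_wpmul2l; first by rewrite lee_fin rs0.
  by have [_ _ _ /(_ rr rn0)] := cP r.
rewrite big_split/= -ge0_sume_distrr; last first.
  by move=> r _; apply: (sintegral_term_ge0 h0 hge0 s r).
rewrite sumEFin -mulr_suml -sIE; apply: leeD.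
  by apply: lee_wpmul2l => //; rewrite lee_fin exprn_ge0.
rewrite lee_fin mulrA ler_pdivrMr// mulrC ler_pM2l// /T lerDr//.
Qed.

End shadow_cover.

(** * Poincare for C^1 functions and passage to the limit *)

Section poincare.
Context {R : realType} {n : nat}.
Hypothesis n0 : (0 < n)%N.
Variable D : set 'rV[R]_n.+1.
Hypotheses (oD : open D).
Variable M : R.
Hypotheses (M0 : 0 < M) (DM : forall x, D x -> `|x| <= M).
Local Notation leb := (@lebesgue_rV R).
Local Notation L2 := (Lp D 2%:E).
Local Notation N2 := (Lp_norm D 2%:E).
Local Notation fn := ('rV[R]_n.+1 -> R).
Implicit Types (v w : fn).

Let mD : measurable D := open_measurable_rV oD.

Let bD : bounded_set D.
Proof.
exists M; split; first exact: num_real.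
by move=> e Me x /= /DM /le_trans; apply; exact: ltW.
Qed.

Lemma ler_of_eps (x y K : R) : 0 <= K -> (forall e, 0 < e -> x <= y + e * K) -> x <= y.
Proof.
move=> K0 h; apply/ler_addgt0Pr => d d0.
have K1 : 0 < K + 1 by rewrite ltr_wpDl.
apply: (le_trans (h (d / (K + 1)) _)); first by rewrite divr_gt0.
rewrite lerD2l mulrAC ler_pdivrMr// ler_pM2l// lerDl//.
Qed.

Lemma bd_norm_le y : bd D y -> `|y| <= M.
Proof.
move=> [cy _]; have : closure [set x : 'rV[R]_n.+1 | `|x| <= M] y.
  by move: cy; apply: closure_subset => x /DM.
by rewrite -(closure_id _).1//; exact: closed_norm_ball.
Qed.

Lemma partial_le_grad w : Ck 1 w ->
  N2 (partial ord0 w) <= L2v_norm D (grad D w).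
Proof.
move=> cw; have [G2 _] := C1_weak_gradient oD bD cw.
rewrite (L2v_norm_eq_ae oD _ _ (C1_grad oD bD cw))//; last first.
  by apply: grad_L2v; exact: C1_H1.
apply: (Lp2_norm_le mD).
- by have := G2 ord0; under eq_fun do rewrite mxE.
- exact: enorm_Lp2.
apply: aeW => x _; rewrite [leRHS]ger0_norm ?enorm_ge0//.
by have := coord_le_enorm (classical_gradient w x) ord0; rewrite mxE.
Qed.

(** Apply [integral_le_boundary] to [w ^+ 2], whose derivative is at most [2 |w| |d_0 w|], and
    conclude by Cauchy-Schwarz. Finiteness of the boundary integral is a hypothesis because the
    Hausdorff measure of the boundary is not bounded here. *)
Lemma C1_poincare w : Ck 1 w -> (bd_sqr_integral D w (fun=> 0%R) < +oo)%E ->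
  N2 w ^+ 2 <= 2 * M * 2 ^+ n * fine (bd_sqr_integral D w (fun=> 0)) +
    4 * M * N2 w * L2v_norm D (grad D w).
Proof.
move=> cw Ioo; have [cw0 /(_ ord0) [dw0 cdw0]] := cw.
pose F x := w x ^+ 2.
have FE : F = w * w by apply/funext => x; rewrite /F expr2.
have cF : continuous F by rewrite FE => x; apply: (@continuousM _ _ w w x); exact: cw0.
have dF x : derivable F x (delta_mx ord0 ord0) by rewrite FE; exact: derivableM.
have pF x : partial ord0 F x = 2 * (w x * partial ord0 w x).
  by rewrite /partial FE deriveM// mulr_natl mulr2n.
have cpF : continuous (partial ord0 F).
  rewrite (_ : partial ord0 F = fun x => 2 * (w x * partial ord0 w x)).
    move=> x; apply: (@continuousM _ _ (fun=> 2) (fun x => w x * partial ord0 w x)).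
      exact: cst_continuous.
    by apply: (@continuousM _ _ w (partial ord0 w)); [exact: cw0|exact: cdw0].
  by apply/funext => x.
have w2 : L2 w by exact: continuous_Lp2.
have dw2 : L2 (partial ord0 w) by exact: continuous_Lp2.
(* The staircase needs a bounded function: [F] is continuous and the boundary lies in a compact
   ball. *)
have [B FB] : exists B, forall x, bd D x -> 0 <= F x <= B.
  have := @continuous_compact _ _ F _ (continuous_subspaceT cF)
    (@compact_norm_ball R n.+1 M).
  move=> /compact_bounded [B [Br hB]]; exists (B + 1) => x bx.
  rewrite sqr_ge0/=; apply: le_trans (ler_norm _) _.
  apply: (hB (B + 1)) => /=; first by rewrite ltrDl.
  by exists x => //; exact: bd_norm_le.
have mFbd : measurable_fun (bd D) F.
  by apply: continuous_measurable_rV => //; exact: bd_measurable.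
have IE : (\int[hausdorff n]_(x in bd D) (F x)%:E =
    bd_sqr_integral D w (fun=> 0%R))%E.
  by rewrite /bd_sqr_integral; congr integral; apply/funext => x; rewrite subr0.
have Ifin : bd_sqr_integral D w (fun=> 0) \is a fin_num.
  by rewrite ge0_fin_numE ?bd_sqr_integral_ge0.
have lfin : leb n.+1 D \is a fin_num.
  by rewrite ge0_fin_numE//; exact: lebesgue_rV_bounded.
set J := \int[leb n.+1]_(x in D) `|partial ord0 F x|.
have jpF := continuous_integrable oD bD cpF.
have JE : (\int[leb n.+1]_(x in D) `|(partial ord0 F x)%:E| = J%:E)%E.
  by rewrite /J /Rintegral fineK//; exact: integrable_fin_num (integrable_norm jpF).
have J2 : J <= 2 * (N2 w * N2 (partial ord0 w)).
  have aw2 : L2 (fun x => `|w x|).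
    by apply: (continuous_Lp2 oD bD) => x; apply: continuous_comp;
      [exact: cw0|exact: norm_continuous].
  have adw2 : L2 (fun x => `|partial ord0 w x|).
    by apply: (continuous_Lp2 oD bD) => x; apply: continuous_comp;
      [exact: cdw0|exact: norm_continuous].
  have -> : J = 2 * \int[leb n.+1]_(x in D) (`|w x| * `|partial ord0 w x|).
    have j := Lp2_mul_integrable mD aw2 adw2.
    have := I_lin mD 2 0 j j; rewrite mul0r addr0 => <-.
    apply: eq_Rintegral => x _.
    by rewrite pF !normrM mul0r addr0 (@ger0_norm _ 2).
  rewrite ler_wpM2l//; apply: (le_trans (Lp2_cauchy_schwarz mD aw2 adw2)).
  rewrite le_eqVlt; apply/orP; left; apply/eqP; congr (_ * _).
    apply: le_anti; apply/andP; split; apply: (Lp2_norm_le mD) => //;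
    by apply: aeW => x _; rewrite normr_id.
  apply: le_anti; apply/andP; split; apply: (Lp2_norm_le mD) => //;
  by apply: aeW => x _; rewrite normr_id.
have NE : (\int[leb n.+1]_(x in D) (F x)%:E = (N2 w ^+ 2)%:E)%E.
  rewrite (Lp2_norm_sqr w2) /Rintegral fineK//.
  exact: integrable_fin_num (Lp2_sqr_integrable w2).
(* The cover costs [e] pointwise on [D], which has finite measure, and [e] in its integral; both
   disappear as [e] tends to 0. *)
have key e : 0 < e -> N2 w ^+ 2 <= 2 * M * (2 ^+ n * fine (bd_sqr_integral D w (fun=> 0)) + J)
    + e * (fine (leb n.+1 D) + 2 * M).
  move=> e0; rewrite -IE in Ioo.
  have [c [mc c0 Fc ic]] := boundary_cover n0 mFbd e0 FB Ioo.
  have := integral_le_boundary oD M0 DM (ltW e0) (fun x => sqr_ge0 (w x)) mc c0 cF dF cpF Fc.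
  rewrite NE JE => /le_trans H; rewrite -lee_fin; apply: H.
  rewrite IE -(fineK Ifin) in ic.
  rewrite -(fineK lfin) -EFinM.
  apply: (@le_trans _ _ ((e * fine (leb n.+1 D))%:E + (2 * M)%:E *
    (((2 ^+ n)%:E * (fine (bd_sqr_integral D w (fun=> 0)))%:E + e%:E) + J%:E))%E).
    apply: leeD => //; apply: lee_wpmul2l; first by rewrite lee_fin mulr_ge0// ltW.
    exact: leeD.
  rewrite -!EFinM -!EFinD lee_fin le_eqVlt /=; apply/orP; left; apply/eqP.
  by ring.
have K0 : 0 <= fine (leb n.+1 D) + 2 * M.
  by rewrite addr_ge0 ?fine_ge0// mulr_ge0// ltW.
apply: (le_trans (ler_of_eps K0 key)).
rewrite mulrDr mulrA lerD2l.
have := partial_le_grad cw => pg.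
have NN : 0 <= N2 w by exact: Lp_norm_ge0.
apply: (@le_trans _ _ (2 * M * (2 * (N2 w * N2 (partial ord0 w))))).
  by rewrite ler_wpM2l// mulr_ge0// ltW.
have -> : 2 * M * (2 * (N2 w * N2 (partial ord0 w))) =
  4 * M * N2 w * N2 (partial ord0 w) by ring.
by rewrite ler_wpM2l// !mulr_ge0// ltW.
Qed.

Lemma grad_norm_add_sqr_le v w : H1 D v -> H1 D w ->
  L2v_norm D (grad D w) ^+ 2 <=
  2 * L2v_norm D (grad D v) ^+ 2 + 2 * H1_norm D (w \- v) ^+ 2.
Proof.
move=> hv hw.
have hwv : H1 D (w \- v).
  have := H1_lin oD bD 1 (-1) hw hv.
  by congr H1; apply/funext => x; rewrite mul1r mulN1r.
have E : w = (fun x => 1 * (w \- v) x + 1 * v x).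
  by apply/funext => x; rewrite !mul1r /= subrK.
have ae := grad_lin oD bD 1 1 hwv hv.
rewrite -E in ae.
rewrite (L2v_norm_eq_ae oD _ _ ae); last 2 first.
- exact: grad_L2v.
- by apply: L2v_lin => //; exact: grad_L2v.
apply: (le_trans (L2v_norm_lin_sqr_le oD 1 1 (grad_L2v hwv) (grad_L2v hv))).
rewrite expr1n !mulr1 [leLHS]addrC; apply: lerD; first exact: lexx.
apply: ler_wpM2l => //.
by rewrite lerXn2r ?nnegrE ?Lp_norm_ge0 ?H1_norm_ge0// grad_norm_le_H1.
Qed.

Lemma Lp2_norm_add_sqr_le v w : H1 D v -> H1 D w ->
  N2 v ^+ 2 <= 2 * N2 w ^+ 2 + 2 * H1_norm D (w \- v) ^+ 2.
Proof.
move=> hv hw.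
have hwv : H1 D (w \- v).
  have := H1_lin oD bD 1 (-1) hw hv.
  by congr H1; apply/funext => x; rewrite mul1r mulN1r.
have E : v = (fun x => 1 * w x + (-1) * (w \- v) x).
  by apply/funext => x /=; ring.
rewrite [X in N2 X ^+ 2 <= _]E.
apply: (le_trans (Lp2_norm_lin_sqr_le oD 1 (-1) (H1_Lp2 hw) (H1_Lp2 hwv))).
rewrite sqrrN expr1n !mulr1 lerD2l ler_wpM2l//.
by rewrite lerXn2r ?nnegrE ?Lp_norm_ge0 ?H1_norm_ge0// Lp2_norm_le_H1.
Qed.

(** Origin of 64, up to terms tending to 0: absorbing the mixed term gives [Nw^2 <= 16 M^2 G^2];
    passing from [w k] to [v] costs a factor 2 for the function and 2 for its gradient. The 1
    accounts for the gradient part of the H^1 norm. *)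
Lemma H10_poincare v : H10 D v ->
  H1_norm D v ^+ 2 <= (64 * M ^+ 2 + 1) * L2v_norm D (grad D v) ^+ 2.
Proof.
move=> [hv [_ _ [w [cw wv wI]]]].
suff : N2 v ^+ 2 <= 64 * M ^+ 2 * L2v_norm D (grad D v) ^+ 2.
  move=> h; rewrite [leLHS]H1_norm_sqr mulrDl mul1r.
  apply: lerD; first exact: h.
  exact: lexx.
set b := 2 * M * 2 ^+ n.
have b0 : 0 <= b by rewrite /b !mulr_ge0 ?exprn_ge0// ltW.
have K0 : 0 <= 4 * b + 64 * M ^+ 2 + 2.
  by rewrite !addr_ge0// mulr_ge0// sqr_ge0.
apply: (ler_of_eps K0) => e e0.
(* A norm below [min e 1] has its square below [e]. *)
pose e1 := Num.min e 1.
have e10 : 0 < e1 by rewrite /e1 lt_min e0 ltr01.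
have [k [Ioo Ik ek]] : exists k, [/\ (bd_sqr_integral D (w k) (fun=> 0%R) < +oo)%E,
    fine (bd_sqr_integral D (w k) (fun=> 0%R)) < e & H1_norm D (w k \- v) < e1].
  (* Convergence to 0 in the extended reals makes the boundary integrals eventually finite, as
     [C1_poincare] requires. *)
  have [If I0] := (fine_cvgP _ _).1 wI.
  have [k [fk [Ik ek]]] :=
    filter_ex (filterI If (filterI (cvgr_lt 0 I0 e e0) (cvgr_lt 0 wv e1 e10))).
  exists k; split => //.
  by rewrite -ge0_fin_numE ?bd_sqr_integral_ge0.
have := Lp2_norm_add_sqr_le hv (C1_H1 oD bD (cw k)).
have := grad_norm_add_sqr_le hv (C1_H1 oD bD (cw k)).
have := C1_poincare (cw k) Ioo; rewrite -/b.
have ek2 : H1_norm D (w k \- v) ^+ 2 <= e.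
  rewrite expr2; apply: (@le_trans _ _ (e1 * 1)).
    by apply: ler_pM; rewrite ?H1_norm_ge0 ?(ltW ek)// (le_trans (ltW ek))// ge_min lexx orbT.
  by rewrite mulr1 ge_min lexx.
have bI : b * fine (bd_sqr_integral D (w k) (fun=> 0%R)) <= b * e.
  by rewrite ler_wpM2l// ltW.
move: ek2 bI; set E2 := H1_norm D _ ^+ 2; set I0 := b * fine _.
set G := L2v_norm D (grad D (w k)); set g2 := L2v_norm D (grad D v) ^+ 2.
set Nw := N2 (w k); set Nv := N2 v ^+ 2.
move: E2 I0 G g2 Nw Nv => E2 I0 G g2 Nw Nv ek2 bI h1 h2 h3.
(* Young's inequality, weighted so that [4 M Nw G] takes only half of [Nw ^+ 2]. *)
have h4 := sqr_ge0 (Nw - 4 * M * G).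
have h5 : M ^+ 2 * G ^+ 2 <= M ^+ 2 * (2 * g2 + 2 * E2) by rewrite ler_wpM2l ?sqr_ge0.
have h6 : M ^+ 2 * E2 <= M ^+ 2 * e by rewrite ler_wpM2l ?sqr_ge0.
have -> : 64 * M ^+ 2 * g2 + e * (4 * b + 64 * M ^+ 2 + 2) =
  64 * (M ^+ 2 * g2) + 4 * (b * e) + 64 * (M ^+ 2 * e) + 2 * e by ring.
have {}h4 : 8 * (M * Nw * G) <= Nw ^+ 2 + 16 * (M ^+ 2 * G ^+ 2).
  by rewrite -subr_ge0; apply: le_trans h4 _; rewrite le_eqVlt; apply/orP; left;
    apply/eqP; ring.
have {}h1 : Nw ^+ 2 <= I0 + 4 * (M * Nw * G) by rewrite !mulrA.
have {}h5 : M ^+ 2 * G ^+ 2 <= 2 * (M ^+ 2 * g2) + 2 * (M ^+ 2 * E2).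
  by apply: le_trans h5 _; rewrite le_eqVlt; apply/orP; left; apply/eqP; ring.
move: h1 h3 h4 h5 h6 bI ek2.
move: (M * Nw * G) (Nw ^+ 2) (M ^+ 2 * G ^+ 2) (M ^+ 2 * g2) (M ^+ 2 * E2) (M ^+ 2 * e) (b * e).
by move=> *; lra.
Qed.

End poincare.

(** * Dual norms and energy estimates *)

Section dual_norms.
Context {R : realType} {n : nat}.
Variable D : set 'rV[R]_n.
Hypotheses (oD : open D) (bD : bounded_set D).
Local Notation fn := ('rV[R]_n -> R).
Variable V : set fn.
Hypotheses (VH1 : V `<=` H1 D)
  (Vlin : forall a b v w, V v -> V w -> V (fun x => a * v x + b * w x)).
Variable l : fn -> R.
Hypothesis dl : dual D V l.
Implicit Types v w : fn.

Lemma dual_scale a v : V v -> l (fun x => a * v x) = a * l v.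
Proof.
case: dl => lin _ Vv.
have V0 : V (fun=> 0).
  have := Vlin 0 0 Vv Vv; congr V; apply/funext => x.
  by rewrite !mul0r addr0.
have l0 : l (fun=> 0) = 0.
  have := lin 1 _ _ V0 V0.
  rewrite (_ : (fun x => 1 * 0 + 0) = (fun=> 0)); last first.
    by apply/funext => x; rewrite mulr0 addr0.
  by rewrite mul1r; lra.
have := lin a _ _ Vv V0; rewrite l0 addr0 => <-.
by congr l; apply/funext => x; rewrite addr0.
Qed.

Lemma dual_sub v w : V v -> V w -> l (v \- w) = l v - l w.
Proof.
move=> Vv Vw; case: dl => lin _.
have := lin (-1) _ _ Vw Vv; rewrite mulN1r addrC => <-.
by congr l; apply/funext => x /=; ring.
Qed.

Let S := [set `|l v| | v in [set v | V v /\ H1_norm D v <= 1]].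

Let S_ub : has_ubound S.
Proof.
case: dl => _ [M lM]; exists `|M| => _ [v [Vv v1] <-].
apply: (le_trans (lM _ Vv)); apply: (@le_trans _ _ (`|M| * H1_norm D v)).
  by rewrite ler_wpM2r ?H1_norm_ge0// ler_norm.
by rewrite ler_piMr.
Qed.

Lemma dual_norm_ge v : V v -> H1_norm D v <= 1 -> `|l v| <= dual_norm D V l.
Proof. by move=> Vv v1; apply: ub_le_sup; [exact: S_ub|exists v]. Qed.

Lemma H1_norm_0scale v : V v -> V (fun x => 0 * v x) /\ H1_norm D (fun x => 0 * v x) <= 1.
Proof.
move=> Vv; split.
  by have := Vlin 0 0 Vv Vv; congr V; apply/funext => x; rewrite !mul0r addr0.
by rewrite (H1_norm_scale oD bD 0 (VH1 Vv)) normr0 mul0r.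
Qed.

Lemma dual_norm_ge0 v : V v -> 0 <= dual_norm D V l.
Proof.
move=> /H1_norm_0scale[V0 N0]; apply: le_trans (dual_norm_ge V0 N0).
exact: normr_ge0.
Qed.

(** Normalise [v]. When its norm is 0 this is impossible, and the boundedness of [l] directly gives
    [l v = 0]. *)
Lemma dual_le v : V v -> `|l v| <= dual_norm D V l * H1_norm D v.
Proof.
move=> Vv; have := H1_norm_ge0 D v; rewrite le_eqVlt => /orP[/eqP v0|v0].
  case: dl => _ [M lM]; have := lM _ Vv.
  by rewrite -v0 !mulr0.
have Vs : V (fun x => (H1_norm D v)^-1 * v x).
  have := Vlin (H1_norm D v)^-1 0 Vv Vv; congr V; apply/funext => x.
  by rewrite mul0r addr0.
have ni : `|(H1_norm D v)^-1| = (H1_norm D v)^-1 by rewrite gtr0_norm ?invr_gt0.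
have N1 : H1_norm D (fun x => (H1_norm D v)^-1 * v x) <= 1.
  by rewrite (H1_norm_scale oD bD _ (VH1 Vv)) ni mulVf ?gt_eqF.
have := dual_norm_ge Vs N1.
by rewrite dual_scale// normrM ni ler_pdivrMl// mulrC.
Qed.

End dual_norms.

(** * Energy estimates for weak solutions *)

Section energy_estimates.
Context {R : realType} {n : nat}.
Hypothesis n1 : (0 < n.-1)%N.
Variable D : set 'rV[R]_n.
Hypotheses (oD : open D) (bD : bounded_set D).
Local Notation leb := (@lebesgue_rV R n).
Local Notation fn := ('rV[R]_n -> R).
Local Notation vfn := ('rV[R]_n -> 'rV[R]_n).
Local Notation "'I' f" := (\int[leb]_(x in D) f x) (at level 10).
Local Notation gnorm v := (L2v_norm D (grad D v)).
Local Notation Noo := (Lp_norm D +oo%E).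
Variable kap : R.
Hypotheses (kap0 : 0 <= kap)
  (poincare : forall v, H10 D v -> H1_norm D v <= kap * gnorm v).
Implicit Types (u v w p phi : fn) (g G H : vfn).

Let mD : measurable D := open_measurable_rV oD.

(** Factor out the larger exponential and use [1 - exp (-z) <= z]. *)
Lemma expR_sub_le (M a b : R) : a <= M -> b <= M ->
  `|expR a - expR b| <= expR M * `|a - b|.
Proof.
have key (x y : R) : x <= M -> y <= x -> `|expR x - expR y| <= expR M * `|x - y|.
  move=> xM yx; rewrite !ger0_norm ?subr_ge0 ?ler_expR//.
  apply: (@le_trans _ _ (expR x * (x - y))); last first.
    by rewrite ler_wpM2r ?subr_ge0// ler_expR.
  have -> : expR x - expR y = expR x * (1 - expR (y - x)).
    by rewrite mulrBr mulr1 -expRD; congr (_ - expR _); ring.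
  rewrite ler_wpM2l ?expR_ge0//.
  by have := expR_ge1Dx (y - x); lra.
move=> aM bM; have [ba|ab] := leP b a; first exact: key.
by rewrite distrC (distrC a); apply: key => //; exact: ltW.
Qed.

Lemma expR_measurable u : measurable_fun D u -> measurable_fun D (fun x => expR (u x)).
Proof. by move=> mu; exact: measurableT_comp. Qed.

Lemma expR_Loo_bound u : Lp D +oo%E u ->
  {ae leb, forall x, D x -> expR (- Noo u) <= expR (u x) <= expR (Noo u)}.
Proof.
move=> Lu; apply: filterS (Loo_bound Lu) => x h Dx.
by have := h Dx; rewrite ler_norml !ler_expR.
Qed.

Lemma expR_Loo_norm u M : Lp D +oo%E u -> Noo u <= M ->
  {ae leb, forall x, D x -> `|expR (u x)| <= expR M}.
Proof.
move=> Lu uM; apply: filterS (expR_Loo_bound Lu) => x h Dx.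
have /andP[_ h2] := h Dx.
by rewrite gtr0_norm ?expR_gt0// (le_trans h2)// ler_expR.
Qed.

Lemma weighted_gradient_ge u M G : Lp D +oo%E u -> Noo u <= M -> L2v D G ->
  expR (- M) * L2v_norm D G ^+ 2 <= I (fun x => expR (u x) * dotv (G x) (G x)).
Proof.
move=> Lu uM G2; rewrite L2v_norm_sqr//.
have j := dotv_integrable mD G2 G2.
have := I_lin mD (expR (- M)) 0 j j; rewrite mul0r addr0 => <-.
apply: (I_le mD).
- exact: integ_lin.
- apply: (weighted_dotv_integrable mD _ (expR_Loo_norm Lu (lexx _))) => //.
  by apply: expR_measurable; case: Lu.
apply: filterS (expR_Loo_bound Lu) => x h Dx; rewrite mul0r addr0.
have /andP[h1 _] := h Dx; rewrite ler_wpM2r ?dotv_ge0//.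
by rewrite (le_trans _ h1)// ler_expR lerN2.
Qed.

(** Used to isolate the coercive term: gradients are chosen representatives, so
    [grad p = grad v + grad w] holds only almost everywhere. *)
Lemma weighted_dotv_split (c : fn) M v w p G : measurable_fun D c ->
  {ae leb, forall x, D x -> `|c x| <= M} -> H1 D v -> H1 D w -> H1 D p -> L2v D G ->
  {ae leb, forall x, D x -> grad D v x = grad D p x - grad D w x} ->
  I (fun x => c x * dotv (grad D p x) (G x)) =
  I (fun x => c x * dotv (grad D v x) (G x)) + I (fun x => c x * dotv (grad D w x) (G x)).
Proof.
move=> mc cM hv hw hp G2 ae.
have jv := weighted_dotv_integrable mD mc cM (grad_L2v hv) G2.
have jw := weighted_dotv_integrable mD mc cM (grad_L2v hw) G2.
have jp := weighted_dotv_integrable mD mc cM (grad_L2v hp) G2.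
transitivity (1 * I (fun x => c x * dotv (grad D v x) (G x)) +
    1 * I (fun x => c x * dotv (grad D w x) (G x))); last first.
  by congr (_ + _); exact: mul1r.
apply: etrans (I_lin mD 1 1 jv jw).
apply: I_eq_ae => //.
- by apply/measurable_EFinP; exact: measurable_int jp.
- by apply/measurable_EFinP; exact: measurable_int (integ_lin mD 1 1 jv jw).
apply: filterS ae => x h Dx.
have -> : grad D p x = 1 *: grad D v x + 1 *: grad D w x.
  by rewrite !scale1r (h Dx) subrK.
by rewrite dotv_linl; ring.
Qed.

Lemma grad_sub v w : H1 D v -> H1 D w ->
  {ae leb, forall x, D x -> grad D (v \- w) x = grad D v x - grad D w x}.
Proof.
move=> hv hw; have := grad_lin oD bD 1 (-1) hv hw.
rewrite (_ : (fun x => 1 * v x + -1 * w x) = v \- w); last first.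
  by apply/funext => x; rewrite mul1r mulN1r.
by apply: filterS => x h Dx; rewrite (h Dx) scale1r scaleN1r.
Qed.

Lemma H10_H1 : H10 D `<=` H1 D.
Proof. by move=> v []. Qed.

Lemma ler_sqr_cancel (a G B : R) : 0 < a -> 0 <= G -> 0 <= B ->
  a * G ^+ 2 <= B * G -> G <= a^-1 * B.
Proof.
move=> a0 G0 B0 h; have [->|Gn] := eqVneq G 0.
  by rewrite mulr_ge0// invr_ge0 ltW.
have Gp : 0 < G by rewrite lt_neqAle eq_sym Gn.
by rewrite ler_pdivlMl// -(ler_pM2r Gp) -mulrA -expr2.
Qed.

(** The norm of [f] carries the Poincare constant because [f] is bounded by the full H^1 norm of the
    test function, while [g] acts on its gradient. *)
Definition data_bound (A B P : R) : R := kap * A + B + P.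

Lemma gradient_estimate u (f : fn -> R) g phi p : Lp D +oo%E u ->
  dual D (H10 D) f -> L2v D g -> H1 D phi -> weak_solution D u f g phi p ->
  H10 D (p \- phi) /\
  gnorm (p \- phi) <= expR (2 * Noo u) *
    data_bound (dual_norm D (H10 D) f) (L2v_norm D g) (H1_norm D phi).
Proof.
move=> Lu df g2 hphi [hp tp wp].
have v0 := eq_trace_H10 n1 oD bD hp hphi tp; split => //.
set v := p \- phi in v0 *; have [hv _] := v0.
have gv2 := grad_L2v hv.
have mu : measurable_fun D (fun x => expR (u x)) by apply: expR_measurable; case: Lu.
have uM := expR_Loo_norm Lu (lexx _).
have E := wp _ v0.
rewrite (weighted_dotv_split mu uM hv hphi hp gv2 (grad_sub hp hphi)) in E.
have c1 := weighted_gradient_ge Lu (lexx _) gv2.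
have c2 := weighted_cauchy_schwarz mD mu uM (grad_L2v hphi) gv2 (expR_ge0 _).
have c3 := L2v_cauchy_schwarz mD g2 gv2.
have c4 := dual_le oD bD H10_H1 (H10_lin n1 oD bD) df v0.
have A0 := dual_norm_ge0 oD bD H10_H1 (H10_lin n1 oD bD) df v0.
have c5 := poincare v0.
have c6 := grad_norm_le_H1 D phi.
have G0 : 0 <= gnorm v by exact: Lp_norm_ge0.
have B0 : 0 <= L2v_norm D g by exact: Lp_norm_ge0.
have P0 := H1_norm_ge0 D phi.
have M0 : 0 <= Noo u by exact: Lp_norm_ge0.
move: E c1 c2 c3 c4 A0 c5 c6 G0 B0 P0 M0.
set X1 := I (fun x => expR (u x) * dotv (grad D v x) (grad D v x)).
set X2 := I (fun x => expR (u x) * dotv (grad D phi x) (grad D v x)).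
set X3 := I (fun x => dotv (g x) (grad D v x)).
move: (gnorm v) (gnorm phi) (H1_norm D phi) (H1_norm D v) (f v) (L2v_norm D g)
  (dual_norm D (H10 D) f) (Noo u) X1 X2 X3.
move=> G Gp P N fv B A M X1 X2 X3 E c1 c2 c3 c4 A0 c5 c6 G0 B0 P0 M0.
have e1 : 1 <= expR M by rewrite -expR0 ler_expR.
(* The weak formulation tested with [v = p - phi]: the three summands bound the contributions of
   [f], [g] and the lifting [phi], the last weighted by the coefficient. *)
have h : expR (- M) * G ^+ 2 <= (kap * A + B + expR M * P) * G.
  apply: (le_trans c1).
  have -> : X1 = fv - X3 - X2 by rewrite -E; ring.
  apply: (@le_trans _ _ (`|fv| + `|X3| + `|X2|)).
    have := ler_norm fv; have := ler_norm (- X3); have := ler_norm (- X2).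
    by rewrite !normrN; lra.
  rewrite !mulrDl; apply: lerD.
    apply: lerD => //; apply: (le_trans c4).
    by rewrite (mulrC kap) -mulrA ler_wpM2l.
  apply: (le_trans c2); rewrite -mulrA ler_wpM2l ?expR_ge0//.
  by rewrite ler_wpM2r.
have K0 : 0 <= kap * A + B + expR M * P.
  by rewrite !addr_ge0 ?mulr_ge0// expR_ge0.
apply: (le_trans (ler_sqr_cancel (expR_gt0 _) G0 K0 h)).
(* One [expR M] comes from coercivity; the other, needed for [phi] only, is granted to all the
   data. *)
rewrite -expRN opprK mulr_natl mulr2n expRD -mulrA ler_wpM2l ?expR_ge0//.
rewrite /data_bound mulrDr lerD2r.
by rewrite ler_peMl// addr_ge0// mulr_ge0.
Qed.

(** The leading 2 is the factor lost by [H1_norm_lin_le] on [p = (p - phi) + phi]. *)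
Definition solution_bound (A B P : R) : R := 2 * (kap * data_bound A B P + P).

Lemma solution_estimate u (f : fn -> R) g phi p : Lp D +oo%E u ->
  dual D (H10 D) f -> L2v D g -> H1 D phi -> weak_solution D u f g phi p ->
  H1_norm D p <= expR (2 * Noo u) *
    solution_bound (dual_norm D (H10 D) f) (L2v_norm D g) (H1_norm D phi).
Proof.
move=> Lu df g2 hphi wp; have [v0 Gv] := gradient_estimate Lu df g2 hphi wp.
have Nv := poincare v0.
have hv := H10_H1 v0.
have E : p = (fun x => 1 * (p \- phi) x + 1 * phi x).
  by apply/funext => x /=; ring.
have := H1_norm_lin_le oD bD 1 1 hv hphi; rewrite -{1}E => h'.
have {h'} : H1_norm D p <= 2 * (H1_norm D (p \- phi) + H1_norm D phi).
  move: h'; move: (H1_norm D p) (H1_norm D (p \- phi)) (H1_norm D phi) => a b c.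
  by rewrite normr1 !mul1r.
have M0 : 0 <= Noo u by exact: Lp_norm_ge0.
have e1 : 1 <= expR (2 * Noo u) by rewrite -expR0 ler_expR mulr_ge0.
have P0 := H1_norm_ge0 D phi.
move: Nv Gv e1 P0; rewrite /solution_bound; set DB := data_bound _ _ _.
move: (H1_norm D p) (H1_norm D (p \- phi)) (gnorm (p \- phi)) (H1_norm D phi)
  (expR _) DB => N V G P e DB Nv Gv e1 P0 h.
apply: (le_trans h); rewrite mulrCA ler_pM2l// mulrDr; apply: lerD.
  by apply: (le_trans Nv); rewrite mulrCA ler_wpM2l.
by rewrite ler_peMl.
Qed.

Lemma difference_estimate u1 u2 (f : fn -> R) g phi p1 p2 :
  Lp D +oo%E u1 -> Lp D +oo%E u2 -> dual D (H10 D) f -> L2v D g -> H1 D phi ->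
  weak_solution D u1 f g phi p1 -> weak_solution D u2 f g phi p2 ->
  H1_norm D (p1 \- p2) <= expR (4 * Num.max (Noo u1) (Noo u2)) *
    (kap * solution_bound (dual_norm D (H10 D) f) (L2v_norm D g) (H1_norm D phi)) *
    Noo (u1 \- u2).
Proof.
move=> Lu1 Lu2 df g2 hphi wp1 wp2.
have [v1 _] := gradient_estimate Lu1 df g2 hphi wp1.
have [v2 _] := gradient_estimate Lu2 df g2 hphi wp2.
have sp2 := solution_estimate Lu2 df g2 hphi wp2.
have [hp1 _ w1] := wp1; have [hp2 _ w2] := wp2.
have q0 : H10 D (p1 \- p2).
  have := H10_lin n1 oD bD 1 (-1) v1 v2; congr H10.
  by apply/funext => x /=; ring.
have hq := H10_H1 q0; have gq2 := grad_L2v hq.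
set M := Num.max _ _.
have M1 : Noo u1 <= M by rewrite le_max lexx.
have M2 : Noo u2 <= M by rewrite le_max lexx orbT.
have mu1 : measurable_fun D (fun x => expR (u1 x)) by apply: expR_measurable; case: Lu1.
have mu2 : measurable_fun D (fun x => expR (u2 x)) by apply: expR_measurable; case: Lu2.
have uM1 := expR_Loo_norm Lu1 M1; have uM2 := expR_Loo_norm Lu2 M2.
have E1 := w1 _ q0; have E2 := w2 _ q0.
(* In the equation for [u1], split [grad p1] into [grad (p1 - p2)] and [grad p2]. *)
rewrite (weighted_dotv_split mu1 uM1 hq hp2 hp1 gq2 (grad_sub hp1 hp2)) in E1.
have c1 := weighted_gradient_ge Lu1 M1 gq2.
have md : measurable_fun D (fun x => expR (u2 x) - expR (u1 x)) by exact: measurable_funB.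
have dM : {ae leb, forall x, D x ->
    `|expR (u2 x) - expR (u1 x)| <= expR M * Noo (u1 \- u2)}.
  have b12 := Loo_bound (Loo_sub Lu1 Lu2).
  apply: filterS2 (filterI (Loo_bound Lu1) (Loo_bound Lu2)) b12 => x [h1 h2] h12 Dx.
  rewrite distrC; apply: (@le_trans _ _ (expR M * `|u1 x - u2 x|)).
    by apply: expR_sub_le; [apply: le_trans (ler_norm _) (le_trans (h1 Dx) M1)
      |apply: le_trans (ler_norm _) (le_trans (h2 Dx) M2)].
  by rewrite ler_wpM2l ?expR_ge0//; exact: h12.
have d0 : 0 <= Noo (u1 \- u2) by exact: Lp_norm_ge0.
have c2 := weighted_cauchy_schwarz mD md dM (grad_L2v hp2) gq2
  (mulr_ge0 (expR_ge0 _) d0).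
have j1 := weighted_dotv_integrable mD mu1 uM1 (grad_L2v hp2) gq2.
have j2 := weighted_dotv_integrable mD mu2 uM2 (grad_L2v hp2) gq2.
have E3 : I (fun x => (expR (u2 x) - expR (u1 x)) * dotv (grad D p2 x) (grad D (p1 \- p2) x)) =
   I (fun x => expR (u2 x) * dotv (grad D p2 x) (grad D (p1 \- p2) x)) -
   I (fun x => expR (u1 x) * dotv (grad D p2 x) (grad D (p1 \- p2) x)).
  have := I_lin mD 1 (-1) j2 j1; rewrite mul1r mulN1r => <-.
  by apply: eq_Rintegral => x _; ring.
(* Both equations have the same right-hand side, so the term with the difference of coefficients
   equals the coercive term, which [c2] therefore bounds. *)
rewrite {}E3 E2 -E1 addrK in c2.
have c5 := poincare q0; have c6 := grad_norm_le_H1 D p2.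
have G0 : 0 <= gnorm (p1 \- p2) by exact: Lp_norm_ge0.
have P0 : 0 <= gnorm p2 by exact: Lp_norm_ge0.
have M0 : 0 <= Noo u2 by exact: Lp_norm_ge0.
have SB : 0 <= solution_bound (dual_norm D (H10 D) f) (L2v_norm D g) (H1_norm D phi).
  have := le_trans (H1_norm_ge0 D p2) sp2.
  by rewrite pmulr_rge0// expR_gt0.
move: sp2 SB; set SB := solution_bound _ _ _ => sp2 SB0.
have gp2 : gnorm p2 <= expR (2 * M) * SB.
  apply: (le_trans c6); apply: (le_trans sp2); rewrite ler_wpM2r//.
  by rewrite ler_expR ler_wpM2l.
move: c1 c2 c5 G0 P0 gp2 d0; clear E1 E2 dM.
set X := I (fun x => _).
move: (gnorm (p1 \- p2)) (H1_norm D (p1 \- p2)) (gnorm p2) (Noo (u1 \- u2)) X.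
move=> Q N Gp del X c1 c2 c5 Q0 Gp0 gp2 d0.
have h : expR (- M) * Q ^+ 2 <= (expR M * del * Gp) * Q.
  by apply: (le_trans c1); apply: (le_trans (ler_norm _)); rewrite -mulrA.
have K0 : 0 <= expR M * del * Gp by rewrite !mulr_ge0 ?expR_ge0.
have := ler_sqr_cancel (expR_gt0 _) Q0 K0 h; rewrite -expRN opprK => hQ.
apply: (le_trans c5).
(* In order: coercivity, difference of the exponentials, bound on [p2]. *)
have -> : 4 * M = M + M + 2 * M by ring.
rewrite !expRD.
have -> : expR M * expR M * expR (2 * M) * (kap * SB) * del =
  kap * (expR M * (expR M * del * (expR (2 * M) * SB))) by ring.
rewrite ler_wpM2l//; apply: (le_trans hQ).
rewrite ler_wpM2l ?expR_ge0// ler_wpM2l// mulr_ge0// expR_ge0.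
Qed.

End energy_estimates.

(** The factor [K] instead of its square root is enough, by [K <= K ^ 2] on naturals. *)
Lemma enorm_le (R : realType) (K : nat) (x : 'rV[R]_K) (B : R) : 0 <= B ->
  (forall j, `|x ord0 j| <= B) -> enorm x <= K%:R * B.
Proof.
move=> B0 xB; rewrite -(@ler_pXn2r _ 2) ?nnegrE ?enorm_ge0 ?mulr_ge0//.
rewrite enorm_sqr; apply: (@le_trans _ _ (\sum_(i < K) B ^+ 2)).
  apply: ler_sum => i _; rewrite -expr2 -(@real_normK _ (x ord0 i)) ?num_real//.
  by rewrite lerXn2r ?nnegrE.
rewrite sumr_const card_ord exprMn -[leLHS]mulr_natl.
apply: ler_wpM2r; first exact: sqr_ge0.
by rewrite -natrX ler_nat -mulnn; case: (K) => // k; rewrite leq_pmulr.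
Qed.

Lemma H10_poincare_norm (R : realType) (n : nat) (D : set 'rV[R]_n) :
  (0 < n.-1)%N -> open D -> bounded_set D ->
  exists2 kap : R, 0 <= kap &
    forall v, H10 D v -> H1_norm D v <= kap * L2v_norm D (grad D v).
Proof.
case: n D => // n D n0 oD bD; have [M M0 DM] := bounded_in_ball bD.
have K0 : 0 <= 64 * M ^+ 2 + 1 by have := sqr_ge0 M; lra.
exists (Num.sqrt (64 * M ^+ 2 + 1)); first exact: sqrtr_ge0.
move=> v v0; have := H10_poincare n0 oD M0 DM v0.
have := H1_norm_ge0 D v; have : 0 <= L2v_norm D (grad D v) by exact: Lp_norm_ge0.
move: (H1_norm D v) (L2v_norm D (grad D v)) => N G G0 N0 h.
by rewrite -(@ler_pXn2r _ 2) ?nnegrE ?mulr_ge0 ?sqrtr_ge0// exprMn sqr_sqrtr.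
Qed.

Theorem corollary3p2 (R : realType) (d : nat) (d23 : d = 2%N \/ d = 3%N)
  (D : set 'rV[R]_d) (Dopen : open D) (Dbounded : bounded_set D)
  (Dconnected : connected D) (DC1 : C1_boundary D) (K : nat) :
  exists C : R -> R -> R -> R -> R,
  forall (f : ('rV[R]_d -> R) -> R) (g : 'rV[R]_d -> 'rV[R]_d)
    (phi : 'rV[R]_d -> R) (l : 'I_K -> ('rV[R]_d -> R) -> R),
  dual D (H10 D) f -> L2v D g -> H1 D phi ->
  (forall j, dual D (H1 D) (l j)) ->
  let c := C (dual_norm D (H10 D) f) (L2v_norm D g) (H1_norm D phi)
             (\big[Num.max/0]_(j < K) dual_norm D (H1 D) (l j)) in
  (forall u p, Lp D +oo%E u -> weak_solution D u f g phi p ->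
    enorm (observe l p) <= c * expR (2 * Lp_norm D +oo%E u)) /\
  (forall u1 u2 p1 p2, Lp D +oo%E u1 -> Lp D +oo%E u2 ->
    weak_solution D u1 f g phi p1 -> weak_solution D u2 f g phi p2 ->
    enorm (observe l p1 - observe l p2) <=
      c * expR (4 * Num.max (Lp_norm D +oo%E u1) (Lp_norm D +oo%E u2))
        * Lp_norm D +oo%E (u1 \- u2)).
Proof.
have n1 : (0 < d.-1)%N by case: d23 => ->.
have [kap kap0 poincare] := H10_poincare_norm n1 Dopen Dbounded.
pose SB := solution_bound kap.
(* One constant must serve both estimates, which involve [SB] and [kap * SB]; [kap + 1] dominates
   both factors. [K * m] passes from the components to the Euclidean norm. *)
exists (fun A B P m => K%:R * m * ((kap + 1) * SB A B P)).
move=> f g phi l df g2 hphi dl.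
set A := dual_norm D (H10 D) f; set B := L2v_norm D g; set P := H1_norm D phi.
set m := \big[Num.max/0]_(j < K) _; move=> c.
have m0 : 0 <= m.
  by rewrite /m; exact: bigmax_ge_id.
have lm v j : H1 D v -> `|l j v| <= m * H1_norm D v.
  move=> hv; apply: (le_trans (dual_le Dopen Dbounded _ _ (dl j) hv)).
  - by [].
  - by move=> a b v' w'; exact: H1_lin.
  by apply: ler_wpM2r; [exact: H1_norm_ge0|exact: le_bigmax].
have bound (X : R) (x : 'rV[R]_K) : 0 <= X -> (forall j, `|x ord0 j| <= m * X) ->
    enorm x <= K%:R * m * X.
  by move=> X0 h; rewrite -mulrA; apply: enorm_le => //; exact: mulr_ge0.
have est1 u p : Lp D +oo%E u -> weak_solution D u f g phi p ->
    H1_norm D p <= expR (2 * Lp_norm D +oo%E u) * SB A B P.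
  by move=> Lu wp; exact: (solution_estimate n1 Dopen Dbounded kap0 poincare Lu df
    g2 hphi wp).
have est2 u1 u2 p1 p2 : Lp D +oo%E u1 -> Lp D +oo%E u2 ->
    weak_solution D u1 f g phi p1 -> weak_solution D u2 f g phi p2 ->
    H1_norm D (p1 \- p2) <=
      expR (4 * Num.max (Lp_norm D +oo%E u1) (Lp_norm D +oo%E u2)) *
      (kap * SB A B P) * Lp_norm D +oo%E (u1 \- u2).
  move=> Lu1 Lu2 wp1 wp2.
  exact: (difference_estimate n1 Dopen Dbounded kap0 poincare Lu1 Lu2
    df g2 hphi wp1 wp2).
rewrite /c; move: (SB A B P) est1 est2 => S est1 est2 {c}.
(* The sign of the constant is read off from the estimate itself, since an H^1 norm is
   nonnegative. *)
have S0 u p : Lp D +oo%E u -> weak_solution D u f g phi p -> 0 <= S.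
  move=> Lu wp; have := le_trans (H1_norm_ge0 D p) (est1 _ _ Lu wp).
  by rewrite pmulr_rge0 ?expR_gt0.
have kap1 : 0 <= kap + 1 by rewrite addr_ge0.
split=> [u p Lu wp|u1 u2 p1 p2 Lu1 Lu2 wp1 wp2].
  have s0 := S0 _ _ Lu wp; have [hp _ _] := wp.
  rewrite -mulrA; apply: bound => [|j].
    by rewrite !mulr_ge0 ?expR_ge0.
  rewrite mxE; apply: (le_trans (lm _ _ hp)); apply: ler_wpM2l => //.
  apply: (le_trans (est1 _ _ Lu wp)); rewrite mulrC.
  apply: ler_wpM2r; first exact: expR_ge0.
  by rewrite mulrDl mul1r lerDr mulr_ge0.
have s0 := S0 _ _ Lu1 wp1; have [hp1 _ _] := wp1; have [hp2 _ _] := wp2.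
have N0 : 0 <= Lp_norm D +oo%E (u1 \- u2) by exact: Lp_norm_ge0.
have hq : H1 D (p1 \- p2).
  have := H1_lin Dopen Dbounded 1 (-1) hp1 hp2; congr H1.
  by apply/funext => x /=; ring.
have := est2 _ _ _ _ Lu1 Lu2 wp1 wp2.
move: (expR _) (expR_ge0 (4 * Num.max (Lp_norm D +oo%E u1) (Lp_norm D +oo%E u2)))
  (Lp_norm D _ _) N0 => e e0 N N0 est.
have -> : K%:R * m * ((kap + 1) * S) * e * N = K%:R * m * ((kap + 1) * S * e * N).
  by ring.
apply: bound => [|j]; first by rewrite !mulr_ge0.
rewrite !mxE -(dual_sub (dl j) hp1 hp2).
apply: (le_trans (lm _ _ hq)); apply: ler_wpM2l => //; apply: (le_trans est).
rewrite (mulrC e); apply: ler_wpM2r => //; apply: ler_wpM2r => //.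
by rewrite mulrDl mul1r lerDl.
Qed.
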